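(* Let $d\ge2$ and let $\overline K\subset\mathbb R^d$ be a convex body of class $\mathcal C^2_+$. For $\lambda>0$ consider $\mathbb R^d$ as a projective model of an open half-space of $\mathrm{Sp}^d(\lambda)$. Then $$\lim_{\lambda\to0^+}E_C^\lambda(\overline K)=E_C(\overline K)\qquad\text{and}\qquad\lim_{\lambda\to1}E_C^\lambda(\overline K)=E^s(\overline K).$$
   Context: For $\lambda>0$, $\mathrm{Sp}^d(\lambda)$ is the space form of dimension $d$ and constant curvature $\lambda$, modelled as the sphere $\mathbb S^d(\lambda)=\{\mathbf x\in\mathbb R^{d+1}:\mathbf x\cdot\mathbf x=1/\lambda\}$; $\mathrm{Sp}^d(1)=\mathbb S^d$. The open half-space centered at $\mathbf o$ is the open geodesic ball of radius $\frac\pi{2\sqrt\lambda}$ around $\mathbf o$; its projective model is given by the gnomonic projection $g_{\mathbf o}^\lambda$, which maps the point at distance $r<\frac\pi{2\sqrt\lambda}$ from $\mathbf o$ in unit direction $\mathbf u\in\mathbf o^\perp\cong\mathbb R^d$ to $\frac{\tan(\sqrt\lambda r)}{\sqrt\lambda}\,\mathbf u\in\mathbb R^d$. A functional evaluated at $\overline K$ means its value at the preimage $K=(g_{\mathbf o}^\lambda)^{-1}(\overline K)\subset\mathrm{Sp}^d(\lambda)$ (for $E^s$: the preimage in $\mathbb S^d$). Class $\mathcal C^2_+$: the boundary is a $\mathcal C^2$-smooth embedded hypersurface with everywhere strictly positive Gauss–Kronecker curvature. Dual body in $\mathrm{Sp}^d(\lambda)$: $K^*=\{\mathbf v\in\mathbb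 S^d(\lambda):\mathbf v\cdot\mathbf u\ge0\ \forall\mathbf u\in K\}$. For $q\ge0$, $\Omega_q^\lambda(K)=\int_{\partial K}H_{d-1}^\lambda(K,\mathbf u)^{\frac q{d+q}}\,\mathrm{vol}_{\partial K}^\lambda(d\mathbf u)$ and $P^\lambda(K)=\Omega_0^\lambda(K)$, where $H_{d-1}^\lambda(K,\cdot)$ is the Gauss–Kronecker curvature of $\partial K$ in $\mathrm{Sp}^d(\lambda)$ and $\mathrm{vol}_{\partial K}^\lambda$ the $(d-1)$-dimensional Hausdorff measure on $\partial K$. Define $$\mathcal E^\lambda(K)=\lambda^{-(d-1)}\lim_{q\to0^+}\left(\frac{\Omega_q^\lambda(K^* )}{P^\lambda(K^* )}\right)^{1+\frac dq},\qquad E_C^\lambda(K)=-\log\mathcal E^\lambda(K).$$ The spherical curvature entropy of $K\subset\mathbb S^d$ is $E^s(K)=-\log\lim_{q\to0^+}\left(\frac{\Omega_q^1(K^* )}{P^1(K^* )}\right)^{1+\frac dq}$. The Gaussian entropy of a convex body $\overline K\subset\mathbb R^d$ of class $\mathcal C^2_+$ is $$E_C(\overline K)=\frac1{\omega_{d-1}}\int_{\partial\overline K}H_{d-1}^e(\overline K,\mathbf x)\,[\log H_{d-1}^e(\overline K,\mathbf x)]\,\mathrm{vol}_{\partial\overline K}^e(d\mathbf x),$$ with $H_{d-1}^e$ the Euclidean Gauss–Kronecker curvature, $\mathrm{vol}_{\partial\overline K}^e$ the surface area measure and $\omega_{d-1}$ the total surface area of $\mathbb S^{d-1}$. *)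

(* Defs.v *)
From HB Require Import structures.
From mathcomp Require Import all_boot all_order all_algebra.
From mathcomp Require Import all_classical all_reals all_analysis.
Import Order.TTheory GRing.Theory Num.Theory.
Import numFieldNormedType.Exports.

Set Implicit Arguments.
Unset Strict Implicit.
Unset Printing Implicit Defensive.

Local Open Scope classical_set_scope.
Local Open Scope ring_scope.

(* The norm carried by ['rV[R]_n] in the library is the sup norm: it is used
   below only through the topology it induces. Lengths and angles are always
   measured with [dot] and [enorm]. *)
Definition dot (R : realType) (n : nat) (u v : 'rV[R]_n) : R :=
  \sum_i u 0 i * v 0 i.

Definition enorm (R : realType) (n : nat) (u : 'rV[R]_n) : R :=
  Num.sqrt (dot u u).

(* Volume of the unit ball of R^m:
   alpha_0 = 1, alpha_1 = 2, alpha_m = (2 pi / m) alpha_(m-2). *)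
Fixpoint ball_volume (R : realType) (m : nat) : R :=
  match m with
  | 0 => 1
  | 1 => 2
  | (k.+1 as k').+1 => 2 * pi / k'.+1%:R * ball_volume R k
  end.

Section hausdorff.
Context (R : realType) (n m : nat).
Local Notation T := 'rV[R]_n.
Implicit Types (A B : set T) (C : (set T)^nat) (delta : R).
Local Open Scope ereal_scope.

(* alpha_m * (diam A / 2) ^ m; the element 0 only matters for A = set0. *)
Definition hausdorff_weight A : \bar R :=
  ereal_sup ([set 0] `|`
    [set (ball_volume R m / 2 ^+ m * enorm (x - y) ^+ m)%:E | x in A & y in A]).

Definition fine_cover delta A : set ((set T)^nat) :=
  [set C | A `<=` \bigcup_k C k /\
    forall k x y, C k x -> C k y -> (enorm (x - y) <= delta)%R].

Definition hausdorff_content delta A : \bar R :=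
  ereal_inf [set \sum_(k <oo) hausdorff_weight (C k) | C in fine_cover delta A].

(* m-dimensional Hausdorff outer measure on R^n, normalized so that it agrees
   with m-dimensional volume. *)
Definition hausdorff A : \bar R :=
  ereal_sup [set hausdorff_content delta A | delta in [set delta | (0 < delta)%R]].

Lemma hausdorff_weight_ge0 A : 0 <= hausdorff_weight A.
Proof. by apply: ereal_sup_ubound; left. Qed.

Lemma hausdorff_weight0 : hausdorff_weight set0 = 0.
Proof.
apply/eqP; rewrite eq_le hausdorff_weight_ge0 andbT.
by apply: ge_ereal_sup => x [->//|[? []]].
Qed.

Lemma hausdorff_content_ge0 delta A : 0 <= hausdorff_content delta A.
Proof.
apply: le_ereal_inf_tmp => _ [C _ <-].
by apply: nneseries_ge0 => k _ _; exact: hausdorff_weight_ge0.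
Qed.

Lemma hausdorff_content0 delta : hausdorff_content delta set0 = 0.
Proof.
apply/eqP; rewrite eq_le hausdorff_content_ge0 andbT.
apply: ereal_inf_lbound; exists (fun=> set0); first by split.
by apply: eseries0 => k _ _; exact: hausdorff_weight0.
Qed.

Lemma le_hausdorff_content delta :
  {homo hausdorff_content delta : A B / A `<=` B >-> A <= B}.
Proof.
move=> A B AB; apply/ereal_inf_le_tmp => _ [C [BC Cd] <-].
by exists C => //; split => //; apply: subset_trans BC.
Qed.

Lemma hausdorff_content_sigma_subadditive delta :
  sigma_subadditive (hausdorff_content delta).
Proof.
move=> A; have [[i ioo]|] :=
    pselect (exists i, hausdorff_content delta (A i) = +oo).
  rewrite (eseries_pinfty _ _ ioo) ?leey// => k _.
  by rewrite -ltNye (lt_le_trans _ (hausdorff_content_ge0 _ _)).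
rewrite -forallNE => Aoo.
suff add2e (e : {posnum R}) : hausdorff_content delta (\bigcup_n A n) <=
    \sum_(i <oo) hausdorff_content delta (A i) + e%:num%:E.
  by apply/lee_addgt0Pr => _/posnumP[].
rewrite (le_trans _ (epsilon_trick _ _ _))//; last first.
  by move=> k; exact: hausdorff_content_ge0.
pose P k (B : (set T)^nat) := fine_cover delta (A k) B /\
  \sum_(j <oo) hausdorff_weight (B j) <=
    hausdorff_content delta (A k) + (e%:num / (2 ^ k.+1)%:R)%:E.
have [G PG] : {G : ((set T)^nat)^nat & forall k, P k (G k)}.
  apply: (@choice _ _ P) => k; rewrite /P /hausdorff_content.
  set S := (X in ereal_inf X); move infS : (ereal_inf S) => iS.
  case: iS infS => [r Sr|Soo|Soo].
  - have en1 : (0 < e%:num / (2 ^ k.+1)%:R)%R by [].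
    have /(lb_ereal_inf_adherent en1) : ereal_inf S \is a fin_num by rewrite Sr.
    move=> [x [B AB muBx] xS].
    by exists B; split => //; rewrite muBx -Sr; exact/ltW.
  - by have := Aoo k; rewrite /hausdorff_content Soo.
  - by have := hausdorff_content_ge0 delta (A k);
      rewrite /hausdorff_content Soo leeNy_eq.
have muG_ge0 x : 0 <= (hausdorff_weight \o uncurry G) x.
  exact: hausdorff_weight_ge0.
apply: (@le_trans _ _ (\esum_(i in setT) (hausdorff_weight \o uncurry G) i)).
  apply: ereal_inf_lbound => /=.
  have /card_esym/ppcard_eqP[f] := card_nat2.
  exists (uncurry G \o f).
    split => [t [i _ At]|k x y /=].
      have [j _ ?] := (PG i).1.1 _ At; exists (f^-1%FUN (i, j)) => //=.
      by rewrite invK ?inE.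
    by case: (f k) => a b; exact: (PG a).1.2.
  rewrite -(esum_pred_image (hausdorff_weight \o uncurry G) _ xpredT) ?[fun=> _]set_true//.
  by rewrite image_eq.
rewrite (_ : esum _ _ = \sum_(i <oo) \sum_(j <oo ) hausdorff_weight (G i j)); last first.
  pose J : nat -> set (nat * nat) := fun i => [set (i, j) | j in setT].
  rewrite (_ : setT = \bigcup_k J k); last first.
    by rewrite predeqE => -[a b]; split => // _; exists a => //; exists b.
  rewrite esum_bigcupT /=; last 2 first.
    - apply/trivIsetP => i j _ _ ij.
      rewrite predeqE => -[a b]; split => //= -[] [_] _ [<-{a} _].
      by move=> [m' _] [] /esym/eqP; rewrite (negbTE ij).
    - by move=> x; exact: muG_ge0.
  rewrite -(image_id [set: nat]) -fun_true esum_pred_image//; last first.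
    by move=> k _; apply: esum_ge0 => x _; exact: muG_ge0.
  apply: eq_eseriesr => /= j _.
  rewrite -(esum_pred_image (hausdorff_weight \o uncurry G) (pair j) predT)//=; last 2 first.
    - by move=> k _; exact: (muG_ge0 (j, k)).
    - by move=> ? ? _ _; exact: (@can_inj _ _ _ snd).
  by congr esum; rewrite predeqE => -[a b]; split; move=> [i _ <-]; exists i.
apply: lee_nneseries => [k _ _|k _].
  by apply: nneseries_ge0 => j _ _; exact: hausdorff_weight_ge0.
exact: (PG k).2.
Qed.

Lemma hausdorff_content_le delta A :
  (0 < delta)%R -> hausdorff_content delta A <= hausdorff A.
Proof. by move=> d0; apply: ereal_sup_ubound; exists delta. Qed.

Lemma hausdorff_ge0 A : 0 <= hausdorff A.
Proof.
apply: le_trans (hausdorff_content_le A (@ltr01 R)).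
exact: hausdorff_content_ge0.
Qed.

Lemma hausdorff0 : hausdorff set0 = 0.
Proof.
apply/eqP; rewrite eq_le hausdorff_ge0 andbT.
by apply: ge_ereal_sup => _ [delta _ <-]; rewrite hausdorff_content0.
Qed.

Lemma le_hausdorff : {homo hausdorff : A B / A `<=` B >-> A <= B}.
Proof.
move=> A B AB; apply: ge_ereal_sup => _ [delta d0 <-].
exact: le_trans (le_hausdorff_content delta AB) (hausdorff_content_le _ d0).
Qed.

Lemma hausdorff_sigma_subadditive : sigma_subadditive hausdorff.
Proof.
move=> A; apply: ge_ereal_sup => _ [delta d0 <-].
apply: le_trans (hausdorff_content_sigma_subadditive delta A) _.
apply: lee_nneseries => k _ *; first exact: hausdorff_content_ge0.
exact: hausdorff_content_le.
Qed.

HB.instance Definition _ := isOuterMeasure.Build R T hausdorff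
  hausdorff0 hausdorff_ge0 le_hausdorff hausdorff_sigma_subadditive.

Definition hausdorff_outer : {outer_measure set T -> \bar R} := hausdorff.

Definition hausdorff_measure :
    {measure set (caratheodory_type hausdorff_outer) -> \bar R} :=
  (hausdorff_outer : set (caratheodory_type hausdorff_outer) -> \bar R).

Definition hausdorff_integral (A : set T) (f : T -> R) : R :=
  Rintegral hausdorff_measure A f.

End hausdorff.

Section hypersurfaces.
Context (R : realType) (m n : nat).
Implicit Types (V : set 'rV[R]_m) (X : 'rV[R]_m -> 'rV[R]_n) (M : set 'rV[R]_n).

Definition partial (i : 'I_m) X : 'rV[R]_m -> 'rV[R]_n :=
  'D_(delta_mx 0 i) X.

Definition C1_on V X : Prop :=
  forall i u, V u ->
    derivable X u (delta_mx 0 i) /\ {for u, continuous (partial i X)}.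

Definition C2_on V X : Prop :=
  C1_on V X /\ forall i, C1_on V (partial i X).

Definition tangent_frame X u : 'M[R]_(m, n) :=
  \matrix_(i, j) partial i X u 0 j.

(* X is a regular C^2 parametrization, with parameter domain V, of a relatively
   open part of M, and a homeomorphism onto it (last clause). *)
Definition C2_chart M V X : Prop :=
  [/\ open V, C2_on V X, set_inj V X,
      forall u, V u -> row_free (tangent_frame X u)
    & forall W, open W -> W `<=` V -> exists2 O, open O & X @` W = M `&` O].

Definition C2_embedded M : Prop :=
  forall x, M x -> exists V X, C2_chart M V X /\ (X @` V) x.

Definition first_form X u : 'M[R]_m :=
  \matrix_(i, j) dot (partial i X u) (partial j X u).

(* With this sign the form of the boundary of a convex set is positive
   semidefinite with respect to the outer normal nu. *)
Definition second_form X (nu : 'rV[R]_n) u : 'M[R]_m :=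
  \matrix_(i, j) - dot (partial j (partial i X) u) nu.

(* The Gauss-Kronecker curvature at x of the m-dimensional manifold M, as a
   hypersurface of an (m+1)-dimensional ambient manifold of R^n in which N is
   the set of its outer unit normals at x (a singleton in the cases of interest).
   When the ambient manifold is a sphere, the normal is tangent to the sphere,
   so that replacing the covariant derivative of the sphere by that of R^n does
   not change the second fundamental form. *)
Definition gauss_kronecker M (N : set 'rV[R]_n) (x : 'rV[R]_n) : R :=
  xget 0 [set h | exists V X u nu,
    [/\ C2_chart M V X, V u, X u = x, N nu
      & h = \det (second_form X nu u) / \det (first_form X u)]].

End hypersurfaces.

(* Boundary of K relative to a closed ambient set S containing K. *)
Definition boundary (R : realType) (n : nat) (S K : set 'rV[R]_n) :=
  closure K `&` closure (S `\` K).

Definition outer_normals (R : realType) (n : nat) (K : set 'rV[R]_n) x :=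
  [set nu : 'rV[R]_n | enorm nu = 1 /\ forall y, K y -> dot nu (y - x) <= 0].

Section euclidean.
Context (R : realType) (d : nat).
Implicit Types (K : set 'rV[R]_d) (x : 'rV[R]_d).

Definition curvature_e K x : R :=
  @gauss_kronecker R d.-1 d (boundary setT K) (outer_normals K x) x.

Definition convex_body K : Prop :=
  [/\ convex_set K, compact K & interior K !=set0].

Definition C2_plus K : Prop :=
  @C2_embedded R d.-1 d (boundary setT K) /\
  forall x, boundary setT K x -> 0 < curvature_e K x.

Definition sphere_area : R :=
  fine (hausdorff d.-1 [set x : 'rV[R]_d | enorm x = 1]).

Definition gaussian_entropy K : R :=
  sphere_area^-1 * hausdorff_integral d.-1 (boundary setT K)
    (fun x => curvature_e K x * ln (curvature_e K x)).

End euclidean.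

Section spherical.
Context (R : realType) (d : nat).
Implicit Types (lambda : R) (K : set 'rV[R]_d.+1) (x : 'rV[R]_d.+1).

(* Sp^d(lambda) *)
Definition sphere lambda : set 'rV[R]_d.+1 :=
  [set x | dot x x = lambda^-1].

Definition dual lambda K : set 'rV[R]_d.+1 :=
  [set v | sphere lambda v /\ forall u, K u -> 0 <= dot v u].

Definition curvature_s lambda K x : R :=
  @gauss_kronecker R d.-1 d.+1 (boundary (sphere lambda) K)
    (outer_normals K x `&` [set nu | dot nu x = 0]) x.

Definition Omega lambda (q : R) K : R :=
  hausdorff_integral d.-1 (boundary (sphere lambda) K)
    (fun x => curvature_s lambda K x `^ (q / (d%:R + q))).

Definition perimeter lambda K : R := Omega lambda 0 K.

Definition entropy_quotient lambda K (q : R) : R :=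
  (Omega lambda q (dual lambda K) / perimeter lambda (dual lambda K))
    `^ (1 + d%:R / q).

Definition entropy_power lambda K : R :=
  lambda ^- d.-1 * lim (entropy_quotient lambda K q @[q --> 0^'+]).

Definition curvature_entropy lambda K : R := - ln (entropy_power lambda K).

Definition spherical_entropy K : R :=
  - ln (lim (entropy_quotient 1 K q @[q --> 0^'+])).

(* The point of the sphere at geodesic distance r from the center
   o = (1 / sqrt lambda, 0) in the unit direction u of R^d, the orthogonal
   complement of o. *)
Definition polar_point lambda (r : R) (u : 'rV[R]_d) : 'rV[R]_d.+1 :=
  row_mx (cos (Num.sqrt lambda * r) / Num.sqrt lambda)%:M
         ((sin (Num.sqrt lambda * r) / Num.sqrt lambda) *: u).

Definition gnomonic_preimage lambda (L : set 'rV[R]_d) : set 'rV[R]_d.+1 :=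
  [set x | exists r u,
    [/\ 0 <= r < pi / (2 * Num.sqrt lambda), enorm u = 1,
        x = polar_point lambda r u
      & L ((tan (Num.sqrt lambda * r) / Num.sqrt lambda) *: u)]].

End spherical.

(* Main.v *)
(* Let S be the unit sphere of R^d. Positive curvature makes the point x(p) of
   the boundary of K with outer normal p a C^1 function of p, and it maps S onto
   the boundary with Jacobian 1 / H, where H is the curvature at x(p). So the
   Gaussian entropy is the mean of log H over S.
   Let h(p) = x(p) . p be the support function. The boundary of the dual of the
   preimage of K in Sp^d(lambda) consists of the multiples of norm
   lambda^(-1/2) of the vectors (sqrt lambda h(p), - p). Its curvature there is
     lambda^(d-1) / H ((1 + lambda h^2) / (1 + lambda |x|^2))^((d+1)/2),
   and this parametrization by S has Jacobian
     lambda^(-(d-1)/2) (1 + lambda |x|^2)^(1/2) (1 + lambda h^2)^(-d/2).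
   As q goes to 0 the power means in the definition of the entropy converge to
   the geometric mean of the curvature, so E_C^lambda is the mean over S, for the
   weight above, of
     log H - (d+1)/2 (log (1 + lambda h^2) - log (1 + lambda |x|^2)).
   This is continuous in lambda, also at lambda = 0, where it is the mean of
   log H. *)

From HB Require Import structures.
Require Import Defs.
From mathcomp Require Import all_boot all_order all_algebra fingroup perm.
From mathcomp Require Import all_classical all_reals all_analysis.
From mathcomp Require Import measurable_realfun ring lra.
Import Order.TTheory GRing.Theory Num.Theory.
Import numFieldNormedType.Exports.

Set Implicit Arguments.
Unset Strict Implicit.
Unset Printing Implicit Defensive.

Local Open Scope classical_set_scope.
Local Open Scope ring_scope.

(** * Euclidean norm *)

(** The value of the Hausdorff measure on a cube is never computed: positivity and finiteness
    suffice. The sphere and each of its images are compared with one linear image of the parameter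
    space, whose unknown scaling factor cancels. The only factors left to find are those of square
    matrices, which are absolute values of determinants. Jacobians are therefore statements about
    the measures of all small sets, and a change of variables is proved by cutting the compact
    sphere into finitely many pieces on which the map is almost linear. The curvature is defined
    through an unspecified chart, so evaluating it requires the invariance of det II / det I under
    chart changes. Only a continuous first differential of the transition map is established. It is
    enough because the product of a fixed normal with the tangent frame is differentiated at a point
    where this product vanishes. The same product, solved for the parameter of x(p), yields the
    regularity of x by implicit differentiation. *)

Section euclidean_space.
Context (R : realType) (n : nat).
Implicit Types u v w : 'rV[R]_n.

Lemma dotC u v : dot u v = dot v u.
Proof. by apply: eq_bigr => i _; rewrite mulrC. Qed.

Lemma dotDl u v w : dot (u + v) w = dot u w + dot v w.
Proof. by rewrite /dot -big_split; apply: eq_bigr => i _; rewrite mxE mulrDl. Qed.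

Lemma dotZl a u v : dot (a *: u) v = a * dot u v.
Proof. by rewrite /dot mulr_sumr; apply: eq_bigr => i _; rewrite mxE mulrA. Qed.

Lemma dotNl u v : dot (- u) v = - dot u v.
Proof. by rewrite -scaleN1r dotZl mulN1r. Qed.

Lemma dotBl u v w : dot (u - v) w = dot u w - dot v w.
Proof. by rewrite dotDl dotNl. Qed.

Lemma dotDr u v w : dot w (u + v) = dot w u + dot w v.
Proof. by rewrite !(dotC w) dotDl. Qed.

Lemma dotZr a u v : dot u (a *: v) = a * dot u v.
Proof. by rewrite !(dotC u) dotZl. Qed.

Lemma dotNr u v : dot u (- v) = - dot u v.
Proof. by rewrite !(dotC u) dotNl. Qed.

Lemma dotBr u v w : dot w (u - v) = dot w u - dot w v.
Proof. by rewrite !(dotC w) dotBl. Qed.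

Lemma dot0l u : dot 0 u = 0.
Proof. by rewrite -(scale0r 0) dotZl mul0r. Qed.

Lemma dot0r u : dot u 0 = 0.
Proof. by rewrite dotC dot0l. Qed.

Lemma dot_mxE u v : dot u v = (u *m v^T) 0 0.
Proof. by rewrite mxE; apply: eq_bigr => i _; rewrite mxE. Qed.

Lemma dot_ge0 u : 0 <= dot u u.
Proof. by apply: sumr_ge0 => i _; rewrite -expr2 sqr_ge0. Qed.

Lemma enorm_ge0 u : 0 <= enorm u.
Proof. exact: sqrtr_ge0. Qed.

Lemma enorm_sqr u : enorm u ^+ 2 = dot u u.
Proof. by rewrite sqr_sqrtr// dot_ge0. Qed.

Lemma coord_le_enorm u i : `|u 0 i| <= enorm u.
Proof.
rewrite -(ler_pXn2r (ltn0Sn 1)) ?nnegrE ?enorm_ge0// enorm_sqr real_normK ?num_real//.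
rewrite /dot (bigD1 i)//= -expr2 lerDl.
by apply: sumr_ge0 => j _; rewrite -expr2 sqr_ge0.
Qed.

Lemma norm_leP u c : 0 <= c -> reflect (forall i, `|u 0 i| <= c) (`|u| <= c).
Proof.
move=> c0; rewrite [`|u|]/Num.norm /= mx_normrE.
apply: (iffP idP) => [/bigmax_leP[_ uc] i|uc]; first exact: (uc (0, i)).
by apply/bigmax_leP; split => //= -[i j] _ /=; rewrite (ord1 i).
Qed.

Lemma coord_le_norm u i : `|u 0 i| <= `|u|.
Proof. by apply/norm_leP : i. Qed.

Lemma norm_le_enorm u : `|u| <= enorm u.
Proof. by apply/norm_leP => [|i]; rewrite ?enorm_ge0// coord_le_enorm. Qed.

Lemma enorm_le_norm u : enorm u <= n%:R * `|u|.
Proof.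
rewrite -(ler_pXn2r (ltn0Sn 1)) ?nnegrE ?enorm_ge0 ?mulr_ge0// enorm_sqr.
have : dot u u <= \sum_(i < n) `|u| ^+ 2.
  apply: ler_sum => i _; rewrite -expr2 -real_normK ?num_real//.
  by rewrite ler_pXn2r ?nnegrE// coord_le_norm.
move=> /le_trans; apply; rewrite sumr_const card_ord exprMn.
rewrite -[leLHS]mulr_natl ler_wpM2r// ?exprn_ge0// -natrX ler_nat expnS expn1.
by case: (n) => // k; rewrite leq_pmulr.
Qed.

Lemma enorm0 : enorm (0 : 'rV[R]_n) = 0.
Proof. by rewrite /enorm dot0l sqrtr0. Qed.

Lemma enorm_eq0 u : (enorm u == 0) = (u == 0).
Proof.
apply/idP/idP => [/eqP u0|/eqP->]; last by rewrite enorm0.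
by rewrite -normr_eq0 eq_le normr_ge0 andbT -u0 norm_le_enorm.
Qed.

Lemma enorm_gt0 u : (0 < enorm u) = (u != 0).
Proof. by rewrite lt_def enorm_ge0 andbT enorm_eq0. Qed.

Lemma dot_gt0 u : (0 < dot u u) = (u != 0).
Proof. by rewrite -enorm_gt0 -enorm_sqr exprn_even_gt0//= enorm_eq0 enorm_gt0. Qed.

Lemma enorm1_neq0 u : enorm u = 1 -> u != 0.
Proof. by move=> u1; rewrite -enorm_gt0 u1. Qed.

Lemma dot_delta u j : dot u (delta_mx 0 j) = u 0 j.
Proof.
rewrite /dot (bigD1 j)//= big1 ?addr0; first by rewrite [X in _ * X]mxE !eqxx mulr1.
by move=> i ij; rewrite [X in _ * X]mxE eqxx (negbTE ij) mulr0.
Qed.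

Lemma enorm_delta j : enorm (delta_mx 0 j : 'rV[R]_n) = 1.
Proof. by rewrite /enorm dot_delta mxE !eqxx sqrtr1. Qed.

Lemma enormZ a u : enorm (a *: u) = `|a| * enorm u.
Proof.
by rewrite /enorm dotZl dotZr mulrA -expr2 sqrtrM ?sqr_ge0// sqrtr_sqr.
Qed.

Lemma enormN u : enorm (- u) = enorm u.
Proof. by rewrite -scaleN1r enormZ normrN1 mul1r. Qed.

Lemma enormBC u v : enorm (u - v) = enorm (v - u).
Proof. by rewrite -enormN opprB. Qed.

Lemma cauchy_schwarz u v : `|dot u v| <= enorm u * enorm v.
Proof.
rewrite -(ler_pXn2r (ltn0Sn 1)) ?nnegrE ?mulr_ge0 ?enorm_ge0//.
rewrite exprMn !enorm_sqr real_normK ?num_real//.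
have [->|v0] := eqVneq v 0; first by rewrite !dot0r expr0n mulr0.
have vv : 0 < dot v v by rewrite dot_gt0.
have := dot_ge0 (dot v v *: u - dot u v *: v).
rewrite dotBl !dotBr !dotZl !dotZr (dotC v u).
set a := dot u u; set b := dot u v; set c := dot v v.
have -> : c * (c * a) - c * (b * b) - (b * (c * b) - b * (b * c)) =
   c * (a * c - b ^+ 2) by rewrite /a /b /c; ring.
by rewrite pmulr_rge0// subr_ge0.
Qed.

Lemma dot_le_enorm u v : dot u v <= enorm u * enorm v.
Proof. exact: le_trans (ler_norm _) (cauchy_schwarz u v). Qed.

Lemma enormD u v : enorm (u + v) <= enorm u + enorm v.
Proof.
rewrite -(ler_pXn2r (ltn0Sn 1)) ?nnegrE ?addr_ge0 ?enorm_ge0//.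
rewrite enorm_sqr dotDl !dotDr sqrrD !enorm_sqr (dotC v u).
have := dot_le_enorm u v; lra.
Qed.

Lemma enormB u v : enorm (u - v) <= enorm u + enorm v.
Proof. by rewrite -(enormN v) enormD. Qed.

Lemma enorm_triangle v u w : enorm (u - w) <= enorm (u - v) + enorm (v - w).
Proof. by rewrite -[u - w](subrKA v) enormD. Qed.

Lemma enorm_subl u v : enorm u - enorm v <= enorm (u - v).
Proof. by rewrite lerBlDr -{1}(subrK v u) enormD. Qed.

(** The topology comes from the sup norm, which is equivalent to the Euclidean norm with constants 1
    and n. The radius uses [n.+1] so that the denominator is nonzero for n = 0. *)
Lemma nbhs_enormP u (O : set 'rV[R]_n) :
  nbhs u O <-> exists2 e, 0 < e & forall v, enorm (v - u) < e -> O v.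
Proof.
split.
  move=> /nbhs_ballP[e /= e0 uO]; exists e => // v vu; apply: uO.
  by rewrite mx_norm_ball /ball_ /= distrC (le_lt_trans (norm_le_enorm _)).
move=> [e e0 uO]; apply/nbhs_ballP; exists (e / n.+1%:R) => /=.
  by rewrite divr_gt0.
move=> v; rewrite mx_norm_ball /ball_ /= distrC => vu; apply: uO.
apply: le_lt_trans (enorm_le_norm _) _.
rewrite ltr_pdivlMr// mulrC in vu; apply: le_lt_trans vu.
by rewrite ler_wpM2r// ler_nat.
Qed.

End euclidean_space.

Lemma dot_mulmx (R : realType) m n (u : 'rV[R]_m) (A : 'M[R]_(m, n)) v :
  dot (u *m A) v = dot u (v *m A^T).
Proof. by rewrite !dot_mxE trmx_mul trmxK mulmxA. Qed.

Lemma enorm_mulmx_le (R : realType) m n (A : 'M[R]_(m, n)) :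
  exists2 c : R, 0 < c & forall u, enorm (u *m A) <= c * enorm u.
Proof.
exists (1 + \sum_i enorm (row i A)).
  by rewrite ltr_pwDl// sumr_ge0// => i _; exact: enorm_ge0.
move=> u; rewrite mulmx_sum_row mulrDl mul1r.
apply: ler_wpDl; first exact: enorm_ge0.
rewrite mulr_suml; elim/big_ind2 : _ => [|x1 x2 y1 y2 h1 h2|i _].
- by rewrite enorm0.
- exact: le_trans (enormD _ _) (lerD h1 h2).
- by rewrite enormZ mulrC ler_wpM2l ?enorm_ge0// coord_le_enorm.
Qed.

Lemma enorm_row_free_le (R : realType) m n (A : 'M[R]_(m, n)) : row_free A ->
  exists2 c : R, 0 < c & forall u, enorm u <= c * enorm (u *m A).
Proof.
move=> Afree; have [c c0 cP] := enorm_mulmx_le (pinvmx A).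
exists c => // u; have := cP (u *m A).
by rewrite -mulmxA mulmxVp// mulmx1.
Qed.

(** * Hausdorff measures *)

Section metric_outer_measure.
Context (R : realType) (n : nat).
Local Notation T := 'rV[R]_n.
Local Open Scope ereal_scope.

(** The defining property of a metric outer measure: additivity on sets at positive distance,
    reduced to the inequality that subadditivity does not give. *)
Definition separated_superadditive (mu : set T -> \bar R) :=
  forall (A B : set T) (e : R), (0 < e)%R ->
    (forall a b, A a -> B b -> (e <= enorm (a - b))%R) ->
  mu A + mu B <= mu (A `|` B).

Variable mu : {outer_measure set T -> \bar R}.
Hypothesis mu_sep : separated_superadditive mu.

(* Caratheodory's criterion: the shells between two consecutive superlevels of g
   are separated from the previous superlevel, so their measures are summable. *)
Lemma caratheodory_sublevel (g : T -> R) :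
  (forall x y, `|g x - g y| <= enorm (x - y))%R ->
  mu.-caratheodory [set x | (g x <= 0)%R].
Proof.
move=> glip; apply: le_caratheodory_measurable => X.
have [->|Xoo] := eqVneq (mu X) +oo; first by rewrite leey.
have {}Xoo : mu X < +oo by rewrite ltey.
pose c (k : nat) : R := (k.+1%:R^-1)%R.
have c0 k : (0 < c k)%R by rewrite invr_gt0.
have cS k : (c k.+1 < c k)%R by rewrite ltf_pV2 ?posrE// ltr_nat.
pose D k := X `&` [set x | (c k <= g x)%R].
pose S k := X `&` [set x | (c k.+1 <= g x < c k)%R].
have sep (A B : set T) (s t : R) : (s < t)%R -> (forall x, A x -> (g x <= s)%R) ->
    (forall x, B x -> (t <= g x)%R) -> mu A + mu B <= mu (A `|` B).
  move=> st As Bt; apply: (mu_sep (e := (t - s)%R)); first by rewrite subr_gt0.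
  move=> a b /As ga /Bt gb; rewrite enormBC; apply: le_trans (glip _ _).
  by apply: le_trans (ler_norm _); rewrite lerB.
have step k : mu (S k.+1) + mu (D k) <= mu (D k.+2).
  apply: le_trans (sep _ _ (c k.+1) (c k) (cS k) _ _) _.
  - by move=> x [_ /= /andP[_ /ltW]].
  - by move=> x [_ /=].
  apply: le_outer_measure => x [[Xx /= /andP[gx _]]|[Xx /= gx]]; split => //=.
  by rewrite (le_trans _ gx)// ltW// (lt_trans (cS _)).
have DX k : mu (D k) <= mu X by apply: le_outer_measure => x [].
have Dfin k : mu (D k) \is a fin_num.
  by rewrite ge0_fin_numE ?outer_measure_ge0// (le_lt_trans (DX k)).
(* Consecutive shells touch, so only every second one is separated from the previous superlevel. The
   two terms on the right collect the shells of either parity, whence the bound by twice the measure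
   of X below. *)
have partial k : \sum_(i < k) mu (S i.+1) <= mu (D k) + mu (D k.+1).
  elim: k => [|k ih]; first by rewrite big_ord0 adde_ge0 ?outer_measure_ge0.
  rewrite big_ord_recr /=; apply: le_trans (leeD2r _ ih) _.
  rewrite addeAC [leRHS]addeC leeD2r//.
  by rewrite addeC; exact: step.
have Soo : \sum_(k <oo) mu (S k.+1) < +oo.
  apply: (@le_lt_trans _ _ (mu X + mu X)); last by rewrite lte_add_pinfty.
  apply: lime_le => [|]; first by apply: is_cvg_nneseries => *; exact: outer_measure_ge0.
  near=> k; rewrite big_mkord; apply: le_trans (partial k) _.
  by rewrite leeD.
have tail := nneseries_tail_cvg Soo (fun k _ => outer_measure_ge0 mu (S k.+1)).
apply/lee_addgt0Pr => e e0.
have /fine_cvgP[tailfin /cvgrPdist_lt/(_ _ e0) taile] := tail.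
near \oo => k.
have taile_k : \sum_(k <= i <oo) mu (S i.+1) <= e%:E.
  rewrite -[leLHS]fineK; last by near: k.
  rewrite lee_fin; apply: le_trans (ler_norm _) _.
  by rewrite -normrN -sub0r ltW//; near: k.
have XF : X `&` ~` [set x | (g x <= 0)%R] `<=`
    D k.+1 `|` \bigcup_(i >= k) S i.+1.
  move=> x [Xx /negP]; rewrite -ltNge => gx.
  have [gck|gck] := leP (c k.+1) (g x); [by left|right].
  have : exists i, (c i <= g x)%R.
    exists (Num.truncn (g x)^-1).
    rewrite -[leRHS]invrK lef_pV2 ?posrE ?invr_gt0//.
    by rewrite ltW// truncnS_gt.
  move=> /ex_minnP[[|i] gi imin].
    by have := le_lt_trans gi gck; rewrite ltNge => /negP[]; rewrite /c lef_pV2 ?posrE// ler_nat.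
  have gxi : (g x < c i)%R by rewrite ltNge; apply/negP => /imin; rewrite ltnn.
  have ki : (k.+1 <= i)%N.
    rewrite leqNgt; apply/negP => ik; have := le_lt_trans gi gck.
    by rewrite ltNge => /negP[]; rewrite /c lef_pV2 ?posrE// ler_nat.
  case: i gxi gi ki {imin} => // i gxi gi ki; exists i; first by [].
  by split => //=; rewrite gi gxi.
apply: le_trans (leeD2l _ (le_outer_measure mu _ _ XF)) _.
apply: le_trans (leeD2l _ (outer_measureU2 _ _ _)) _.
rewrite addeA leeD//.
  apply: le_trans (sep _ _ 0%R (c k.+1) (c0 _) _ _) _.
  - by move=> x [].
  - by move=> x [].
  by apply: le_outer_measure => x [] [].
apply: le_trans taile_k.
have := outer_measure_sigma_subadditive_tail mu k (fun i => S i.+1).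
suff -> : (~` `I_k) = [set i | (k <= i)%N] by [].
by apply/seteqP; split => i /=; [move=> /negP; rewrite -leqNgt|rewrite leqNgt => /negP].
Unshelve. all: by end_near. Qed.

Lemma caratheodory_coord_le i (c : R) :
  mu.-caratheodory [set x : T | (x 0 i <= c)%R].
Proof.
rewrite (_ : mkset _ = [set x : T | (x 0 i - c <= 0)%R]); last first.
  by apply/seteqP; split => x /=; rewrite subr_le0.
apply: (@caratheodory_sublevel (fun x => x 0 i - c)%R) => x y.
rewrite (_ : _ - _ = (x - y) 0 i)%R ?coord_le_enorm//.
by rewrite !mxE; ring.
Qed.

End metric_outer_measure.

Lemma ball_volume_gt0 (R : realType) m : 0 < ball_volume R m.
Proof.
suff: 0 < ball_volume R m /\ 0 < ball_volume R m.+1 by case.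
elim: m => [|m [h1 h2]]; first by split.
by split => //=; rewrite mulr_gt0// divr_gt0// mulr_gt0// pi_gt0.
Qed.

Section hausdorff_lipschitz.
Context (R : realType) (m : nat).
Local Open Scope ereal_scope.

Lemma hausdorff_weight_le n (A : set 'rV[R]_n) c : 0 <= c ->
  (forall x y, A x -> A y ->
    (ball_volume R m / 2 ^+ m * enorm (x - y) ^+ m)%:E <= c) ->
  hausdorff_weight m A <= c.
Proof.
by move=> c0 Ac; apply: ge_ereal_sup => _ [->//|[x Ax [y Ay <-]]]; exact: Ac.
Qed.

Lemma hausdorff_weight_ge n (A : set 'rV[R]_n) x y : A x -> A y ->
  (ball_volume R m / 2 ^+ m * enorm (x - y) ^+ m)%:E <= hausdorff_weight m A.
Proof. by move=> Ax Ay; apply: ereal_sup_ubound; right; exists x => //; exists y. Qed.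

Lemma le_hausdorff_weight n (A B : set 'rV[R]_n) : A `<=` B ->
  hausdorff_weight m A <= hausdorff_weight m B.
Proof.
move=> AB; apply: hausdorff_weight_le => [|x y /AB Bx /AB By].
  exact: hausdorff_weight_ge0.
exact: hausdorff_weight_ge.
Qed.

Context (T : Type) (n1 n2 : nat) (F : T -> 'rV[R]_n1) (G : T -> 'rV[R]_n2).

Lemma hausdorff_weight_lip (B : set T) (k : R) : (0 < k)%R ->
  (forall a b, B a -> B b -> (enorm (F a - F b) <= k * enorm (G a - G b))%R) ->
  hausdorff_weight m (F @` B) <= (k ^+ m)%:E * hausdorff_weight m (G @` B).
Proof.
move=> k0 FG; apply: hausdorff_weight_le.
  by rewrite mule_ge0 ?hausdorff_weight_ge0// lee_fin exprn_ge0 ?ltW.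
move=> _ _ [a Ba <-] [b Bb <-].
apply: le_trans (lee_wpmul2l _ (hausdorff_weight_ge _ _)); last 3 first.
- by rewrite lee_fin exprn_ge0 ?ltW.
- by exists a; [exact: Ba|reflexivity].
- by exists b; [exact: Bb|reflexivity].
rewrite -EFinM lee_fin mulrCA ler_wpM2l//.
  by apply: divr_ge0; [apply/ltW/ball_volume_gt0|rewrite exprn_ge0].
rewrite -exprMn lerXn2r ?nnegrE ?enorm_ge0//; last exact: FG.
by rewrite mulr_ge0 ?enorm_ge0// ltW.
Qed.

(** Both sets are images of a common parameter set, so comparing two parametrizations needs no
    inverse map. A cover of the image under G is pulled back to the parameters and pushed forward by
    F. *)
Lemma hausdorff_lip (B : set T) (k : R) : (0 < k)%R ->
  (forall a b, B a -> B b -> (enorm (F a - F b) <= k * enorm (G a - G b))%R) ->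
  hausdorff m (F @` B) <= (k ^+ m)%:E * hausdorff m (G @` B).
Proof.
move=> k0 FG; have km : (0 < k ^+ m)%R by rewrite exprn_gt0.
apply: ge_ereal_sup => _ [delta /= d0 <-].
have dk : (0 < delta / k)%R by rewrite divr_gt0.
apply: le_trans (lee_wpmul2l _ (hausdorff_content_le _ _ dk)); last first.
  by rewrite lee_fin ltW.
rewrite -lee_pdivrMl//; apply: le_ereal_inf_tmp => _ [C [BC Cd] <-].
rewrite lee_pdivrMl// -nneseriesZl; last by move=> *; exact: hausdorff_weight_ge0.
pose D i := F @` (B `&` (G @^-1` C i)).
apply: (@le_trans _ _ (\sum_(i <oo) hausdorff_weight m (D i))).
  apply: ereal_inf_lbound; exists D => //; split.
    move=> _ [a Ba <-]; have [i _ Ci] : (\bigcup_i C i) (G a) by apply: BC; exists a.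
    by exists i => //; exists a.
  move=> i _ _ [a [Ba Ca] <-] [b [Bb Cb] <-].
  apply: le_trans (FG _ _ Ba Bb) _; rewrite mulrC -ler_pdivlMr//.
  exact: Cd Ca Cb.
apply: lee_nneseries => [i *|i *]; first exact: hausdorff_weight_ge0.
apply: le_trans (hausdorff_weight_lip k0 _) _.
  by move=> a b [Ba _] [Bb _]; exact: FG.
apply: lee_wpmul2l; first by rewrite lee_fin ltW.
apply: le_hausdorff_weight.
by move=> _ [a [_ Ca] <-].
Qed.

End hausdorff_lipschitz.

Lemma hausdorff_isometry (R : realType) m (T : Type) n1 n2
    (F : T -> 'rV[R]_n1) (G : T -> 'rV[R]_n2) B :
  (forall a b, B a -> B b -> enorm (F a - F b) = enorm (G a - G b)) ->
  hausdorff m (F @` B) = hausdorff m (G @` B).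
Proof.
move=> FG; apply/eqP; rewrite eq_le; apply/andP; split.
  have := hausdorff_lip m (B := B) (F := F) (G := G) ltr01.
  by rewrite expr1n mul1e; apply => a b Ba Bb; rewrite mul1r FG.
have := hausdorff_lip m (B := B) (F := G) (G := F) ltr01.
by rewrite expr1n mul1e; apply => a b Ba Bb; rewrite mul1r FG.
Qed.

Lemma hausdorff_scale (R : realType) m n (A : set 'rV[R]_n) (k : R) : 0 < k ->
  (hausdorff m ((fun x => k *: x) @` A) = (k ^+ m)%:E * hausdorff m A)%E.
Proof.
move=> k0; apply/eqP; rewrite eq_le; apply/andP; split.
  rewrite -{2}(image_id A); apply: hausdorff_lip => // a b _ _.
  by rewrite -scalerBr enormZ gtr0_norm.
have km : 0 < k ^+ m by rewrite exprn_gt0.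
rewrite muleC -lee_pdivlMr// muleC -exprVn -[X in (hausdorff m X <= _)%E](image_id A).
apply: hausdorff_lip; first by rewrite invr_gt0.
by move=> a b _ _; rewrite -scalerBr enormZ gtr0_norm// mulKf// gt_eqF.
Qed.

Lemma hausdorff_translate (R : realType) m n (A : set 'rV[R]_n) (t : 'rV[R]_n) :
  hausdorff m ((fun x => t + x) @` A) = hausdorff m A.
Proof.
rewrite -[in RHS](image_id A); apply: hausdorff_isometry => a b _ _.
by rewrite opprD addrACA subrr add0r.
Qed.

Section hausdorff_metric.
Context (R : realType) (m n : nat).
Local Notation T := 'rV[R]_n.
Local Open Scope ereal_scope.

Lemma hausdorff_content_anti (A : set T) (d1 d2 : R) : (d1 <= d2)%R ->
  hausdorff_content m d2 A <= hausdorff_content m d1 A.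
Proof.
move=> d12; apply/ereal_inf_le_tmp => _ [C [AC Cd] <-]; exists C => //.
by split => // k x y Cx Cy; rewrite (le_trans (Cd k x y Cx Cy)).
Qed.

(** A covering set of diameter less than e meets at most one of A and B, so intersecting a cover
    with A and with B does not increase the total weight. *)
Lemma hausdorff_content_separated (A B : set T) (e delta : R) :
  (delta < e)%R -> (forall a b, A a -> B b -> (e <= enorm (a - b))%R) ->
  hausdorff_content m delta A + hausdorff_content m delta B <=
  hausdorff_content m delta (A `|` B).
Proof.
move=> de AB; apply: le_ereal_inf_tmp => _ [C [ABC Cd] <-].
pose CA k := C k `&` A; pose CB k := C k `&` B.
apply: (@le_trans _ _ (\sum_(k <oo) hausdorff_weight m (CA k) +
                       \sum_(k <oo) hausdorff_weight m (CB k))).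
  apply: leeD; apply: ereal_inf_lbound.
    exists CA => //; split => [x Ax|k x y [Cx _] [Cy _]]; last exact: Cd Cx Cy.
    by have [k _ Ck] := ABC x (or_introl Ax); exists k.
  exists CB => //; split => [x Bx|k x y [Cx _] [Cy _]]; last exact: Cd Cx Cy.
  by have [k _ Ck] := ABC x (or_intror Bx); exists k.
rewrite -nneseriesD; last 2 first.
- by move=> *; exact: hausdorff_weight_ge0.
- by move=> *; exact: hausdorff_weight_ge0.
apply: lee_nneseries => [k *|k *].
  by rewrite adde_ge0 ?hausdorff_weight_ge0.
have [CA0|/set0P[a [Ca Aa]]] := eqVneq (CA k) set0.
  rewrite CA0 hausdorff_weight0 add0e; apply: le_hausdorff_weight.
  by move=> x [].
have [CB0|/set0P[b [Cb Bb]]] := eqVneq (CB k) set0.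
  rewrite CB0 hausdorff_weight0 adde0; apply: le_hausdorff_weight.
  by move=> x [].
by have := le_lt_trans (Cd k a b Ca Cb) de; rewrite ltNge AB.
Qed.

Lemma hausdorff_separated : separated_superadditive (@hausdorff R n m).
Proof.
move=> A B e e0 AB.
have [->|ABoo] := eqVneq (hausdorff m (A `|` B)) +oo; first by rewrite leey.
have fin (X : set T) : X `<=` A `|` B -> hausdorff m X \is a fin_num.
  move=> XAB; rewrite ge0_fin_numE ?hausdorff_ge0//.
  by rewrite (le_lt_trans (le_hausdorff m XAB))// ltey.
have finA := fin A (@subsetUl _ _ _); have finB := fin B (@subsetUr _ _ _).
rewrite -leeBrDr//; apply: ge_ereal_sup => _ [d1 /= d10 <-].
rewrite leeBrDr// addeC -leeBrDr; last first.
  rewrite ge0_fin_numE ?hausdorff_content_ge0//.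
  by apply: le_lt_trans (hausdorff_content_le _ _ d10) _; rewrite ltey_eq finA.
apply: ge_ereal_sup => _ [d2 /= d20 <-].
rewrite leeBrDr; last first.
  rewrite ge0_fin_numE ?hausdorff_content_ge0//.
  by apply: le_lt_trans (hausdorff_content_le _ _ d10) _; rewrite ltey_eq finA.
(* Less than e, so that separation applies at scale d; at most d1 and d2, since contents grow as the
   scale shrinks. *)
pose d : R := Num.min (e / 2)%R (Num.min d1 d2).
have d0 : (0 < d)%R by rewrite !lt_min d10 d20 divr_gt0.
apply: le_trans (hausdorff_content_le m (A `|` B) d0).
have de : (d < e)%R.
  by apply: (@le_lt_trans _ _ (e / 2)%R); [rewrite ge_min lexx|lra].
apply: le_trans (hausdorff_content_separated de AB).
rewrite addeC leeD//; apply: hausdorff_content_anti.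
  by rewrite !ge_min lexx orbT.
by rewrite !ge_min lexx !orbT.
Qed.

End hausdorff_metric.

HB.instance Definition _ (R : realType) (n m : nat) (delta : R) :=
  isOuterMeasure.Build R 'rV[R]_n (@hausdorff_content R n m delta)
    (hausdorff_content0 n m delta) (hausdorff_content_ge0 m delta)
    (@le_hausdorff_content R n m delta)
    (@hausdorff_content_sigma_subadditive R n m delta).

(** * The Hausdorff measure of the unit cube is positive and finite *)

Definition unit_cube (R : realType) n : set 'rV[R]_n :=
  [set x | forall i, 0 <= x 0 i < 1].

Section unit_cube_measure.
Context (R : realType).
Local Open Scope ereal_scope.

Lemma hausdorff_content_le_weight n m (A : set 'rV[R]_n) (delta : R) :
  (forall x y, A x -> A y -> (enorm (x - y) <= delta)%R) ->
  hausdorff_content m delta A <= hausdorff_weight m A.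
Proof.
move=> Ad; apply: ereal_inf_lbound.
exists (fun k => if k == 0%N then A else set0).
  by split=> [x Ax|[|k] x y]; [exists 0%N|exact: Ad|].
rewrite nneseries_recl//; last by move=> *; exact: hausdorff_weight_ge0.
rewrite eseries_cond eseries0 ?adde0// => -[|k]//= _ _.
exact: hausdorff_weight0.
Qed.

(** Cutting the cube into N^n cells of Euclidean diameter at most n / N gives covers of total weight
    at most c, whatever N is; N is taken so large that n / N is at most delta. *)
Lemma hausdorff_unit_cube_fin n : hausdorff n (@unit_cube R n) < +oo.
Proof.
pose c : R := (ball_volume R n / 2 ^+ n * n%:R ^+ n)%R.
have c0 : (0 <= c)%R.
  apply: mulr_ge0; last by rewrite exprn_ge0.
  by apply: divr_ge0; [apply/ltW/ball_volume_gt0|rewrite exprn_ge0].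
apply: (@le_lt_trans _ _ c%:E); last exact: ltry.
apply: ge_ereal_sup => _ [delta /= d0 <-].
pose N := (Num.truncn (n%:R / delta)).+1.
have N0 : (0 < N%:R :> R)%R by rewrite ltr0n.
have Nd : (n%:R / N%:R <= delta)%R.
  rewrite ler_pdivrMr// -ler_pdivrMl// mulrC ltW// truncnS_gt//.
pose P (f : {ffun 'I_n -> 'I_N}) :=
  [set x : 'rV[R]_n | forall i, (f i)%:R <= N%:R * x 0 i < (f i).+1%:R]%R.
have Pd f x y : P f x -> P f y -> (enorm (x - y) <= n%:R / N%:R)%R.
  move=> Px Py; apply: le_trans (enorm_le_norm _) _; rewrite ler_wpM2l//.
  apply/norm_leP; first by rewrite invr_ge0 ltW.
  move=> i; have := Px i; have := Py i; rewrite !mxE -[(f i).+1]addn1 natrD.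
  move=> /andP[h1 h2] /andP[h3 h4].
  rewrite -(ler_pM2l N0) divff ?gt_eqF// -[X in (X * _)%R]gtr0_norm// -normrM.
  by rewrite mulrBr ler_norml; apply/andP; split; lra.
have cover : @unit_cube R n `<=` \big[setU/set0]_(i < #|{ffun 'I_n -> 'I_N}|)
    P (enum_val i).
  move=> x xQ; rewrite -bigcup_seq /=.
  have flr (i : 'I_n) : (Num.truncn (N%:R * x 0 i)%R < N)%N.
    have /andP[x0 x1] := xQ i; have Nx : (0 <= N%:R * x 0 i)%R by rewrite mulr_ge0// ltW.
    rewrite -(ltr_nat R) (@le_lt_trans _ _ (N%:R * x 0 i)%R) ?gtr_pMr//.
    by rewrite truncn_le.
  exists (enum_rank [ffun i => Ordinal (flr i)]); first by rewrite /= mem_index_enum.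
  move=> i; rewrite enum_rankK ffunE /=.
  have /andP[x0 x1] := xQ i; have Nx : (0 <= N%:R * x 0 i)%R by rewrite mulr_ge0// ltW.
  by apply/andP; split; [rewrite truncn_le|exact: truncnS_gt].
apply: le_trans (le_hausdorff_content n delta cover) _.
pose F k := oapp (fun i : 'I_#|{ffun 'I_n -> 'I_N}| => P (enum_val i)) set0 (insub k).
rewrite (eq_bigr (F \o val)); last by move=> i _; rewrite /F /= valK.
apply: le_trans (outer_measure_subadditive _ F _) _.
apply: (@le_trans _ _ (\sum_(i < #|{ffun 'I_n -> 'I_N}|) (c / N%:R ^+ n)%:E)).
  apply: lee_sum => i _; rewrite /F valK.
  apply: le_trans (hausdorff_content_le_weight _ _) _.
    by move=> x y Px Py; apply: le_trans (Pd _ _ _ Px Py) Nd.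
  apply: hausdorff_weight_le.
    by rewrite lee_fin divr_ge0// exprn_ge0// ltW.
  move=> x y Px Py; rewrite lee_fin /c -[leRHS]mulrA -expr_div_n ler_wpM2l//.
    by apply: divr_ge0; [apply/ltW/ball_volume_gt0|rewrite exprn_ge0].
  by rewrite lerXn2r ?nnegrE ?enorm_ge0 ?divr_ge0// (Pd _ _ _ Px Py).
rewrite sumEFin sumr_const card_ord card_ffun !card_ord lee_fin -[leLHS]mulr_natr natrX.
by rewrite divfK// expf_eq0 gt_eqF// andbF.
Qed.

(* Integrating out one coordinate at a time shows that boxes covering the unit
   cube have total volume at least 1. *)
Lemma box_cover_volume n (a : nat -> R) (l r : nat -> nat -> R) :
  (forall k, 0 <= a k)%R -> (forall k i, l k i <= r k i)%R ->
  (forall x : nat -> R, (forall i, 0 <= x i < 1)%R ->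
    1 <= \sum_(k <oo) (a k * \prod_(i < n) \1_(`[l k i, r k i]%classic) (x i))%:E) ->
  1 <= \sum_(k <oo) (a k * \prod_(i < n) (r k i - l k i))%:E.
Proof.
elim: n a => [|n ih] a a0 lr cov.
  have := cov (fun=> 0%R); rewrite lexx ltr01 => /(_ (fun=> isT)).
  move=> /le_trans; apply; apply: lee_nneseries => k *.
    by rewrite lee_fin big_ord0 mulr1.
  by rewrite !big_ord0.
(* The weight [a k] absorbs the length of the coordinate that has been integrated out; this is why
   the statement carries weights. *)
suff : 1 <= \sum_(k <oo) (a k * (r k n - l k n) * \prod_(i < n) (r k i - l k i))%:E.
  move=> /le_trans; apply; apply: lee_nneseries => k *.
    rewrite lee_fin mulr_ge0 ?mulr_ge0 ?subr_ge0// prodr_ge0// => i _.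
    by rewrite subr_ge0.
  by rewrite big_ord_recr /= -mulrA [X in (_ * X)%R]mulrC.
apply: ih => // [k|x x01]; first by rewrite mulr_ge0// subr_ge0.
pose b k := (a k * \prod_(i < n) \1_(`[l k i, r k i]%classic) (x i))%R.
have b0 k : (0 <= b k)%R by rewrite mulr_ge0// prodr_ge0.
pose J k := `[l k n, r k n]%classic : set R.
have mJ k : measurable (J k) by exact: measurable_itv.
pose I01 := `[0%R, 1%R[%classic : set R.
have mI : measurable I01 by exact: measurable_itv.
have mindic k : measurable_fun I01 (\1_(J k) : R -> R).
  by apply: measurable_indic; exact: mJ.
have mbk k : measurable_fun I01 (fun t => (b k * \1_(J k) t)%:E).
  by apply/measurable_EFinP/measurable_funM; [exact: measurable_cst|exact: mindic].
have leI : lebesgue_measure I01 = 1.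
  by rewrite lebesgue_measure_itv /= lte_fin ltr01 sube0.
apply: (@le_trans _ _ (\int[lebesgue_measure]_(t in I01) (cst 1 t))).
  by rewrite integral_cst// mul1e [leRHS]leI.
apply: (@le_trans _ _ (\int[lebesgue_measure]_(t in I01)
    \sum_(k <oo) (b k * \1_(J k) t)%:E)).
  apply: ge0_le_integral => //.
  - apply: ge0_emeasurable_sum => // [k t _ _|k _].
      by rewrite lee_fin mulr_ge0.
    exact: mbk.
  - move=> t; rewrite /I01 /= in_itv /= => t01.
    have := cov (fun i => if (i == n)%N then t else x i).
    move=> /(_ _)/le_trans; apply; first by move=> i; case: ifP.
    apply: lee_nneseries => k *.
      by rewrite lee_fin mulr_ge0// prodr_ge0.
    rewrite lee_fin big_ord_recr /= eqxx mulrA ler_wpM2r// /b ler_wpM2l//.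
    rewrite le_eqVlt; apply/orP; left; apply/eqP; apply: eq_bigr => i _.
    by rewrite ltn_eqF.
rewrite integral_nneseries//; last first.
- by move=> k t _; rewrite lee_fin mulr_ge0.
apply: lee_nneseries => k *.
  by apply: integral_ge0 => t _; rewrite lee_fin mulr_ge0.
have -> : (a k * (r k n - l k n) * \prod_(i < n) \1_`[l k i, r k i] (x i))%:E =
    (b k)%:E * (r k n - l k n)%:E by rewrite -EFinM /b mulrAC.
under eq_integral do rewrite EFinM.
rewrite ge0_integralZl_EFin//; last by apply/measurable_EFinP; exact: mindic.
rewrite integral_indic//; last exact: mJ.
apply: lee_wpmul2l; first by rewrite lee_fin.
apply: (@le_trans _ _ (lebesgue_measure (J k))).
  by apply: le_measure; rewrite ?inE; [apply: measurableI; [exact: mJ|exact: mI]|exact: mJ|exact: subIsetl].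
rewrite /J lebesgue_measure_itv /= lte_fin; case: ifPn => _; first by rewrite -EFinB.
by rewrite lee_fin subr_ge0.
Qed.

(** A covering set of weight c rho^n has diameter at most rho, so it lies in a box of side 2 rho
    around any of its points, of volume 2^n / c times its weight. Such boxes have total volume at
    least 1, which bounds the weights below by c / 2^n. *)
Lemma hausdorff_unit_cube_gt0 n : (0 < n)%N -> 0 < hausdorff n (@unit_cube R n).
Proof.
move=> n0.
pose c : R := (ball_volume R n / 2 ^+ n)%R.
have c0 : (0 < c)%R by rewrite divr_gt0 ?exprn_gt0// ball_volume_gt0.
have c2 : (0 < c / 2 ^+ n)%R by rewrite divr_gt0 ?exprn_gt0.
apply: lt_le_trans (hausdorff_content_le _ _ (@ltr01 R)).
apply: (@lt_le_trans _ _ (c / 2 ^+ n)%:E); first by rewrite lte_fin.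
apply: le_ereal_inf_tmp => _ [C [QC Cd] <-].
have wge0 k : 0 <= hausdorff_weight n (C k) by exact: hausdorff_weight_ge0.
have wfin k : hausdorff_weight n (C k) \is a fin_num.
  rewrite ge0_fin_numE//; apply: (@le_lt_trans _ _ c%:E); last exact: ltry.
  apply: hausdorff_weight_le; first by rewrite lee_fin ltW.
  move=> x y Cx Cy; rewrite lee_fin -[leRHS]mulr1 ler_wpM2l// ?(ltW c0)//.
  by rewrite exprn_ile1 ?enorm_ge0// (Cd k).
pose w k := fine (hausdorff_weight n (C k)).
have w0 k : (0 <= w k)%R by rewrite fine_ge0.
pose rho k := ((w k / c) `^ n%:R^-1)%R.
have rho0 k : (0 <= rho k)%R by exact: powR_ge0.
have rhoE k : (c * rho k ^+ n = w k)%R.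
  rewrite -powR_mulrn// -powRrM mulVf ?pnatr_eq0 -?lt0n// powRr1; last first.
    by rewrite divr_ge0// ltW.
  by rewrite mulrC divfK// gt_eqF.
(* [z k] is any point of [C k]. Its coordinates are extended by 0 to all natural indices, as
   [box_cover_volume] expects. *)
pose z k := xget (0%R : 'rV[R]_n) (C k).
pose zi k i : R := if insub i is Some j then z k 0%R j else 0%R.
have zC k (x : 'rV[R]_n) i : C k x -> (zi k (val i) - rho k <= x 0 i <= zi k (val i) + rho k)%R.
  move=> Ckx; rewrite /zi valK.
  have Ckz : C k (z k) by apply: (@xgetPex _ 0%R (C k)); exists x.
  have : (enorm (x - z k) <= rho k)%R.
    rewrite -(ler_pXn2r n0) ?nnegrE ?enorm_ge0// -(ler_pM2l c0) rhoE -lee_fin fineK//.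
    exact: hausdorff_weight_ge.
  move=> /(le_trans (coord_le_enorm _ i)); rewrite !mxE ler_norml => /andP[h1 h2].
  by apply/andP; split; lra.
have := @box_cover_volume n (fun=> 1%R) (fun k i => zi k i - rho k)%R
  (fun k i => zi k i + rho k)%R (fun=> ler01).
move=> /(_ _ _)/(lee_wpmul2l (ltW c2 : 0 <= (c / 2 ^+ n)%:E)).
rewrite mule1 => vol; apply: le_trans (vol _ _) _; clear vol.
- by move=> k i; have := rho0 k; lra.
- move=> x x01.
  have [k _ Ck] : (\bigcup_k C k) (\row_i x (val i)).
    by apply: QC => i; rewrite mxE.
  rewrite (@nneseriesD1 _ _ k)//; last first.
    by move=> j _; rewrite lee_fin mul1r prodr_ge0.
  rewrite mul1r big1 => [|i _]; last first.
    have := zC _ _ i Ck; rewrite mxE => h.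
    by rewrite indicE mem_set//= in_itv.
  rewrite -[leLHS]adde0 leeD2l// nneseries_ge0// => j _ _.
  by rewrite lee_fin mul1r prodr_ge0.
rewrite -nneseriesZl; last first.
  move=> k _; rewrite lee_fin mul1r prodr_ge0// => i _.
  by rewrite opprD opprK addrACA subrr add0r addr_ge0.
apply: lee_nneseries => k *.
  rewrite -EFinM lee_fin mulr_ge0 ?(ltW c2)// mul1r prodr_ge0// => i _.
  by rewrite opprD opprK addrACA subrr add0r addr_ge0.
rewrite -EFinM -[leRHS]fineK// lee_fin mul1r -/(w k) -rhoE.
rewrite (eq_bigr (fun=> 2 * rho k)%R) => [|i _]; last first.
  by rewrite opprD opprK addrACA subrr add0r mulr2n mulrDl mul1r.
rewrite prodr_const card_ord exprMn mulrA divfK//.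
Qed.

End unit_cube_measure.

(** * Dyadic cubes, Borel sets and uniqueness of measures *)

Section dyadic_cubes.
Context (R : realType) (n : nat).
Local Notation T := 'rV[R]_n.

Definition dyadic_cube (k : nat) (z : {ffun 'I_n -> int}) : set T :=
  [set x | forall i, (z i)%:~R <= 2 ^+ k * x 0 i < (z i + 1)%:~R].

Definition dyadic_cubes : set (set T) :=
  [set A | A = set0 \/ exists k z, A = dyadic_cube k z].

Lemma dyadic_cube_image k z : dyadic_cube k z =
  (fun x => 2 ^- k *: x) @` ((fun x => \row_i (z i)%:~R + x) @` @unit_cube R n).
Proof.
have k0 : 0 < 2 ^+ k :> R by rewrite exprn_gt0.
apply/seteqP; split => x.
  move=> xz; exists (2 ^+ k *: x); last by rewrite scalerA mulVf ?scale1r ?gt_eqF.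
  exists (2 ^+ k *: x - \row_i (z i)%:~R); last by rewrite addrC subrK.
  by move=> i; have := xz i; rewrite !mxE intrD; lra.
move=> [_ [y yQ <-] <-] i; have := yQ i; rewrite !mxE mulrA mulfV ?gt_eqF// mul1r intrD.
lra.
Qed.

(** At the finer scale the bounds of the coarse cube are integers as well. A strict inequality
    through the common point x therefore becomes a weak one between the integer bounds
    themselves. *)
Lemma dyadic_cube_sub k l z w x : dyadic_cube k z x -> dyadic_cube (k + l) w x ->
  dyadic_cube (k + l) w `<=` dyadic_cube k z.
Proof.
move=> xz xw y yw i; have := xz i; have := xw i; have := yw i.
set a : R := 2 ^+ k; have l0 : 0 < 2 ^+ l :> R by rewrite exprn_gt0.
have -> : 2 ^+ (k + l) = 2 ^+ l * a :> R by rewrite exprD mulrC.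
rewrite -!mulrA; move=> /andP[y1 y2] /andP[x1 x2] /andP[x3 x4].
have zw : 2 ^+ l * (z i)%:~R <= (w i)%:~R :> R.
  have : 2 ^+ l * (z i)%:~R < (w i + 1)%:~R :> R.
    by apply: le_lt_trans x2; rewrite ler_pM2l.
  have -> : 2 ^+ l * (z i)%:~R = (2 ^+ l * z i)%:~R :> R by rewrite intrM rmorphXn.
  by rewrite ltr_int ler_int ltzD1.
have wz : (w i + 1)%:~R <= 2 ^+ l * (z i + 1)%:~R :> R.
  have : (w i)%:~R < 2 ^+ l * (z i + 1)%:~R :> R.
    by apply: le_lt_trans x1 _; rewrite ltr_pM2l.
  have -> : 2 ^+ l * (z i + 1)%:~R = (2 ^+ l * (z i + 1))%:~R :> R.
    by rewrite intrM rmorphXn.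
  by rewrite ltr_int ler_int lezD1.
apply/andP; split; first by rewrite -(ler_pM2l l0) (le_trans zw).
by rewrite -(ltr_pM2l l0) (lt_le_trans y2).
Qed.

(** Two dyadic cubes are nested or disjoint, so together with the empty set they form the pi-system
    on which measures are compared. *)
Lemma dyadic_cubesI : setI_closed dyadic_cubes.
Proof.
move=> A B [->|[k [z ->]]]; first by left; rewrite set0I.
move=> [->|[l [w ->]]]; first by left; rewrite setI0.
have [->|/set0P[x [xz xw]]] := eqVneq (dyadic_cube k z `&` dyadic_cube l w) set0.
  by left.
right; have [kl|/ltnW lk] := leqP k l.
  exists l, w; apply/setIidPr.
  by rewrite -(subnKC kl) in xw *; exact: dyadic_cube_sub xz xw.
exists k, z; apply/setIidPl.
by rewrite -(subnKC lk) in xz *; exact: dyadic_cube_sub xw xz.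
Qed.

Lemma dyadic_cube_floor k (x : T) :
  dyadic_cube k [ffun i => Num.floor (2 ^+ k * x 0 i)] x.
Proof. by move=> i; rewrite ffunE floor_le/= floorD1_gt. Qed.

Lemma dyadic_cube_diam k z x y : dyadic_cube k z x -> dyadic_cube k z y ->
  `|x - y| <= 2 ^- k.
Proof.
move=> xz yz; apply/norm_leP; first by rewrite invr_ge0 exprn_ge0.
have k0 : 0 < 2 ^+ k :> R by rewrite exprn_gt0.
move=> i; have := xz i; have := yz i; rewrite !mxE intrD => h1 h2.
rewrite -(ler_pM2l k0) divff ?gt_eqF// -[X in (X * _)%R]gtr0_norm// -normrM.
by rewrite mulrBr ler_norml; lra.
Qed.

Lemma open_bigcup_dyadic (U : set T) : open U ->
  U = \bigcup_(kz in [set kz : nat * {ffun 'I_n -> int} |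
         dyadic_cube kz.1 kz.2 `<=` U]) dyadic_cube kz.1 kz.2.
Proof.
move=> oU; apply/seteqP; split => x; last by move=> [kz /= kzU /kzU].
move=> Ux; have /nbhs_ballP[e /= e0 xe] : nbhs x U by exact: open_nbhs_nbhs.
have [k ke] : exists k, 2 ^- k < e.
  exists (Num.truncn e^-1).+1; rewrite -[ltRHS]invrK ltf_pV2 ?posrE ?invr_gt0 ?exprn_gt0//.
  apply: lt_trans (truncnS_gt _) _.
  by rewrite -natrX ltr_nat ltn_expl.
exists (k, [ffun i => Num.floor (2 ^+ k * x 0 i)]); last exact: dyadic_cube_floor.
move=> y /= yz; apply: xe; rewrite mx_norm_ball /ball_ /=.
apply: le_lt_trans ke; apply: dyadic_cube_diam yz; exact: dyadic_cube_floor.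
Qed.

Local Notation Borel := (<<s dyadic_cubes >>).

Lemma dyadic_generated_open (U : set T) : open U -> Borel U.
Proof.
move=> /open_bigcup_dyadic ->; rewrite bigcup_mkcond.
apply: (@countable_bigcupT_measurable _ (g_sigma_algebraType dyadic_cubes)).
  exact: countableP.
move=> kz; case: ifPn => _.
  by apply: sub_sigma_algebra; right; exists kz.1, kz.2.
exact: (@measurable0 _ (g_sigma_algebraType dyadic_cubes)).
Qed.

Lemma dyadic_generated_closed (F : set T) : closed F -> Borel F.
Proof.
move=> cF; rewrite -(setCK F).
apply: (@measurableC _ (g_sigma_algebraType dyadic_cubes)).
by apply: dyadic_generated_open; exact: closed_openC.
Qed.

Section caratheodory.
Variable mu : {outer_measure set T -> \bar R}.
Hypothesis mu_sep : separated_superadditive mu.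

Lemma dyadic_cube_caratheodory k z : mu.-caratheodory (dyadic_cube k z).
Proof.
have k0 : 0 < 2 ^+ k :> R by rewrite exprn_gt0.
have mle i c : mu.-cara.-measurable [set x : caratheodory_type mu | (x : T) 0 i <= c].
  exact: caratheodory_coord_le.
have mlt i c : mu.-cara.-measurable [set x : caratheodory_type mu | (x : T) 0 i < c].
  rewrite (_ : mkset _ = \bigcup_k [set x : T | x 0 i <= c - k.+1%:R^-1]).
    by apply: bigcupT_measurable => j; exact: mle.
  apply/seteqP; split => x /=.
    move=> xc; exists (Num.truncn (c - x 0 i)^-1) => //=.
    rewrite lerBrDr -lerBrDl -[leRHS]invrK lef_pV2 ?posrE ?invr_gt0 ?subr_gt0//.
    by rewrite ltW// truncnS_gt.
  by move=> [j _ /= /le_lt_trans]; apply; rewrite ltrBlDr ltrDl.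
rewrite (_ : dyadic_cube k z = \bigcap_(i in [set: 'I_n])
  ([set x : T | x 0 i < 2 ^- k * (z i + 1)%:~R] `\`
   [set x : T | x 0 i < 2 ^- k * (z i)%:~R])).
  apply: (@fin_bigcap_measurable _ (caratheodory_type mu)); first exact: finite_finset.
  by move=> i _; apply: measurableD; exact: mlt.
apply/seteqP; split => [x xz i _|x xz i].
  have := xz i => /andP[h1 h2]; split => /=; first by rewrite ltr_pdivlMl.
  by apply/negP; rewrite -leNgt ler_pdivrMl.
have [/= h1 /negP] := xz i I; rewrite -leNgt ler_pdivrMl// => ->.
by rewrite ltr_pdivlMl in h1.
Qed.

Lemma borel_caratheodory (A : set T) : Borel A -> mu.-caratheodory A.
Proof.
apply: smallest_sub; first exact: (sigma_algebra_measurable (caratheodory_type mu)).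
move=> _ [->|[k [z ->]]]; last exact: dyadic_cube_caratheodory.
exact: (@measurable0 _ (caratheodory_type mu)).
Qed.

(** The proof of separation is a parameter so that the measure structure declared below can be
    recovered from the term alone. *)
Definition borel_restriction of separated_superadditive mu :
  set (g_sigma_algebraType dyadic_cubes) -> \bar R := mu.

Lemma borel_restriction_sigma_additive :
  semi_sigma_additive (borel_restriction mu_sep).
Proof.
move=> F mF tF mUF.
apply: (@measure_semi_sigma_additive _ (caratheodory_type mu) _
  (mu : set (caratheodory_type mu) -> \bar R)) => //.
  by move=> i; exact: borel_caratheodory (mF i).
exact: borel_caratheodory mUF.
Qed.

End caratheodory.

Local Open Scope ereal_scope.

HB.instance Definition _ (mu : {outer_measure set T -> \bar R})
    (h : separated_superadditive mu) :=
  isMeasure.Build _ _ _ (borel_restriction h) (outer_measure0 mu)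
    (outer_measure_ge0 mu) (@borel_restriction_sigma_additive mu h).

Lemma dyadic_uniqueness (mu nu : {outer_measure set T -> \bar R}) (c : R) :
  (0 <= c)%R -> separated_superadditive mu -> separated_superadditive nu ->
  (forall k z, nu (dyadic_cube k z) = c%:E * mu (dyadic_cube k z)) ->
  (forall z, mu (dyadic_cube 0 z) < +oo) ->
  forall A, Borel A -> nu A = c%:E * mu A.
Proof.
move=> c0 musep nusep munu mufin A mA.
pose m1 := mscale (NngNum c0) (borel_restriction musep).
pose m2 := borel_restriction nusep.
(* An enumeration of the unit cubes with integer corners: they exhaust the space by sets of finite
   measure. *)
pose g i := if unpickle i is Some z then dyadic_cube 0 z else set0.
have := @measure_unique _ R (g_sigma_algebraType dyadic_cubes) dyadic_cubes g
  erefl dyadic_cubesI.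
move=> /(_ _ _ m1 m2 _ _ A mA) <- //.
- move=> i; rewrite /g; case: unpickle => [z|]; last by left.
  by right; exists 0%N, z.
- rewrite -subTset => x _.
  exists (pickle [ffun i : 'I_n => Num.floor (2 ^+ 0 * (x : T) 0 i)%R]) => //.
  by rewrite /g pickleK; exact: dyadic_cube_floor.
- move=> _ [->|[k [z ->]]]; first by rewrite !measure0.
  by rewrite /m1 /m2 /mscale /= /borel_restriction munu.
move=> k; change (c%:E * mu (g k) < +oo); rewrite /g.
case: unpickle => [z|]; last by rewrite outer_measure0 mule0.
by rewrite lte_mul_pinfty.
Qed.

End dyadic_cubes.

(** * Linear images of Hausdorff measures *)

Lemma enorm_continuous (R : realType) n : continuous (@enorm R n).
Proof.
move=> x; apply/(@cvgrPdist_lt _ _ _ (nbhs x)) => e e0; apply/nbhs_enormP; exists e => // y.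
apply: le_lt_trans; rewrite ler_norml enormBC enorm_subl andbT.
by rewrite lerNl opprB enormBC enorm_subl.
Qed.

Lemma continuous_enormP (R : realType) n p (f : 'rV[R]_n -> 'rV[R]_p) x :
  {for x, continuous f} <-> forall e, 0 < e -> exists2 d, 0 < d &
    forall y, enorm (y - x) < d -> enorm (f y - f x) < e.
Proof.
split=> [fx e e0|fx O].
  have : nbhs (f x) [set y | enorm (y - f x) < e] by apply/nbhs_enormP; exists e.
  by move=> /fx/nbhs_enormP.
move=> /nbhs_enormP[e e0 eO]; have [d d0 df] := fx _ e0.
by apply/nbhs_enormP; exists d => // y /df/eO.
Qed.

Lemma mulmxr_continuous (R : realType) n p (A : 'M[R]_(n, p)) :
  continuous (fun b : 'rV[R]_n => b *m A).
Proof.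
have [c c0 cA] := enorm_mulmx_le A.
move=> x; apply/continuous_enormP => e e0; exists (e / c); first by rewrite divr_gt0.
move=> y; rewrite -mulmxBl ltr_pdivlMr// mulrC.
exact: le_lt_trans.
Qed.

Lemma closed_sublevel (R : realType) (T : topologicalType) (f : T -> R) c :
  continuous f -> closed [set x | f x <= c].
Proof.
move=> cf; rewrite (_ : mkset _ = f @^-1` [set x | x <= c])//.
by apply: preimage_closed => [//|]; exact: closed_le.
Qed.

Section closure_cover.
Context (R : realType) (n : nat).
Implicit Types C : set 'rV[R]_n.

(** The function f lets the same argument serve the diameter bound (f the identity) and the weight
    (f a multiple of a power). The inequality is closed in each point separately, so one point is
    passed to the closure at a time. *)
Lemma closure_sublevel2 C (f : R -> R) c : continuous f ->
  (forall x y, C x -> C y -> f (enorm (x - y)) <= c) ->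
  forall x y, closure C x -> closure C y -> f (enorm (x - y)) <= c.
Proof.
move=> cf Cc.
have cont (z : 'rV[R]_n) : continuous (fun y : 'rV[R]_n => f (enorm (z - y))).
  move=> y; apply: continuous_comp; last exact: cf.
  apply: continuous_comp; last exact: enorm_continuous.
  by apply: continuousB; [exact: cst_continuous|exact: id].
have step x : C x -> closure C `<=` [set y | f (enorm (x - y)) <= c].
  move=> Cx; rewrite [X in _ `<=` X](closure_id _).1; last exact: closed_sublevel.
  by apply: closure_subset => y Cy; exact: Cc.
move=> x y Cx Cy; rewrite enormBC.
suff : closure C `<=` [set x | f (enorm (y - x)) <= c] by exact.
rewrite [X in _ `<=` X](closure_id _).1; last exact: closed_sublevel.
by apply: closure_subset => z Cz /=; rewrite enormBC; exact: step.
Qed.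

Lemma hausdorff_weight_closure m C : hausdorff_weight m C \is a fin_num ->
  hausdorff_weight m (closure C) = hausdorff_weight m C.
Proof.
move=> wfin; apply/eqP; rewrite eq_le; apply/andP; split; last first.
  by apply: le_hausdorff_weight; exact: subset_closure.
apply: hausdorff_weight_le; first exact: hausdorff_weight_ge0.
move=> x y Cx Cy; rewrite -(fineK wfin) lee_fin.
apply: (closure_sublevel2 (f := fun t => ball_volume R m / 2 ^+ m * t ^+ m)) Cx Cy.
  move=> t; apply: cvgM; first exact: cvg_cst.
  exact: exprn_continuous.
by move=> {}x {}y Cx Cy; rewrite -lee_fin (fineK wfin); exact: hausdorff_weight_ge.
Qed.

End closure_cover.

Section linear_images.
Context (R : realType) (n p : nat).
Local Open Scope ereal_scope.

(** The measure of linear images, regarded as an outer measure on the parameter space: it is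
    translation invariant and homogeneous, so its value on the unit cube determines it on all dyadic
    cubes. *)
Definition linear_hausdorff (A : 'M[R]_(n, p)) (B : set 'rV[R]_n) : \bar R :=
  hausdorff n ((fun b => b *m A) @` B).

Variable A : 'M[R]_(n, p).

Lemma linear_hausdorff0 : linear_hausdorff A set0 = 0.
Proof. by rewrite /linear_hausdorff image_set0 hausdorff0. Qed.

Lemma linear_hausdorff_ge0 B : 0 <= linear_hausdorff A B.
Proof. exact: hausdorff_ge0. Qed.

Lemma le_linear_hausdorff :
  {homo linear_hausdorff A : B C / B `<=` C >-> B <= C}.
Proof. by move=> B C BC; apply: le_hausdorff; exact: image_subset. Qed.

Lemma linear_hausdorff_sigma_subadditive :
  sigma_subadditive (linear_hausdorff A).
Proof.
move=> F; rewrite /linear_hausdorff image_bigcup.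
exact: hausdorff_sigma_subadditive.
Qed.

HB.instance Definition _ := isOuterMeasure.Build R 'rV[R]_n (linear_hausdorff A)
  linear_hausdorff0 linear_hausdorff_ge0 le_linear_hausdorff
  linear_hausdorff_sigma_subadditive.

Lemma linear_hausdorff_separated : row_free A ->
  separated_superadditive (linear_hausdorff A).
Proof.
move=> /enorm_row_free_le[c c0 cA] B C e e0 BC.
rewrite /linear_hausdorff image_setU.
apply: (@hausdorff_separated R n p _ _ (e / c)%R); first by rewrite divr_gt0.
move=> _ _ [b Bb <-] [c' Cc <-]; rewrite -mulmxBl ler_pdivrMr// mulrC.
exact: le_trans (BC _ _ Bb Cc) (cA _).
Qed.

Lemma linear_hausdorff_dyadic k z :
  linear_hausdorff A (dyadic_cube k z) =
  (2 ^- k ^+ n)%:E * linear_hausdorff A (@unit_cube R n).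
Proof.
rewrite /linear_hausdorff dyadic_cube_image.
set S := fun x : 'rV[R]_n => (2 ^- k *: x)%R.
set t := (\row_i (z i)%:~R : 'rV[R]_n)%R.
have -> : (fun b => b *m A) @` (S @` ((fun x => t + x)%R @` @unit_cube R n)) =
    (fun x => 2 ^- k *: x)%R @`
      ((fun x => t *m A + x)%R @` ((fun b => b *m A) @` @unit_cube R n)).
  apply/seteqP; split => y.
    move=> [_ [_ [b Qb <-] <-] <-]; exists (t *m A + b *m A)%R.
      by exists (b *m A) => //; exists b.
    by rewrite /S -scalemxAl mulmxDl.
  move=> [_ [_ [b Qb <-] <-] <-]; exists (S (t + b)%R).
    by exists (t + b)%R => //; exists b.
  by rewrite /S -scalemxAl mulmxDl.
by rewrite hausdorff_scale ?invr_gt0 ?exprn_gt0// hausdorff_translate.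
Qed.

(** Borel regularity. Closing the sets of a cover changes neither diameters nor weights, so
    near-optimal covers at the scales 1 / (k + 1) may be taken closed; [B'] is the preimage of the
    intersection over k of their unions. It extends the scaling law from Borel sets to arbitrary
    sets. *)
Lemma linear_hausdorff_hull (B : set 'rV[R]_n) :
  exists B', [/\ B `<=` B', <<s @dyadic_cubes R n >> B' &
    linear_hausdorff A B' = linear_hausdorff A B].
Proof.
have [Boo|Boo] := eqVneq (linear_hausdorff A B) +oo.
  exists setT; split => //; first exact: (@measurableT _ (g_sigma_algebraType _)).
  apply/eqP; rewrite eq_le Boo leey/= -Boo.
  exact: le_linear_hausdorff.
have Bfin : linear_hausdorff A B \is a fin_num.
  by rewrite ge0_fin_numE ?linear_hausdorff_ge0// ltey.
set BA := (fun b => b *m A) @` B.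
pose delta k : R := (k.+1%:R^-1)%R.
have delta0 k : (0 < delta k)%R by rewrite invr_gt0.
have [C CP] : {C : nat -> (set 'rV[R]_p)^nat & forall k,
    fine_cover (delta k) BA (C k) /\
    \sum_(j <oo) hausdorff_weight n (C k j) < linear_hausdorff A B + (delta k)%:E}.
  apply: (@choice _ _ (fun k C => fine_cover (delta k) BA C /\
    \sum_(j <oo) hausdorff_weight n (C j) < linear_hausdorff A B + (delta k)%:E)) => k.
  have le_k : hausdorff_content n (delta k) BA <= linear_hausdorff A B.
    exact: hausdorff_content_le.
  have fin_k : hausdorff_content n (delta k) BA \is a fin_num.
    rewrite ge0_fin_numE ?hausdorff_content_ge0//.
    by apply: le_lt_trans le_k _; rewrite ltey_eq Bfin.
  have [_ [C CBA <-] CC] := lb_ereal_inf_adherent (delta0 k) fin_k.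
  by exists C; split => //; apply: lt_le_trans CC _; rewrite leeD2r.
pose B' := \bigcap_k \bigcup_j [set b : 'rV[R]_n | closure (C k j) (b *m A)].
have BB' : B `<=` B'.
  move=> b Bb k _; have [] := (CP k).1 => /(_ (b *m A)); case; first by exists b.
  by move=> j _ Cj _; exists j => //; exact: subset_closure.
exists B'; split => //.
  apply: (@bigcapT_measurable _ (g_sigma_algebraType _)) => k.
  apply: (@bigcupT_measurable _ (g_sigma_algebraType _)) => j.
  apply: dyadic_generated_closed.
  apply: (@preimage_closed _ _ (fun b : 'rV[R]_n => b *m A)); last exact: closed_closure.
  by move=> x _; exact: mulmxr_continuous.
apply/eqP; rewrite eq_le; apply/andP; split; last exact: le_linear_hausdorff.
apply: ge_ereal_sup => _ [d /= d0 <-].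
apply/lee_addgt0Pr => e e0.
pose k := Num.truncn (Num.min d e)^-1.
have de0 : (0 < Num.min d e)%R by rewrite lt_min d0.
have kde : (delta k <= Num.min d e)%R.
  rewrite -[leRHS]invrK lef_pV2 ?posrE ?invr_gt0//.
  by rewrite ltW// truncnS_gt.
have [[BC Cd] Csum] := CP k.
apply: (@le_trans _ _ (\sum_(j <oo) hausdorff_weight n (C k j))); last first.
  apply: le_trans (ltW Csum) _; rewrite leeD2l// lee_fin (le_trans kde)//.
  by rewrite ge_min lexx orbT.
apply: (@le_trans _ _ (\sum_(j <oo) hausdorff_weight n (closure (C k j)))).
  apply: ereal_inf_lbound; exists (fun j => closure (C k j)) => //; split.
    by move=> _ [b /(_ k I)[j _ Cj] <-]; exists j.
  move=> j; apply: (closure_sublevel2 (f := id)) => [t|x y Cx Cy]; first exact.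
  by apply: le_trans (Cd j x y Cx Cy) (le_trans kde _); rewrite ge_min lexx.
apply: lee_nneseries => [j *|j *]; first exact: hausdorff_weight_ge0.
rewrite hausdorff_weight_closure// ge0_fin_numE ?hausdorff_weight_ge0//.
apply: (@le_lt_trans _ _ (ball_volume R n / 2 ^+ n * delta k ^+ n)%:E); last exact: ltry.
have c0 : (0 <= ball_volume R n / 2 ^+ n)%R.
  by apply: divr_ge0; [apply/ltW/ball_volume_gt0|rewrite exprn_ge0].
apply: hausdorff_weight_le.
  by rewrite lee_fin mulr_ge0// exprn_ge0// ltW.
move=> x y Cx Cy; rewrite lee_fin ler_wpM2l// lerXn2r ?nnegrE ?enorm_ge0 ?(ltW (delta0 k))//.
exact: Cd Cx Cy.
Qed.

End linear_images.

Section linear_scaling.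
Context (R : realType) (n : nat).
Local Open Scope ereal_scope.
Local Notation Q := (@unit_cube R n.+1).

(** Required for every set B, measurable or not, because the local comparisons below are applied to
    arbitrary pieces. For a rectangular A the factor c remains an unknown positive constant. *)
Definition scales_hausdorff p (A : 'M[R]_(n.+1, p)) (c : R) :=
  forall B, hausdorff n.+1 ((fun b => b *m A) @` B) = c%:E * hausdorff n.+1 B.

Lemma hausdorff_unit_cube_fin_num : hausdorff n.+1 Q \is a fin_num.
Proof. by rewrite ge0_fin_numE ?hausdorff_ge0// hausdorff_unit_cube_fin. Qed.

Lemma linear_hausdorff1 (B : set 'rV[R]_n.+1) :
  linear_hausdorff 1%:M B = hausdorff n.+1 B.
Proof.
rewrite /linear_hausdorff (_ : (fun b => _) = id) ?image_id//.
by apply/funext => b; rewrite mulmx1.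
Qed.

Lemma scales_hausdorff_ge p (A : 'M[R]_(n.+1, p)) c k : (0 < k)%R ->
  (forall u, enorm u <= k * enorm (u *m A))%R ->
  scales_hausdorff A c -> (1 <= k ^+ n.+1 * c)%R.
Proof.
move=> k0 kA Ac; have q0 := hausdorff_unit_cube_gt0 R (ltn0Sn n).
have : hausdorff n.+1 (id @` Q) <=
    (k ^+ n.+1)%:E * hausdorff n.+1 ((fun b => b *m A) @` Q).
  by apply: hausdorff_lip => // a b _ _; rewrite -mulmxBl; exact: kA.
rewrite Ac image_id -(fineK hausdorff_unit_cube_fin_num) -!EFinM lee_fin mulrA.
by rewrite -[leLHS]mul1r ler_pM2r// fine_gt0// q0/= hausdorff_unit_cube_fin.
Qed.

Lemma scales_hausdorff_le p (A : 'M[R]_(n.+1, p)) c k : (0 < k)%R ->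
  (forall u, enorm (u *m A) <= k * enorm u)%R ->
  scales_hausdorff A c -> (c <= k ^+ n.+1)%R.
Proof.
move=> k0 kA Ac; have q0 := hausdorff_unit_cube_gt0 R (ltn0Sn n).
have : hausdorff n.+1 ((fun b => b *m A) @` Q) <=
    (k ^+ n.+1)%:E * hausdorff n.+1 (id @` Q).
  by apply: hausdorff_lip => // a b _ _; rewrite -mulmxBl; exact: kA.
rewrite Ac image_id -(fineK hausdorff_unit_cube_fin_num) -!EFinM lee_fin.
by rewrite ler_pM2r// fine_gt0// q0/= hausdorff_unit_cube_fin.
Qed.

(** Translation invariance and homogeneity make the measure of images proportional to the Hausdorff
    measure on dyadic cubes. Uniqueness of measures extends this to Borel sets, and Borel hulls on
    either side extend it to all sets. *)
Lemma scales_hausdorff_ex p (A : 'M[R]_(n.+1, p)) : row_free A ->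
  exists2 c : R, (0 < c)%R & scales_hausdorff A c.
Proof.
move=> Afree; have Qfin := hausdorff_unit_cube_fin_num.
have q0 : (0 < fine (hausdorff n.+1 Q))%R.
  by rewrite fine_gt0// hausdorff_unit_cube_gt0//= hausdorff_unit_cube_fin.
have [k k0 kA] := enorm_mulmx_le A.
have AQfin : linear_hausdorff A Q \is a fin_num.
  rewrite ge0_fin_numE ?linear_hausdorff_ge0//.
  apply: (@le_lt_trans _ _ ((k ^+ n.+1)%:E * hausdorff n.+1 Q)).
    rewrite -[in leRHS](image_id Q); apply: hausdorff_lip => // a b _ _.
    by rewrite -mulmxBl.
  by rewrite lte_mul_pinfty ?hausdorff_unit_cube_fin// lee_fin exprn_ge0// ltW.
pose c : R := (fine (linear_hausdorff A Q) / fine (hausdorff n.+1 Q))%R.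
have c0 : (0 <= c)%R by apply: divr_ge0; apply: fine_ge0; [exact: linear_hausdorff_ge0|exact: hausdorff_ge0].
have AQ : linear_hausdorff A Q = c%:E * hausdorff n.+1 Q.
  by rewrite -(fineK AQfin) -(fineK Qfin) -EFinM /c divfK// gt_eqF.
(* The Hausdorff measure itself is treated as the case of the identity matrix, so that the facts on
   linear images apply to both sides. *)
have sep1 : separated_superadditive (linear_hausdorff (1%:M : 'M[R]_n.+1)).
  by apply: linear_hausdorff_separated; rewrite row_free_unit unitmx1.
have cube k' z : linear_hausdorff A (dyadic_cube k' z) =
    c%:E * linear_hausdorff (1%:M : 'M[R]_n.+1) (dyadic_cube k' z).
  by rewrite !linear_hausdorff_dyadic AQ linear_hausdorff1 muleCA.
have borel := dyadic_uniqueness c0 sep1 (linear_hausdorff_separated Afree) cube.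
have scale : scales_hausdorff A c.
  move=> B; rewrite -linear_hausdorff1.
  have {}borel := borel _; have fin z : linear_hausdorff (1%:M : 'M[R]_n.+1) (dyadic_cube 0 z) < +oo.
    rewrite linear_hausdorff_dyadic linear_hausdorff1.
    by rewrite lte_mul_pinfty ?hausdorff_unit_cube_fin// lee_fin !exprn_ge0.
  apply/eqP; rewrite eq_le; apply/andP; split.
    have [B' [BB' mB' <-]] := linear_hausdorff_hull 1%:M B.
    by rewrite -borel//; exact: le_linear_hausdorff.
  have [B' [BB' mB' E]] := linear_hausdorff_hull A B.
  rewrite -[leRHS]E borel// lee_wpmul2l//; exact: le_linear_hausdorff.
exists c => //; rewrite lt_neqAle c0 andbT; apply/eqP => c00.
have [k' k'0 k'A] := enorm_row_free_le Afree.
by have := scales_hausdorff_ge k'0 k'A scale; rewrite -c00 mulr0 ler10.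
Qed.

Lemma scales_hausdorffM p (A : 'M[R]_(n.+1, p)) W a w : scales_hausdorff W w ->
  scales_hausdorff A a -> scales_hausdorff (W *m A) (w * a).
Proof.
move=> Ww Aa B; rewrite (_ : (fun b => _) = (fun b => b *m A) \o (fun b => b *m W)).
  by rewrite -image_comp Aa Ww muleA -EFinM mulrC.
by apply/funext => b /=; rewrite mulmxA.
Qed.

Lemma scales_hausdorff_uniq p (A : 'M[R]_(n.+1, p)) a b :
  scales_hausdorff A a -> scales_hausdorff A b -> a = b.
Proof.
move=> Aa /(_ Q); rewrite Aa -(fineK hausdorff_unit_cube_fin_num) -!EFinM => -[].
apply: mulIf; rewrite gt_eqF// fine_gt0// hausdorff_unit_cube_gt0//=.
exact: hausdorff_unit_cube_fin.
Qed.

Lemma scales_hausdorff_isometry (P : 'M[R]_n.+1) :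
  (forall u, enorm (u *m P) = enorm u) -> scales_hausdorff P 1.
Proof.
move=> iP B; rewrite mul1e -[in RHS](image_id B); apply: hausdorff_isometry => a b _ _.
by rewrite -mulmxBl iP.
Qed.

End linear_scaling.

(** * Scaling factors of square matrices *)

Section determinant.
Context (R : realType) (n : nat).
Implicit Types W : 'M[R]_n.+1.

Lemma enorm_mulmx_entry_le m p (E T : 'M[R]_(m, p)) (t : R) : 0 <= t ->
  (forall i j, `|E i j| <= t * `|T i j|) ->
  forall u, enorm (u *m E) <= t * (p%:R * \sum_i \sum_j `|T i j|) * enorm u.
Proof.
move=> t0 ET u; apply: le_trans (enorm_le_norm _) _.
rewrite mulrCA -mulrA ler_wpM2l//; apply/norm_leP => [|j].
  rewrite mulr_ge0 ?enorm_ge0// mulr_ge0// sumr_ge0// => i _.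
  by rewrite sumr_ge0.
rewrite mxE; apply: le_trans (ler_norm_sum _ _ _) _.
rewrite mulr_sumr mulr_suml; apply: ler_sum => i _.
rewrite normrM mulrC; apply: ler_pM => //; last exact: coord_le_enorm.
apply: le_trans (ET i j) _; rewrite ler_wpM2l// (bigD1 j)//= lerDl.
by rewrite sumr_ge0.
Qed.

Lemma expr_near1 N (e : R) : 0 < e ->
  exists2 d, 0 < d & forall x, 0 <= x <= d -> (1 + x) ^+ N < 1 + e.
Proof.
move=> e0; have := @exprn_continuous R N 1; move=> /cvgrPdist_lt/(_ _ e0).
move=> /nbhs_ballP[d /= d0 dP]; exists (d / 2); first by rewrite divr_gt0.
move=> x /andP[x0 xd]; have /dP : ball (1 : R) d (1 + x).
  by rewrite /ball /= opprD addNKr normrN ger0_norm//; lra.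
by rewrite /= expr1n ltr_norml => /andP[]; lra.
Qed.

(** Conjugation by the diagonal matrix with entries t^(r i) preserves the factor and multiplies the
    entry (i, j) by t^(r i - r j), which is small wherever [W i j] is not forced to vanish. As t
    goes to 0 the conjugate tends to the identity, so the factor is 1. The rank r covers lower and
    upper triangular matrices at once. *)
Lemma scales_hausdorff_unitriangular (r : 'I_n.+1 -> nat) W : W \in unitmx ->
  (forall i, W i i = 1) ->
  (forall i j, i != j -> (r i <= r j)%N -> W i j = 0) ->
  scales_hausdorff W 1.
Proof.
move=> Wu W1 W0; have [s s0 Ws] : exists2 c : R, 0 < c & scales_hausdorff W c.
  by apply: scales_hausdorff_ex; rewrite row_free_unit.
suff -> : 1 = s by [].
pose D (t : R) := diag_mx (\row_i t ^+ r i) : 'M[R]_n.+1.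
pose K : R := n.+1%:R * \sum_i \sum_j `|W i j|.
have K0 : 0 <= K by rewrite mulr_ge0// sumr_ge0// => i _; rewrite sumr_ge0.
have DD t : 0 < t -> D t *m D t^-1 = 1%:M.
  move=> t0; rewrite mulmx_diag -diag_const_mx; congr diag_mx.
  by apply/rowP => i; rewrite !mxE -exprMn divff ?expr1n// gt_eqF.
have conj t : 0 < t -> scales_hausdorff (D t *m W *m D t^-1) s.
  move=> t0; have Dfree t' : 0 < t' -> row_free (D t').
    move=> t'0; rewrite row_free_unit.
    by have /mulmx1_unit[] := DD _ t'0.
  have [a a0 Da] := scales_hausdorff_ex (Dfree _ t0).
  have t0' : 0 < t^-1 by rewrite invr_gt0.
  have [b b0 Db] := scales_hausdorff_ex (Dfree _ t0').
  have := scales_hausdorffM Da Db; rewrite DD// => ab.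
  have ab1 : a * b = 1.
    apply: scales_hausdorff_uniq ab _.
    by apply: scales_hausdorff_isometry => u; rewrite mulmx1.
  have := scales_hausdorffM (scales_hausdorffM Da Ws) Db.
  by rewrite mulrAC ab1 mul1r.
have close t : 0 < t <= 1 -> forall u : 'rV[R]_n.+1,
    enorm (u *m (D t *m W *m D t^-1) - u) <= t * K * enorm u.
  move=> /andP[t0 t1] u; rewrite -{2}[u]mulmx1 -mulmxBr.
  apply: enorm_mulmx_entry_le => [|i j]; first exact: ltW.
  rewrite mul_mx_diag mul_diag_mx !mxE.
  have [->|ij] := eqVneq i j.
    rewrite W1 mulr1 -exprMn divff ?gt_eqF// expr1n subrr normr0.
    by rewrite mulr_ge0// ltW.
  rewrite subr0; have [rij|rji] := leqP (r i) (r j).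
    by rewrite W0// mulr0 mul0r normr0 mulr0.
  rewrite mulrAC normrM ler_wpM2r// -(subnK rji) -addSnnS exprD exprVn mulfK; last first.
    by rewrite expf_eq0 gt_eqF// andbF.
  rewrite exprS normrM ger0_norm ?(ltW t0)//.
  rewrite -[leRHS]mulr1 ler_wpM2l ?(ltW t0)// ger0_norm ?exprn_ge0 ?(ltW t0)//.
  by rewrite exprn_ile1 ?(ltW t0).
have small e : 0 < e -> s <= 1 + e /\ 1 <= (1 + e) * s.
  move=> e0; have [d d0 dP] := expr_near1 n.+1 e0.
  pose x := Num.min (d / 2) (1 / 2).
  have x0 : 0 < x by rewrite lt_min !divr_gt0.
  have [xd x1] : x <= d / 2 /\ x <= 1 / 2 by rewrite !ge_min !lexx orbT.
  pose t := Num.min 1 (x / (K + 1)).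
  have K1 : 0 < K + 1 by rewrite ltr_wpDl.
  have t01 : 0 < t <= 1 by rewrite lt_min ltr01 divr_gt0//= ge_min lexx.
  have tK : t * K <= x.
    apply: (@le_trans _ _ (x / (K + 1) * K)).
      by rewrite ler_wpM2r// ge_min lexx orbT.
    by rewrite mulrAC ler_pdivrMr// ler_wpM2l ?(ltW x0)// lerDl.
  have t0 := andP t01; have cl u := le_trans (close t t01 u) (ler_wpM2r (enorm_ge0 u) tK).
  split.
    apply: (@le_trans _ _ ((1 + x) ^+ n.+1)); last first.
      by apply/ltW/dP; lra.
    apply: scales_hausdorff_le (conj _ t0.1); first by lra.
    move=> u; rewrite -[X in enorm X](subrK u) mulrDl mul1r addrC.
    by apply: le_trans (enormD _ _) _; rewrite lerD2l// -addrC addKr.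
  (* For x at most 1/2 the product (1 + 2x)(1 - x) is at least 1, so 1 + 2x is a lower Lipschitz
     constant for the conjugated map. *)
  apply: (@le_trans _ _ ((1 + 2 * x) ^+ n.+1 * s)); last first.
    by rewrite ler_wpM2r ?(ltW s0)//; apply/ltW/dP; lra.
  apply: scales_hausdorff_ge (conj _ t0.1); first by lra.
  move=> u; have := cl u; have := enorm_subl u (u *m (D t *m W *m D t^-1)).
  rewrite (enormBC u); set a := enorm u; set b := enorm (u *m _) => h1 h2.
  have a0 : 0 <= a := enorm_ge0 u.
  have h3 : (1 - x) * a <= b by lra.
  apply: (@le_trans _ _ ((1 + 2 * x) * ((1 - x) * a))); last first.
    by rewrite ler_wpM2l//; lra.
  by rewrite mulrA -[leLHS]mul1r ler_wpM2r//; nra.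
apply/eqP; rewrite eq_le; apply/andP; split; apply/ler_addgt0Pr => e e0.
  have es : 0 < e / s by rewrite divr_gt0.
  by have [_] := small _ es; rewrite mulrDl mul1r divfK// gt_eqF.
by have [] := small _ e0.
Qed.

Lemma scales_hausdorff_scalar (a : R) : a != 0 ->
  scales_hausdorff (a%:M : 'M[R]_n.+1) (`|a| ^+ n.+1).
Proof.
move=> a0; have na0 : 0 < `|a| by rewrite normr_gt0.
have [s s0 As] : exists2 c : R, 0 < c & scales_hausdorff (a%:M : 'M[R]_n.+1) c.
  by apply: scales_hausdorff_ex; rewrite row_free_unit unitmxE det_scalar unitrX// unitfE.
suff -> : `|a| ^+ n.+1 = s by [].
apply/eqP; rewrite eq_le; apply/andP; split; last first.
  by apply: scales_hausdorff_le As => // u; rewrite mul_mx_scalar enormZ.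
have := scales_hausdorff_ge _ _ As (k := `|a|^-1); rewrite exprVn ler_pdivlMl ?exprn_gt0// mulr1.
apply; first by rewrite invr_gt0.
by move=> u; rewrite mul_mx_scalar enormZ mulKf// gt_eqF.
Qed.

Lemma scales_hausdorff_perm (s : 'S_n.+1) : scales_hausdorff (perm_mx s : 'M[R]_n.+1) 1.
Proof.
apply: scales_hausdorff_isometry => u.
rewrite -(invgK s) -col_permE /enorm; congr Num.sqrt; rewrite /dot.
rewrite [RHS](reindex_inj (@perm_inj _ s^-1%g)).
by apply: eq_bigr => i _; rewrite !mxE.
Qed.

Lemma scales_hausdorff_diag_perm (d : 'rV[R]_n.+1) (s : 'S_n.+1) c :
  scales_hausdorff (diag_mx d) c -> scales_hausdorff (diag_mx (\row_j d 0 (s j))) c.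
Proof.
move=> dc; have := scales_hausdorffM (scales_hausdorffM (scales_hausdorff_perm s) dc)
  (scales_hausdorff_perm s^-1).
rewrite mulr1 mul1r -row_permE -col_permE; congr scales_hausdorff.
apply/matrixP => i j; rewrite !mxE (inj_eq perm_inj).
by case: eqP => [->|].
Qed.

(** Cyclic permutations of the diagonal do not change the factor. The product of all [n.+1] of them
    is the scalar matrix of the product of the entries, whose factor is known; taking roots gives
    the claim. *)
Lemma scales_hausdorff_diag (d : 'rV[R]_n.+1) : (forall i, d 0 i != 0) ->
  scales_hausdorff (diag_mx d) `|\prod_i d 0 i|.
Proof.
move=> d0; have p0 : \prod_i d 0 i != 0 by apply/prodf_neq0.
have [c c0 dc] : exists2 c : R, 0 < c & scales_hausdorff (diag_mx d) c.
  by apply: scales_hausdorff_ex; rewrite row_free_unit unitmxE det_diag unitfE.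
suff -> : `|\prod_i d 0 i| = c by [].
have prod_perms (ss : seq 'S_n.+1) :
    scales_hausdorff (diag_mx (\row_j \prod_(s <- ss) d 0 (s j))) (c ^+ size ss).
  elim: ss => [|s ss ih] /=.
    apply: scales_hausdorff_isometry => u; congr enorm.
    rewrite -[RHS]mulmx1 -diag_const_mx; congr (_ *m diag_mx _).
    by apply/rowP => i; rewrite !mxE big_nil.
  have := scales_hausdorffM (scales_hausdorff_diag_perm s dc) ih.
  rewrite -exprS mulmx_diag; congr scales_hausdorff; congr diag_mx.
  by apply/rowP => i; rewrite !mxE big_cons.
pose shift (k : 'I_n.+1) := perm (addrI k).
have := prod_perms [seq shift k | k <- enum 'I_n.+1].
rewrite size_map size_enum_ord (_ : \row_j _ = const_mx (\prod_i d 0 i)); last first.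
  apply/rowP => j; rewrite !mxE big_map big_enum /=.
  rewrite [RHS](reindex_inj (addrI j)); apply: eq_bigr => k _.
  by rewrite permE addrC.
rewrite diag_const_mx => /scales_hausdorff_uniq/(_ (scales_hausdorff_scalar p0)).
move/esym/eqP; rewrite eqrXn2 ?(ltW c0)// => /eqP ->//.
Qed.

(** LUP decomposition: permutation matrices and unitriangular matrices have factor 1, and what
    remains is the diagonal of U, whose product is the determinant up to sign. *)
Lemma scales_hausdorff_det W : W \in unitmx -> scales_hausdorff W `|\det W|.
Proof.
move=> Wu; have := cormen_lup_perm W; have := cormen_lup_correct W.
have := @cormen_lup_upper _ _ W; have := @cormen_lup_lower _ _ W.
have := cormen_lup_detL W.
case: (cormen_lup W) => -[P L] U /= detL lower upper PW /is_perm_mxP[s Ps].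
have {}PW : perm_mx s *m W = L *m U by rewrite -Ps.
have detU : `|\det U| = `|\det W|.
  have : `|\det (perm_mx s *m W)| = `|\det (L *m U)| by rewrite PW.
  by rewrite !det_mulmx detL mul1r det_perm normrM normrX normrN1 expr1n mul1r.
have detU0 : \det U != 0 by rewrite -normr_eq0 detU normr_eq0 -unitfE -unitmxE.
have Udet : \det U = \prod_i U i i.
  rewrite -det_tr det_trig; first by apply: eq_bigr => i _; rewrite mxE.
  by apply/is_trig_mxP => i j ij; rewrite mxE upper.
have U0 i : U i i != 0.
  by move: detU0; rewrite Udet => /prodf_neq0/(_ i isT).
have Ls : scales_hausdorff L 1.
  apply: (@scales_hausdorff_unitriangular (@nat_of_ord _)).
  - by rewrite unitmxE detL unitr1.
  - by move=> i; rewrite lower// eqxx.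
  - by move=> i j ij le_ij; rewrite lower// (negbTE ij).
pose d := \row_i U i i.
pose U1 := diag_mx (\row_i (U i i)^-1) *m U.
have UE : U = diag_mx d *m U1.
  rewrite mulmxA mulmx_diag (_ : \row_j _ = const_mx 1) ?diag_const_mx ?mul1mx//.
  by apply/rowP => i; rewrite !mxE divff.
have U1s : scales_hausdorff U1 1.
  (* The rank decreases with the index because this matrix is upper triangular. *)
  apply: (@scales_hausdorff_unitriangular (fun i => n - i)%N).
  - have : U \in unitmx by rewrite unitmxE unitfE.
    by rewrite UE unitmx_mul => /andP[].
  - by move=> i; rewrite /U1 mul_diag_mx !mxE mulVf.
  - move=> i j ij; rewrite leq_sub2lE => [ji|]; last by rewrite -ltnS.
    rewrite /U1 mul_diag_mx mxE upper ?mulr0// ltn_neqAle [X in _ && X]ji andbT eq_sym.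
    exact: ij.
have ds : scales_hausdorff (diag_mx d) `|\det W|.
  rewrite -detU Udet (_ : \prod_i U i i = \prod_i d 0 i).
    by apply: scales_hausdorff_diag => i; rewrite mxE.
  by apply: eq_bigr => i _; rewrite mxE.
have -> : W = perm_mx s^-1 *m (L *m (diag_mx d *m U1)).
  by rewrite -UE -PW mulmxA -perm_mxM mulVg perm_mx1 mul1mx.
have := scales_hausdorffM (scales_hausdorff_perm s^-1)
  (scales_hausdorffM Ls (scales_hausdorffM ds U1s)).
by rewrite !mul1r mulr1 -UE -PW mulmxA -perm_mxM mulVg perm_mx1 mul1mx.
Qed.

End determinant.

(** * Differentials and the local area formula *)

Section directional_derivatives.
Context (R : realType) (m : nat).
Implicit Types (u v w : 'rV[R]_m).

Lemma is_derive_line (V : normedModType R) (f : 'rV[R]_m -> V) w v (t : R) df :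
  is_derive (w + t *: v) v f df -> is_derive t 1 (fun s : R => f (w + s *: v)) df.
Proof.
have E : (fun h : R => h^-1 *: ((f \o shift (w + t *: v)) (h *: v) - f (w + t *: v)))
    = (fun h : R => h^-1 *: (((fun s : R => f (w + s *: v)) \o shift t) (h *: (1 : R)) -
        f (w + t *: v))).
  apply/funext => h /=; congr (_ *: (f _ - _)).
  by rewrite [h *: 1]mulr1 scalerDl addrCA.
move=> [fd fv]; apply: DeriveDef; first by rewrite /derivable -E.
by rewrite /derive -E.
Qed.

Lemma is_derive_from_line (V : normedModType R) (f : 'rV[R]_m -> V) w v df :
  is_derive (0 : R) 1 (fun s : R => f (w + s *: v)) df -> is_derive w v f df.
Proof.
have E : (fun h : R => h^-1 *: ((f \o shift w) (h *: v) - f w))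
    = (fun h : R => h^-1 *: (((fun s : R => f (w + s *: v)) \o shift 0) (h *: (1 : R)) -
        f (w + (0 : R) *: v))).
  apply/funext => h /=.
  by rewrite [h *: 1]mulr1 scale0r !addr0 [w + _]addrC.
move=> [fd fv]; apply: DeriveDef; first by rewrite /derivable E.
by rewrite /derive E.
Qed.

Lemma is_derive_comp1 (f : 'rV[R]_m -> R) (g : R -> R) w v df dg :
  is_derive w v f df -> is_derive (f w) 1 g dg ->
  is_derive w v (fun x => g (f x)) (dg * df).
Proof.
move=> fd gd; apply: is_derive_from_line.
have fd' : is_derive (0 : R) 1 (fun s : R => f (w + s *: v)) df.
  by apply: is_derive_line; rewrite scale0r addr0.
by apply: (@is_derive1_comp R g (fun s => f (w + s *: v))); rewrite /= scale0r addr0.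
Qed.

Lemma is_derive_rowP n (X : 'rV[R]_m -> 'rV[R]_n) u v dX :
  is_derive u v X dX <-> forall j, is_derive u v (fun w => X w 0 j) (dX 0 j).
Proof.
split=> [[Xd <-] j|Xd].
  apply: DeriveDef; first by move/derivable_mxP : Xd; exact.
  by rewrite derive_mx// mxE.
have Xdv : derivable X u v.
  by apply/derivable_mxP => i j; rewrite (ord1 i); case: (Xd j).
apply: DeriveDef => //; rewrite derive_mx//; apply/rowP => j; rewrite mxE.
by case: (Xd j).
Qed.

Lemma is_derive_dot n (X : 'rV[R]_m -> 'rV[R]_n) u v dX (w : 'rV[R]_n) :
  is_derive u v X dX -> is_derive u v (fun x => dot (X x) w) (dot dX w).
Proof.
move=> /is_derive_rowP Xd.
have := @is_derive_sum R _ R n (fun i x => X x 0 i * w 0 i) u v (fun i => dX 0 i * w 0 i).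
rewrite (_ : \sum_(i < n) _ = (fun x => dot (X x) w)); last first.
  by apply/funext => x; rewrite fct_sumE.
apply => i; rewrite (_ : (fun x => _) = w 0 i *: (fun x => X x 0 i)).
  by rewrite mulrC; exact: is_deriveZ.
by apply/funext => x; rewrite mulrC.
Qed.

Lemma MVT_abs (f df : R -> R) (tau c e : R) :
  (forall s : R, `|s| <= `|tau| -> is_derive s 1 f (df s)) ->
  (forall s, `|s| <= `|tau| -> `|df s - c| <= e) ->
  `|f tau - f 0 - c * tau| <= e * `|tau|.
Proof.
move=> fd dfc.
have key a b : a <= b -> (forall s, a <= s <= b -> `|s| <= `|tau|) ->
    `|f b - f a - c * (b - a)| <= e * (b - a).
  move=> ab abt.
  have fdr s : s \in `]a, b[%R -> is_derive s 1 f (df s).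
    by rewrite in_itv /= => /andP[/ltW as_ /ltW sb]; apply/fd/abt; rewrite as_.
  have fc : {within `[a, b], continuous f}.
    apply: continuous_in_subspaceT => s /set_mem; rewrite /= in_itv /= => sab.
    have [fds _] := fd s (abt s sab).
    by apply: differentiable_continuous; apply/derivable1_diffP.
  have [x] := MVT_segment ab fdr fc.
  rewrite in_itv /= => xab ->; rewrite -mulrBl normrM.
  by rewrite [`|b - a|]ger0_norm ?subr_ge0// ler_wpM2r ?subr_ge0// dfc// abt.
have [t0|t0] := leP 0 tau.
  have := key 0 tau t0; rewrite subr0 ger0_norm// => -> // s /andP[s0 st].
  by rewrite !ger0_norm.
have := key tau 0 (ltW t0); rewrite sub0r ltr0_norm// mulrN opprK => H.
rewrite (_ : f tau - f 0 - c * tau = - (f 0 - f tau + c * tau)); last by ring.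
rewrite normrN; apply: H => s /andP[st s0].
by rewrite ler0_norm// lerN2.
Qed.

End directional_derivatives.

Section strict_differentiability.
Context (R : realType) (m n : nat).
Implicit Types (F X : 'rV[R]_m -> 'rV[R]_n) (A : 'M[R]_(m, n)).

(** Both points vary. This makes F nearly proportional in distances to its linear part around u,
    which differentiability at u alone does not give. *)
Definition strict_diff F u A := forall e, 0 < e -> exists2 d, 0 < d &
  forall a b, enorm (a - u) < d -> enorm (b - u) < d ->
    enorm (F a - F b - (a - b) *m A) <= e * enorm (a - b).

(** Frechet differentiability with an explicit differential, acting on row vectors from the
    right. *)
Definition fdiff F u A := forall e, 0 < e -> exists2 d, 0 < d &
  forall a, enorm (a - u) < d ->
    enorm (F a - F u - (a - u) *m A) <= e * enorm (a - u).

Lemma strict_diff_fdiff F u A : strict_diff F u A -> fdiff F u A.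
Proof.
move=> Fu e e0; have [d d0 dP] := Fu e e0; exists d => // a au.
by apply: dP => //; rewrite subrr enorm0.
Qed.

Lemma fdiff_continuous F u A : fdiff F u A -> {for u, continuous F}.
Proof.
move=> Fu; apply/continuous_enormP => e e0.
have [d d0 dP] := Fu 1 ltr01; have [c c0 cA] := enorm_mulmx_le A.
exists (Num.min d (e / (1 + c))); first by rewrite lt_min d0 divr_gt0// addr_gt0.
move=> a; rewrite lt_min => /andP[ad ae].
rewrite -[F a - F u](subrK ((a - u) *m A)).
apply: le_lt_trans (enormD _ _) _; apply: le_lt_trans (lerD (dP _ ad) (cA _)) _.
by rewrite -mulrDl mulrC -ltr_pdivlMr// addr_gt0.
Qed.

Lemma fdiff_is_derive F u A v : fdiff F u A -> is_derive u v F (v *m A).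
Proof.
move=> Fu.
have lim : h^-1 *: ((F \o shift u) (h *: v) - F u) @[h --> 0^'] --> v *m A.
  apply/cvgrPdist_le => e e0.
  have v1 : 0 < enorm v + 1 by rewrite ltr_wpDl// enorm_ge0.
  have [d d0 dP] := Fu (e / (enorm v + 1)) (divr_gt0 e0 v1).
  near=> h.
  have h0 : h != 0 by near: h; exact: nbhs_dnbhs_neq.
  have hd : enorm (h *: v) < d.
    rewrite enormZ; apply: (@le_lt_trans _ _ (`|h| * (enorm v + 1))).
      by rewrite ler_wpM2l// lerDl.
    rewrite -ltr_pdivlMr//; near: h; apply: dnbhs0_lt; exact: divr_gt0.
  have := dP (h *: v + u); rewrite addrK => /(_ hd); rewrite enormZ => hP.
  rewrite distrC; apply: le_trans (norm_le_enorm _) _.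
  rewrite (_ : _ - _ = h^-1 *: (F (h *: v + u) - F u - (h *: v) *m A)); last first.
    by rewrite [RHS]scalerBr -scalemxAl scalerA mulVf// scale1r.
  rewrite enormZ normfV mulrC ler_pdivrMr ?normr_gt0//.
  apply: le_trans hP _; rewrite mulrCA mulrC ler_wpM2r//.
  by rewrite mulrAC ler_pdivrMr// ler_wpM2l ?(ltW e0)// lerDl.
apply: DeriveDef; first by apply/cvg_ex; exists (v *m A).
by apply/cvg_lim.
Unshelve. all: by end_near. Qed.

(** The points b and a are joined by changing one coordinate at a time. On each segment the mean
    value theorem applies, with a partial derivative close to its value at u. *)
Lemma C1_strict_diff (V : set 'rV[R]_m) X (u : 'rV[R]_m) : open V -> C1_on V X -> V u ->
  strict_diff X u (tangent_frame X u).
Proof.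
move=> oV XC Vu e e0.
set A := tangent_frame X u.
(* There are m segments, each contributing to the n coordinates that enter the Euclidean norm. *)
pose N : R := m%:R * n%:R + 1.
have N0 : 0 < N by rewrite ltr_wpDl// mulr_ge0.
pose e' := e / N.
have e'0 : 0 < e' by exact: divr_gt0.
have [d1 d10 d1V] : exists2 d, 0 < d & forall w, enorm (w - u) < d -> V w.
  by apply/nbhs_enormP; exact: open_nbhs_nbhs.
have [d2 d20 d2P] : exists2 d, 0 < d & forall w i, enorm (w - u) < d ->
    enorm (partial i X w - partial i X u) < e'.
  have near_i : nbhs u (fun w => forall i, enorm (partial i X w - partial i X u) < e').
    apply: (@filter_forall _ _ _ (nbhs u)) => i.
    have [_ /continuous_enormP/(_ _ e'0) near_i] := XC i u Vu.
    exact/nbhs_enormP.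
  have /nbhs_enormP[d dp dP] := near_i.
  by exists d => // w i /dP.
pose d := Num.min d1 d2.
have d0 : 0 < d by rewrite lt_min d10.
have m1 : 0 < m.+1%:R :> R by rewrite ltr0n.
(* On the path a coordinate is within c of that of u before the move and moves by at most 2c; the
   factor [m.+1] turns the resulting sup norm bound 3c into a Euclidean one. *)
have [c c0 c3] : exists2 c, 0 < c & 3 * c = d / m.+1%:R.
  exists (d / (3 * m.+1%:R)); first by rewrite divr_gt0// mulr_gt0.
  by rewrite invfM mulrCA mulVKf.
exists c => //.
move=> a b au bu.
have box (w : 'rV[R]_m) : (forall i, `|w 0 i - u 0 i| <= 3 * c) ->
    enorm (w - u) < d.
  move=> wu; apply: le_lt_trans (enorm_le_norm _) _.
  have : `|w - u| <= d / m.+1%:R.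
    apply/norm_leP => [|i]; first by rewrite divr_ge0// ltW.
    by rewrite !mxE -c3; exact: wu.
  move=> /(ler_wpM2l (ler0n R m))/le_lt_trans; apply.
  by rewrite mulrCA gtr_pMr// ltr_pdivrMr// mul1r ltr_nat.
pose b_ k : 'rV[R]_m := \row_i (if (i < k)%N then a 0 i else b 0 i).
have coord j : `|(X a - X b - (a - b) *m A) 0 j| <= m%:R * (e' * enorm (a - b)).
  have -> : (X a - X b - (a - b) *m A) 0 j =
      \sum_(k < m) (X (b_ k.+1) 0 j - X (b_ k) 0 j - A k j * (a 0 k - b 0 k)).
    rewrite sumrB -(big_mkord xpredT (fun k => X (b_ k.+1) 0 j - X (b_ k) 0 j)).
    rewrite telescope_sumr// !mxE; congr (X _ 0 j - X _ 0 j - _).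
    - by apply/rowP => i; rewrite mxE ltn_ord.
    - by apply/rowP => i; rewrite mxE ltn0.
    - by apply: eq_bigr => i _; rewrite !mxE mulrC.
  apply: le_trans (ler_norm_sum _ _ _) _.
  apply: (@le_trans _ _ (\sum_(k < m) (e' * enorm (a - b)))); last first.
    by rewrite sumr_const card_ord mulr_natl.
  apply: ler_sum => k _.
  pose tau := a 0 k - b 0 k; pose ek : 'rV[R]_m := delta_mx 0 k.
  have taule : `|tau| <= enorm (a - b).
    by have := coord_le_enorm (a - b) k; rewrite !mxE.
  have bk1 : b_ k.+1 = b_ k + tau *: ek.
    apply/rowP => i; rewrite !mxE eqxx /= ltnS leq_eqVlt.
    have [->|ik] := eqVneq i k; first by rewrite eqxx ltnn mulr1 addrC subrK.
    by rewrite (negbTE (ik : i != k :> nat)) mulr0 addr0.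
  have inball s : `|s| <= `|tau| -> enorm (b_ k + s *: ek - u) < d.
    move=> st; apply: box => i.
    have ai := le_lt_trans (coord_le_enorm (a - u) i) au.
    have bi := le_lt_trans (coord_le_enorm (b - u) i) bu.
    have ak := le_lt_trans (coord_le_enorm (a - u) k) au.
    have bk := le_lt_trans (coord_le_enorm (b - u) k) bu.
    rewrite !mxE in ai bi ak bk *.
    have tle : `|tau| <= 2 * c.
      rewrite /tau (_ : _ - _ = (a 0 k - u 0 k) - (b 0 k - u 0 k)); last by ring.
      by apply: le_trans (ler_normB _ _) _; lra.
    rewrite addrAC; apply: le_trans (ler_normD _ _) _.
    have h1 : `|(if (i < k)%N then a 0 i else b 0 i) - u 0 i| <= c.
      by case: ifP => _; apply/ltW.
    have h2 : `|s * ((0 == 0 :> 'I_1) && (i == k))%:R| <= `|s|.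
      by case: (_ && _); rewrite ?mulr1// mulr0 normr0.
    by lra.
  have := @MVT_abs R (fun s => X (b_ k + s *: ek) 0 j)
    (fun s => partial k X (b_ k + s *: ek) 0 j) tau (A k j) e'.
  rewrite bk1 scale0r addr0 => H; apply: le_trans (H _ _) _.
  - move=> s st; have := inball s st; rewrite lt_min => /andP[/d1V Vs _].
    have [/derivableP Xd _] := XC k _ Vs.
    by have := @is_derive_line R m R (fun w => X w 0 j) (b_ k) ek s
         (partial k X (b_ k + s *: ek) 0 j); apply; move/is_derive_rowP : Xd; exact.
  - move=> s st; have := inball s st; rewrite lt_min => /andP[_ sd2].
    have := d2P _ k sd2; move/ltW; apply: le_trans.
    by have := coord_le_enorm (partial k X (b_ k + s *: ek) - partial k X u) j; rewrite !mxE.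
  by rewrite ler_wpM2l ?(ltW e'0).
apply: le_trans (enorm_le_norm _) _.
have : `|X a - X b - (a - b) *m A| <= m%:R * (e' * enorm (a - b)).
  by apply/norm_leP => //; rewrite mulr_ge0// mulr_ge0 ?enorm_ge0// ltW.
move=> /(ler_wpM2l (ler0n R n))/le_trans; apply.
have mnN : m%:R * n%:R / N <= 1 by rewrite ler_pdivrMr// mul1r lerDl.
rewrite (_ : _ * _ = m%:R * n%:R / N * (e * enorm (a - b))); last first.
  by rewrite /e'; move: (N^-1) => Ni; ring.
by rewrite -[leRHS]mul1r ler_wpM2r// mulr_ge0 ?enorm_ge0// ltW.
Qed.

End strict_differentiability.

Section area_comparison.
Context (R : realType) (m : nat).

Lemma strict_diff_ratio n (F : 'rV[R]_m -> 'rV[R]_n) u A (e : R) :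
  0 < e -> row_free A -> strict_diff F u A ->
  exists2 d, 0 < d & forall a b, enorm (a - u) < d -> enorm (b - u) < d ->
    enorm (F a - F b) <= (1 + e) * enorm (a *m A - b *m A) /\
    enorm (a *m A - b *m A) <= (1 + e) * enorm (F a - F b).
Proof.
move=> e0 /enorm_row_free_le[c c0 cA] Fu.
(* The choice gives 1 / (1 - x) at most 1 + 2x, hence at most 1 + e. *)
pose x := Num.min (e / 2) (1 / 2).
have x0 : 0 < x by rewrite lt_min !divr_gt0.
have [xe x1] : x <= e / 2 /\ x <= 1 / 2 by rewrite !ge_min !lexx orbT.
have [d d0 dP] := Fu (x / c) (divr_gt0 x0 c0).
exists d => // a b au bu; rewrite -mulmxBl.
have H := dP a b au bu.
have {}H : enorm (F a - F b - (a - b) *m A) <= x * enorm ((a - b) *m A).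
  apply: le_trans H _; rewrite -mulrA ler_wpM2l ?(ltW x0)//.
  by rewrite ler_pdivrMl.
have h1 := enorm_subl (F a - F b) ((a - b) *m A).
have h2 := enorm_subl ((a - b) *m A) (F a - F b).
rewrite (enormBC ((a - b) *m A)) in h2.
move: H h1 h2 (enorm_ge0 (F a - F b)) (enorm_ge0 ((a - b) *m A)).
move: (enorm (F a - F b - _)) (enorm (F a - F b)) (enorm ((a - b) *m A)) => z f g H h1 h2 f0 g0.
split; first by nra.
have : g * (1 - x) <= f by lra.
by nra.
Qed.

End area_comparison.

Section area_formula.
Context (R : realType) (m : nat).
Local Open Scope ereal_scope.

(** Near u the images under F and G are compared with the linear images under A and B, which scale
    the measure of the parameter set by a and b. Each comparison costs a factor (1 + x)^(m+1), and x
    is chosen so that two of them stay below 1 + e. *)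
Lemma area_comparison n1 n2 (F : 'rV[R]_m.+1 -> 'rV[R]_n1)
    (G : 'rV[R]_m.+1 -> 'rV[R]_n2) u A B a b (e : R) : (0 < e)%R ->
  row_free A -> row_free B -> strict_diff F u A -> strict_diff G u B ->
  (0 < a)%R -> (0 < b)%R ->
  scales_hausdorff A a -> scales_hausdorff B b ->
  exists2 d, (0 < d)%R & forall S, (forall s, S s -> enorm (s - u) < d)%R ->
    a%:E * hausdorff m.+1 (G @` S) <=
    ((1 + e) * b)%:E * hausdorff m.+1 (F @` S).
Proof.
move=> e0 Afree Bfree Fu Gu a0 b0 Aa Bb.
have [x x0 xP] := expr_near1 (m.+1 + m.+1) e0.
have {}xP : ((1 + x) ^+ m.+1 * (1 + x) ^+ m.+1 <= 1 + e)%R.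
  by rewrite -exprD ltW// xP// lexx (ltW x0).
have x1 : (0 < 1 + x)%R by rewrite addr_gt0.
have [d1 d10 d1P] := strict_diff_ratio x0 Afree Fu.
have [d2 d20 d2P] := strict_diff_ratio x0 Bfree Gu.
exists (Num.min d1 d2); first by rewrite lt_min d10.
move=> S Sd.
have Sd1 s : S s -> (enorm (s - u) < d1)%R by move/Sd; rewrite lt_min => /andP[].
have Sd2 s : S s -> (enorm (s - u) < d2)%R by move/Sd; rewrite lt_min => /andP[].
pose k := ((1 + x) ^+ m.+1)%R.
have k0 : (0 < k)%R by rewrite exprn_gt0.
have GB : hausdorff m.+1 (G @` S) <= k%:E * (b%:E * hausdorff m.+1 S).
  rewrite -Bb; apply: hausdorff_lip => // s t /Sd2 sd /Sd2 td.
  by have [] := d2P s t sd td.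
have FA : a%:E * hausdorff m.+1 S <= k%:E * hausdorff m.+1 (F @` S).
  rewrite -Aa; apply: hausdorff_lip => // s t /Sd1 sd /Sd1 td.
  by have [] := d1P s t sd td.
apply: (@le_trans _ _ (a%:E * (k%:E * (b%:E * hausdorff m.+1 S)))).
  by rewrite lee_wpmul2l// lee_fin ltW.
have -> : a%:E * (k%:E * (b%:E * hausdorff m.+1 S)) =
    (k * b)%:E * (a%:E * hausdorff m.+1 S).
  by rewrite muleCA (muleCA a%:E) muleA -EFinM.
apply: (@le_trans _ _ ((k * b)%:E * (k%:E * hausdorff m.+1 (F @` S)))).
  by rewrite lee_wpmul2l// lee_fin mulr_ge0 ?(ltW k0) ?(ltW b0).
rewrite muleA -EFinM lee_wpmul2r ?hausdorff_ge0// lee_fin.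
by rewrite mulrAC ler_wpM2r ?(ltW b0).
Qed.

End area_formula.

(** * Measurability and integration for Hausdorff measures *)

Section hausdorff_measurability.
Context (R : realType) (n m : nat).
Local Notation T := 'rV[R]_n.
Local Notation mu := (@hausdorff_outer R n m).
Local Notation cT := (caratheodory_type mu).

Lemma hausdorff_closed_measurable (A : set T) : closed A ->
  measurable (A : set cT).
Proof.
move=> /dyadic_generated_closed mA.
by apply: borel_caratheodory; [exact: hausdorff_separated|exact: mA].
Qed.

Lemma closed_level (S : set T) (f : T -> R) (D : set R) : closed S ->
  {within S, continuous f} -> closed D -> closed (S `&` f @^-1` D).
Proof.
move=> cS cf cD.
have /closed_subspaceP[V cV VE] : closed (f @^-1` D : set (subspace S)).
  by move/continuous_closedP : cf; exact.
by rewrite setIC -VE; exact: closedI.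
Qed.

Lemma hausdorff_continuous_measurable (S : set T) (f : T -> R) : closed S ->
  {within S, continuous f} -> measurable_fun (S : set cT) (f : cT -> R).
Proof.
move=> cS cf; apply: (measurability _ (RGenOpens.measurableE R)).
move=> _ [_ [a [b ->] <-]].
rewrite (_ : S `&` _ = S `\` (S `&` f @^-1` (~` `]a, b[%classic))); last first.
  by rewrite setDE setCI preimage_setC setCK setIUr setICr set0U.
apply: (@measurableD _ cT); apply: hausdorff_closed_measurable => //.
by apply: closed_level => //; apply: open_closedC; exact: interval_open.
Qed.

Lemma hausdorff_bounded_integrable (B : set T) (f : T -> R) (M : R) :
  measurable (B : set cT) -> (mu B < +oo)%E ->
  measurable_fun (B : set cT) (f : cT -> R) ->
  (forall x, B x -> `|f x| <= M) ->
  (@hausdorff_measure R n m).-integrable (B : set cT) (EFin \o f).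
Proof.
move=> mB Bfin mf fM; apply: measurable_bounded_integrable => //.
exists M; split; first exact: num_real.
by move=> N MN x Bx /=; rewrite (le_trans (fM _ Bx))// ltW.
Qed.

Lemma Rintegral_near_const (B : set T) (f : T -> R) (t e : R) :
  measurable (B : set cT) -> (mu B < +oo)%E ->
  measurable_fun (B : set cT) (f : cT -> R) ->
  (forall x, B x -> `|f x - t| <= e) ->
  `|hausdorff_integral m B f - t * fine (mu B)| <= e * fine (mu B).
Proof.
move=> mB Bfin mf fte.
have intf : (@hausdorff_measure R n m).-integrable (B : set cT) (EFin \o f).
  apply: (hausdorff_bounded_integrable (M := e + `|t|)) => // x /fte.
  by have := ler_normD (f x - t) t; rewrite subrK; lra.
have intc c : (@hausdorff_measure R n m).-integrable (B : set cT) (EFin \o cst c).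
  apply: (hausdorff_bounded_integrable (M := `|c|)) => //.
have icst c : Rintegral (@hausdorff_measure R n m) (B : set cT) (cst c) = c * fine (mu B).
  exact: Rintegral_cst.
rewrite ler_norml; apply/andP; split.
  rewrite lerBrDl -mulrN1 mulrAC -mulrDl -icst.
  apply: le_Rintegral => //; first exact: intc.
  by move=> x /fte; rewrite ler_norml /=; lra.
rewrite lerBlDl -mulrDl -icst.
apply: le_Rintegral => //; first exact: intc.
by move=> x /fte; rewrite ler_norml /=; lra.
Qed.

End hausdorff_measurability.

(** * Change of variables on compact sets *)

Lemma compact_rV_closed (R : realType) n (A : set 'rV[R]_n) : compact A -> closed A.
Proof. by apply: compact_closed; exact: norm_hausdorff. Qed.

Section transfer.
Context (R : realType) (m p q : nat).
Variables (S : set 'rV[R]_p) (Phi : 'rV[R]_p -> 'rV[R]_q).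
Hypotheses (Scompact : compact S) (Phi_cont : {within S, continuous Phi})
  (Phi_inj : set_inj S Phi).
Local Notation mu n := (@hausdorff_outer R n m).
Local Notation meas n B := (measurable (B : set (caratheodory_type (mu n)))).
Local Notation N := (Phi @` S).

(** Measurability of the image is carried along with that of B: for S it comes from compactness, and
    injectivity of [Phi] preserves it when an open set is cut off. *)
Definition measurable_piece (B : set 'rV[R]_p) :=
  [/\ B `<=` S, meas p B & meas q (Phi @` B)].

Let Sclosed : closed S. Proof. exact: compact_rV_closed. Qed.

Lemma compact_image_measurable F : compact F -> F `<=` S -> meas q (Phi @` F).
Proof.
move=> cF FS; apply: hausdorff_closed_measurable; apply: compact_rV_closed.
have PhiF : {within F, continuous Phi} by apply: continuous_subspaceW Phi_cont.
exact: (continuous_compact PhiF cF).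
Qed.

Lemma measurable_piece_full : measurable_piece S.
Proof.
by split => //; [exact: hausdorff_closed_measurable|exact: compact_image_measurable].
Qed.

Lemma piece_image_setD (B C : set 'rV[R]_p) : B `<=` S -> C `<=` S ->
  Phi @` (B `\` C) = Phi @` B `\` Phi @` C.
Proof.
move=> BS CS; apply/seteqP; split => y.
  move=> [x [Bx Cx] <-]; split; first by exists x.
  by move=> [z Cz] /(Phi_inj (mem_set (CS _ Cz)) (mem_set (BS _ Bx))) zx; apply: Cx; rewrite -zx.
by move=> [[x Bx <-] nC]; exists x => //; split => // Cx; apply: nC; exists x.
Qed.

Lemma measurable_piece_setD_open O B : open O -> measurable_piece B ->
  measurable_piece (B `\` O).
Proof.
move=> oO [BS mB mPB].
have cSO : compact (S `\` O).
  apply: (subclosed_compact _ Scompact); last by move=> x [].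
  by rewrite setDE; apply: closedI => //; exact: open_closedC.
split.
- by move=> x [/BS].
- apply: (@measurableD _ (caratheodory_type (mu p))) => //.
  by rewrite -(setCK O); apply: measurableC; apply: hausdorff_closed_measurable; exact: open_closedC.
(* Only subsets of S occur on the right, so injectivity carries the differences over to images, and
   both S and its part outside O have compact images. *)
have -> : B `\` O = B `\` (S `\` (S `\` O)).
  apply/seteqP; split => x [Bx Ox]; split => //; first by move=> [_]; apply; split => //; exact: BS.
  by move=> Ox'; apply: Ox; split; [exact: BS|move=> []].
have subS C : S `\` C `<=` S by move=> x [].
rewrite piece_image_setD// [X in _ `\` X]piece_image_setD//.
apply: (@measurableD _ (caratheodory_type (mu q))) => //.
apply: (@measurableD _ (caratheodory_type (mu q))); first by have [] := measurable_piece_full.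
by apply: compact_image_measurable => // x [].
Qed.

Lemma measurable_piece_setI_open O B : open O -> measurable_piece B ->
  measurable_piece (B `&` O).
Proof.
move=> oO pB; have [BS mB mPB] := pB; have [DS mD mPD] := measurable_piece_setD_open oO pB.
have E : B `&` O = B `\` (B `\` O) by rewrite setDD.
rewrite E; split; first by move=> x [/BS].
  exact: measurableD.
rewrite piece_image_setD//; exact: measurableD.
Qed.

(** Compactness gives finitely many good open sets covering S. Cutting them off one after the other
    splits S into disjoint measurable pieces, each inside a good open set. *)
Lemma piece_induction (P : set 'rV[R]_p -> Prop) : P set0 ->
  (forall a, S a -> exists O, [/\ open O, O a &
     forall B, measurable_piece B -> B `<=` O -> P B]) ->
  (forall B C, measurable_piece B -> measurable_piece C -> B `&` C = set0 ->
     P B -> P C -> P (B `|` C)) ->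
  P S.
Proof.
move=> P0 Ploc PU.
have /choice[U UP] : forall a, exists O, S a -> [/\ open O, O a &
     forall B, measurable_piece B -> B `<=` O -> P B].
  move=> a; have [/Ploc[W WP]|nSa] := pselect (S a); first by exists W.
  by exists setT.
have := Scompact; rewrite compact_cover => /(_ _ S U) [i Si|x Sx|].
- by have [] := UP i Si.
- by exists x => //; have [] := UP x Sx.
move=> D DS SD.
suff ind (s : seq 'rV[R]_p) B : {in s, forall a, S a} -> measurable_piece B ->
    (forall x, B x -> exists2 a, a \in s & U a x) -> P B.
  apply: (ind (finmap.enum_fset D)).
  - by move=> a /DS/set_mem.
  - exact: measurable_piece_full.
  - by move=> x /SD[a aD Oax]; exists a.
elim: s B => [|a s ih] B sS pB Bs.
  by rewrite (_ : B = set0)// -subset0 => x /Bs[].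
have [oO _ PO] := UP a (sS a (mem_head _ _)).
rewrite -(setUIDK B (U a)); apply: PU.
- exact: measurable_piece_setI_open.
- exact: measurable_piece_setD_open.
- by rewrite setDE setIACA setICr setI0.
- by apply: PO => [|x []//]; exact: measurable_piece_setI_open.
- apply: ih.
  + by move=> b bs; apply: sS; rewrite inE bs orbT.
  + exact: measurable_piece_setD_open.
  + move=> x [/Bs[b]]; rewrite inE => /predU1P[->|bs] Obx nO; first by [].
    by exists b.
Qed.

End transfer.

Section transfer_integrals.
Context (R : realType) (m p q : nat).
Variables (S : set 'rV[R]_p) (Phi : 'rV[R]_p -> 'rV[R]_q).
Hypotheses (Scompact : compact S) (Phi_cont : {within S, continuous Phi})
  (Phi_inj : set_inj S Phi).
Local Notation N := (Phi @` S).

Lemma image_compact : compact N.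
Proof. exact: (continuous_compact Phi_cont Scompact). Qed.

Lemma finite_measure_image : (hausdorff m S < +oo)%E ->
  (forall a, S a -> exists W k, [/\ open W, W a, 0 <= k & forall B : set 'rV[R]_p,
     B `<=` S `&` W -> (hausdorff m (Phi @` B) <= k%:E * hausdorff m B)%E]) ->
  (hausdorff m N < +oo)%E.
Proof.
move=> Sfin loc.
apply: (piece_induction (m := m) Scompact Phi_cont Phi_inj
  (P := fun B => (hausdorff m (Phi @` B) < +oo)%E)).
- by rewrite image_set0 hausdorff0.
- move=> a /loc[W [k [oW Wa k0 Wk]]]; exists W; split => // B [BS _ _] BW.
  apply: (@le_lt_trans _ _ (k%:E * hausdorff m B)%E).
    by apply: Wk => x Bx; split; [exact: BS|exact: BW].
  by rewrite lte_mul_pinfty// ?lee_fin// (le_lt_trans _ Sfin)// le_hausdorff.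
- move=> B C _ _ _ Bfin Cfin; rewrite image_setU.
  apply: le_lt_trans (outer_measureU2 (@hausdorff_outer R q m) _ _) _.
  exact: lte_add_pinfty.
Qed.

(* Phi distorts measures near a by a factor close to j / c, and f is close to
   (g o Phi) j. *)
Lemma transfer_estimate (f : 'rV[R]_p -> R) (g : 'rV[R]_q -> R) (c e K : R) :
  0 < c -> 0 < e <= 1 ->
  (hausdorff m S < +oo)%E -> (hausdorff m N < +oo)%E ->
  {within S, continuous f} -> {within N, continuous g} ->
  (forall a, S a -> exists W j t, [/\ open W, W a, 0 <= j <= K, `|t| <= K &
     (forall B : set 'rV[R]_p, B `<=` S `&` W ->
       (c%:E * hausdorff m (Phi @` B) <= ((1 + e) * j)%:E * hausdorff m B)%E /\
       (j%:E * hausdorff m B <= ((1 + e) * c)%:E * hausdorff m (Phi @` B))%E) /\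
     (forall b, S b -> W b -> `|f b - t * j| <= e /\ `|g (Phi b) - t| <= e)]) ->
  `|hausdorff_integral m S f - c * hausdorff_integral m N g| <=
    e * (1 + 2 * K + 2 * K ^+ 2) * fine (hausdorff m S).
Proof.
move=> c0 /andP[e0 e1] Sfin Nfin cf cg loc.
have Sclosed := compact_rV_closed Scompact.
have Nclosed := compact_rV_closed image_compact.
have mf := hausdorff_continuous_measurable (m := m) Sclosed cf.
have mg := hausdorff_continuous_measurable (m := m) Nclosed cg.
have mS : measurable (S : set (caratheodory_type (@hausdorff_outer R p m))).
  exact: hausdorff_closed_measurable.
have mN : measurable (N : set (caratheodory_type (@hausdorff_outer R q m))).
  exact: hausdorff_closed_measurable.
have bounded n (A : set 'rV[R]_n) (h : 'rV[R]_n -> R) : compact A ->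
    {within A, continuous h} -> exists M, forall x, A x -> `|h x| <= M.
  move=> cA ch; have [M [_ hM]] := compact_bounded (continuous_compact ch cA).
  exists (M + 1) => x Ax; apply: (hM (M + 1)); first by rewrite ltrDl.
  by exists x.
have [Mf fM] := bounded _ _ _ Scompact cf.
have [Mg gM] := bounded _ _ _ image_compact cg.
have intf : (@hausdorff_measure R p m).-integrable S (EFin \o f).
  exact: hausdorff_bounded_integrable mS Sfin mf fM.
have intg : (@hausdorff_measure R q m).-integrable N (EFin \o g).
  exact: hausdorff_bounded_integrable mN Nfin mg gM.
(* The terms account for the variation of f, for that of g on the image, and for the distortion of
   measure multiplied by the value t. The factors 2 come from 1 + e being at most 2. *)
set C := 1 + 2 * K + 2 * K ^+ 2.
apply: (piece_induction (m := m) Scompact Phi_cont Phi_inj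
  (P := fun B => `|hausdorff_integral m B f - c * hausdorff_integral m (Phi @` B) g| <=
    e * C * fine (hausdorff m B))).
- rewrite image_set0 /hausdorff_integral !Rintegral_set0 mulr0 subrr normr0.
  by rewrite hausdorff0 mulr0.
- move=> a Sa; have [W [j [t [oW Wa /andP[j0 jK] tK [comp near_t]]]]] := loc a Sa.
  exists W; split => // B [BS mB mPB] BW.
  have Bfin : (hausdorff m B < +oo)%E by rewrite (le_lt_trans _ Sfin)// le_hausdorff.
  have PBfin : (hausdorff m (Phi @` B) < +oo)%E.
    by rewrite (le_lt_trans _ Nfin)// le_hausdorff//; exact: image_subset.
  have Bf : `|hausdorff_integral m B f - (t * j) * fine (hausdorff m B)| <=
      e * fine (hausdorff m B).
    apply: Rintegral_near_const => //; first exact: measurable_funS mf.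
    by move=> x Bx; have [] := near_t x (BS _ Bx) (BW _ Bx).
  have PBg : `|hausdorff_integral m (Phi @` B) g - t * fine (hausdorff m (Phi @` B))| <=
      e * fine (hausdorff m (Phi @` B)).
    apply: Rintegral_near_const => //.
      by apply: measurable_funS mg => //; exact: image_subset.
    by move=> _ [x Bx <-]; have [] := near_t x (BS _ Bx) (BW _ Bx).
  have [] := comp B (fun x Bx => conj (BS x Bx) (BW x Bx)).
  have Bfn : hausdorff m B \is a fin_num by rewrite ge0_fin_numE ?hausdorff_ge0.
  have PBfn : hausdorff m (Phi @` B) \is a fin_num by rewrite ge0_fin_numE ?hausdorff_ge0.
  rewrite -(fineK Bfn) -(fineK PBfn) -!EFinM !lee_fin !fineK//.
  have : 0 <= fine (hausdorff m B) by rewrite fine_ge0 ?hausdorff_ge0.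
  have : 0 <= fine (hausdorff m (Phi @` B)) by rewrite fine_ge0 ?hausdorff_ge0.
  move: Bf PBg; move: (fine (hausdorff m B)) (fine (hausdorff m (Phi @` B)))
    (hausdorff_integral m B f) (hausdorff_integral m (Phi @` B) g) => x y I J.
  move=> If Jg y0 x0 h1 h2.
  have K0 : 0 <= K by exact: le_trans jK.
  have cy : c * y <= 2 * K * x.
    apply: le_trans h1 _; rewrite ler_wpM2r//; apply: ler_pM => //; lra.
  have d1 : `|j * x - c * y| <= e * (2 * K * x).
    have ejx : e * (j * x) <= e * (K * x) by rewrite ler_wpM2l ?(ltW e0)// ler_wpM2r.
    have ecy : e * (c * y) <= e * (2 * K * x) by rewrite ler_wpM2l ?(ltW e0).
    have ex0 : 0 <= e * (K * x) by rewrite !mulr_ge0// ltW.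
    by rewrite ler_norml; apply/andP; split; lra.
  have d2 : `|t * (j * x - c * y)| <= K * (e * (2 * K * x)).
    by rewrite normrM ler_pM.
  have d3 : `|c * (t * y - J)| <= e * (2 * K * x).
    rewrite normrM (gtr0_norm c0) distrC.
    apply: le_trans (ler_wpM2l (ltW c0) Jg) _.
    by rewrite mulrCA ler_wpM2l ?(ltW e0).
  rewrite (_ : I - c * J = (I - t * j * x) + (t * (j * x - c * y) + c * (t * y - J)));
    last by ring.
  apply: le_trans (ler_normD _ _) _; apply: le_trans (lerD If (ler_normD _ _)) _.
  by rewrite /C; lra.
- move=> B D [BS mB mPB] [DS mD mPD] BD hB hD.
  have Bfin : hausdorff m B \is a fin_num.
    by rewrite ge0_fin_numE ?hausdorff_ge0// (le_lt_trans _ Sfin)// le_hausdorff.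
  have Dfin : hausdorff m D \is a fin_num.
    by rewrite ge0_fin_numE ?hausdorff_ge0// (le_lt_trans _ Sfin)// le_hausdorff.
  have BDm : hausdorff m (B `|` D) = (hausdorff m B + hausdorff m D)%E.
    exact: (measureU (@hausdorff_measure R p m)).
  have PBD : Phi @` B `&` Phi @` D = set0.
    rewrite -subset0 => _ [[x Bx <-] [y Dy]].
    move=> /(Phi_inj (mem_set (DS _ Dy)) (mem_set (BS _ Bx))) yx.
    by have : (B `&` D) x by [split => //; rewrite -yx]; rewrite BD.
  have -> : hausdorff_integral m (B `|` D) f =
      hausdorff_integral m B f + hausdorff_integral m D f.
    apply: Rintegral_setU => //; last by apply/disj_setPS; rewrite BD.
    by apply: integrableS intf => //; [exact: measurableU|move=> x [/BS|/DS]].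
  have -> : hausdorff_integral m (Phi @` (B `|` D)) g =
      hausdorff_integral m (Phi @` B) g + hausdorff_integral m (Phi @` D) g.
    rewrite image_setU; apply: Rintegral_setU => //; last by apply/disj_setPS; rewrite PBD.
    apply: integrableS intg => //; first exact: measurableU.
    by move=> _ [[x Bx <-]|[x Dx <-]]; exists x => //; [exact: BS|exact: DS].
  rewrite BDm fineD// mulrDr.
  rewrite mulrDr opprD addrACA; apply: le_trans (ler_normD _ _) _.
  exact: lerD.
Qed.

End transfer_integrals.

(** * Charts of hypersurfaces *)

Section entrywise_continuity.
Context (R : realType) (T : topologicalType) (x : T).

(** Continuity entry by entry, so that products, determinants and adjugates of matrix functions
    reduce to sums and products of real functions. *)
Definition mcont m n (F : T -> 'M[R]_(m, n)) :=
  forall i j, {for x, continuous (fun y => F y i j)}.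

Lemma continuous_big_sum (I : Type) (r : seq I) (F : I -> T -> R) :
  (forall i, {for x, continuous (F i)}) ->
  {for x, continuous (fun y => \sum_(i <- r) F i y)}.
Proof.
move=> Fc; elim: r => [|i r ih].
  have -> : (fun y => \sum_(i <- [::]) F i y) = (fun=> 0).
    by apply/funext => y; rewrite big_nil.
  exact: cvg_cst.
have -> : (fun y => \sum_(i <- i :: r) F i y) =
    (fun y => F i y + \sum_(i <- r) F i y).
  by apply/funext => y; rewrite big_cons.
by apply: cvgD => //; exact: Fc.
Qed.

Lemma continuous_big_prod (I : Type) (r : seq I) (F : I -> T -> R) :
  (forall i, {for x, continuous (F i)}) ->
  {for x, continuous (fun y => \prod_(i <- r) F i y)}.
Proof.
move=> Fc; elim: r => [|i r ih].
  have -> : (fun y => \prod_(i <- [::]) F i y) = (fun=> 1).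
    by apply/funext => y; rewrite big_nil.
  exact: cvg_cst.
have -> : (fun y => \prod_(i <- i :: r) F i y) =
    (fun y => F i y * \prod_(i <- r) F i y).
  by apply/funext => y; rewrite big_cons.
by apply: cvgM => //; exact: Fc.
Qed.

Lemma mcont_cst m n (A : 'M[R]_(m, n)) : mcont (fun=> A).
Proof. by move=> i j; exact: cvg_cst. Qed.

Lemma mcont_mul m n p (F : T -> 'M[R]_(m, n)) (G : T -> 'M[R]_(n, p)) :
  mcont F -> mcont G -> mcont (fun y => F y *m G y).
Proof.
move=> Fc Gc i j.
have -> : (fun y => (F y *m G y) i j) = (fun y => \sum_k F y i k * G y k j).
  by apply/funext => y; rewrite mxE.
by apply: continuous_big_sum => k; apply: cvgM; [exact: Fc|exact: Gc].
Qed.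

Lemma mcontD m n (F G : T -> 'M[R]_(m, n)) :
  mcont F -> mcont G -> mcont (fun y => F y + G y).
Proof.
move=> Fc Gc i j.
have -> : (fun y => (F y + G y) i j) = (fun y => F y i j + G y i j).
  by apply/funext => y; rewrite mxE.
by apply: cvgD; [exact: Fc|exact: Gc].
Qed.

Lemma mcont_tr m n (F : T -> 'M[R]_(m, n)) : mcont F -> mcont (fun y => (F y)^T).
Proof.
move=> Fc i j.
have -> : (fun y => (F y)^T i j) = (fun y => F y j i) by apply/funext => y; rewrite mxE.
exact: Fc.
Qed.

Lemma mcont_det n (F : T -> 'M[R]_n) : mcont F ->
  {for x, continuous (fun y => \det (F y))}.
Proof.
move=> Fc; rewrite /determinant; apply: continuous_big_sum => s.
apply: cvgM; first exact: cvg_cst.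
by apply: continuous_big_prod => i; exact: Fc.
Qed.

(** The inverse is written with the adjugate because its entries are then rational in those of F
    near x, whereas [invmx] is defined by cases. *)
Lemma mcont_inv n (F : T -> 'M[R]_n) : mcont F -> F x \in unitmx ->
  mcont (fun y => (\det (F y))^-1 *: \adj (F y)).
Proof.
move=> Fc Fu i j.
have -> : (fun y => ((\det (F y))^-1 *: \adj (F y)) i j) =
    (fun y => (\det (F y))^-1 * cofactor (F y) j i).
  by apply/funext => y; rewrite !mxE.
apply: cvgM; first by apply: cvgV; [rewrite -unitfE -unitmxE|exact: mcont_det].
apply: cvgM; first exact: cvg_cst.
apply: mcont_det => k l.
have -> : (fun y => (row' j (col' i (F y))) k l) = (fun y => F y (lift j k) (lift i l)).
  by apply/funext => y; rewrite !mxE.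
exact: Fc.
Qed.

End entrywise_continuity.

Lemma invmxE (R : realType) n (A : 'M[R]_n) : A \in unitmx ->
  (\det A)^-1 *: \adj A = invmx A.
Proof. by move=> Au; rewrite /invmx Au. Qed.

Section mcont_operator.
Context (R : realType) (m : nat).

Lemma row_mcontP n (F : 'rV[R]_m -> 'rV[R]_n) x :
  mcont x F <-> {for x, continuous F}.
Proof.
split=> [Fc|Fc i j].
  apply/continuous_enormP => e e0.
  have near_i : nbhs x (fun y => forall j, `|F x 0 j - F y 0 j| < e / n.+1%:R).
    apply: (@filter_forall _ _ _ (nbhs x)) => j.
    have := Fc 0 j; move/(@cvgrPdist_lt _ _ _ (nbhs x)); apply.
    by rewrite divr_gt0.
  have /nbhs_enormP[d d0 dP] := near_i; exists d => // y /dP yx.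
  apply: le_lt_trans (enorm_le_norm _) _.
  have : `|F y - F x| <= e / n.+1%:R.
    apply/norm_leP => [|j]; first by rewrite divr_ge0// ltW.
    by rewrite !mxE distrC ltW.
  move=> /(ler_wpM2l (ler0n R n))/le_lt_trans; apply.
  by rewrite mulrCA gtr_pMr// ltr_pdivrMr// mul1r ltr_nat.
rewrite (ord1 i); apply: (@continuous_comp _ _ _ F (fun v : 'rV[R]_n => v 0 j)) => //.
exact: coord_continuous.
Qed.

Lemma mcont_operator k l (C : 'rV[R]_m -> 'M[R]_(k, l)) u e : 0 < e -> mcont u C ->
  exists2 d, 0 < d & forall a, enorm (a - u) < d ->
    forall v, enorm (v *m (C a - C u)) <= e * enorm v.
Proof.
move=> e0 Cc.
pose K : R := l%:R * \sum_(i < k) \sum_(j < l) `|(const_mx 1 : 'M[R]_(k, l)) i j|.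
have K0 : 0 <= K by rewrite mulr_ge0// sumr_ge0// => i _; rewrite sumr_ge0.
have K1 : 0 < K + 1 by rewrite ltr_wpDl.
have near_ij : nbhs u (fun a => forall i j, `|C u i j - C a i j| < e / (K + 1)).
  apply: (@filter_forall _ _ _ (nbhs u)) => i; apply: (@filter_forall _ _ _ (nbhs u)) => j.
  have := Cc i j; move/(@cvgrPdist_lt _ _ _ (nbhs u)); apply; exact: divr_gt0.
have /nbhs_enormP[d d0 dP] := near_ij; exists d => // a /dP au v.
apply: le_trans (enorm_mulmx_entry_le (t := e / (K + 1)) (T := const_mx 1) _ _ v) _.
- by rewrite divr_ge0// ltW.
- by move=> i j; rewrite !mxE normr1 mulr1 distrC ltW.
rewrite -/K ler_wpM2r ?enorm_ge0// mulrAC ler_pdivrMr// ler_wpM2l ?(ltW e0)//.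
by rewrite lerDl.
Qed.

End mcont_operator.

(** * Calculus of Frechet differentials *)

Section fdiff_calculus.
Context (R : realType) (m n : nat).

Lemma fdiff_near (F G : 'rV[R]_m -> 'rV[R]_n) u A :
  (exists2 d, 0 < d & forall a, enorm (a - u) < d -> F a = G a) ->
  fdiff F u A -> fdiff G u A.
Proof.
move=> [d0 d00 FG] Fu e e0; have [d dp dP] := Fu e e0.
exists (Num.min d0 d); first by rewrite lt_min d00.
move=> a; rewrite lt_min => /andP[a1 a2].
by rewrite -!FG//; [exact: dP|rewrite subrr enorm0].
Qed.

Lemma fdiff_unique (F : 'rV[R]_m -> 'rV[R]_n) u A B :
  fdiff F u A -> fdiff F u B -> A = B.
Proof.
move=> FA FB; apply/row_matrixP => i; rewrite !rowE.
have [_ <-] := fdiff_is_derive (delta_mx 0 i) FA.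
by have [_ <-] := fdiff_is_derive (delta_mx 0 i) FB.
Qed.

Lemma fdiff_lipschitz (F : 'rV[R]_m -> 'rV[R]_n) u A : fdiff F u A ->
  exists2 c, 0 < c & exists2 d, 0 < d & forall a, enorm (a - u) < d ->
    enorm (F a - F u) <= c * enorm (a - u).
Proof.
move=> Fu; have [c c0 cA] := enorm_mulmx_le A; have [d d0 dP] := Fu 1 ltr01.
exists (1 + c); first by rewrite addr_gt0.
exists d => // a au; rewrite -[F a - F u](subrK ((a - u) *m A)) mulrDl.
by apply: le_trans (enormD _ _) (lerD (dP _ au) (cA _)).
Qed.

End fdiff_calculus.

Section fdiff_products.
Context (R : realType) (m n : nat).

Lemma fdiff_comp p (G : 'rV[R]_p -> 'rV[R]_m) (F : 'rV[R]_m -> 'rV[R]_n) u C B :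
  fdiff G u C -> fdiff F (G u) B -> fdiff (fun a => F (G a)) u (C *m B).
Proof.
move=> Gu Fu e e0; have [c c0 [d1 d10 cG]] := fdiff_lipschitz Gu.
have [b b0 bB] := enorm_mulmx_le B.
have [d2 d20 d2P] := Gu (e / 2 / b) (divr_gt0 (divr_gt0 e0 (ltr0Sn R 1)) b0).
have [d3 d30 d3P] := Fu (e / 2 / c) (divr_gt0 (divr_gt0 e0 (ltr0Sn R 1)) c0).
exists (Num.min d1 (Num.min d2 (d3 / c))); first by rewrite !lt_min d10 d20 divr_gt0.
move=> a; rewrite !lt_min => /and3P[a1 a2 a3].
have Ga := cG _ a1.
have Ga3 : enorm (G a - G u) < d3.
  by apply: le_lt_trans Ga _; rewrite mulrC -ltr_pdivlMr.
rewrite (_ : F (G a) - F (G u) - (a - u) *m (C *m B) = (F (G a) - F (G u) - (G a - G u) *m B) +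
   (G a - G u - (a - u) *m C) *m B); last by rewrite [(_ - _ *m C) *m B]mulmxBl mulmxA subrKA.
apply: le_trans (enormD _ _) _.
have h1 : e / 2 / c * enorm (G a - G u) <= e / 2 * enorm (a - u).
  by rewrite -mulrA ler_wpM2l ?divr_ge0 ?(ltW e0)// ler_pdivrMl.
have h2 : b * enorm (G a - G u - (a - u) *m C) <= e / 2 * enorm (a - u).
  by rewrite -ler_pdivlMl// mulrA [b^-1 * _]mulrC; exact: d2P.
have := bB (G a - G u - (a - u) *m C); have := d3P _ Ga3; lra.
Qed.

(** Product rule at a zero of b: the variation of C is multiplied by a quantity of first order, so
    continuity of C is enough. This is how second fundamental forms are compared between charts. *)
Lemma fdiff_vanishing_mul l (b : 'rV[R]_m -> 'rV[R]_n) (C : 'rV[R]_m -> 'M[R]_(n, l)) u D :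
  fdiff b u D -> b u = 0 -> mcont u C -> fdiff (fun a => b a *m C a) u (D *m C u).
Proof.
move=> bu b0 Cc e e0; have [c c0 [d1 d10 cb]] := fdiff_lipschitz bu.
have [k k0 kC] := enorm_mulmx_le (C u).
have [d2 d20 d2P] := bu (e / 2 / k) (divr_gt0 (divr_gt0 e0 (ltr0Sn R 1)) k0).
have [d3 d30 d3P] := mcont_operator (divr_gt0 (divr_gt0 e0 (ltr0Sn R 1)) c0) Cc.
exists (Num.min d1 (Num.min d2 d3)); first by rewrite !lt_min d10 d20.
move=> a; rewrite !lt_min => /and3P[a1 a2 a3].
rewrite b0 mul0mx subr0.
rewrite (_ : b a *m C a - (a - u) *m (D *m C u) =
    b a *m (C a - C u) + (b a - (a - u) *m D) *m C u); last first.
  by rewrite [(_ - _ *m D) *m _]mulmxBl mulmxBr mulmxA subrKA.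
apply: le_trans (enormD _ _) _.
have := d2P _ a2; rewrite b0 subr0 => {}d2P; have := cb _ a1; rewrite b0 subr0 => {}cb.
have h1 : e / 2 / c * enorm (b a) <= e / 2 * enorm (a - u).
  by rewrite -mulrA ler_wpM2l ?divr_ge0 ?(ltW e0)// ler_pdivrMl.
have h2 : k * enorm (b a - (a - u) *m D) <= e / 2 * enorm (a - u).
  by rewrite -ler_pdivlMl// mulrA [k^-1 * _]mulrC.
have := kC (b a - (a - u) *m D); have := d3P _ a3 (b a); lra.
Qed.

End fdiff_products.

Section linear_algebra.
Context (R : realType).

Lemma mulmx_tr_eq0 m n (v : 'rV[R]_m) (B : 'M[R]_(m, n)) :
  v *m (B *m B^T) = 0 -> v *m B = 0.
Proof.
move=> vB; apply/eqP; rewrite -enorm_eq0 -sqrf_eq0 enorm_sqr.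
by rewrite dot_mxE trmx_mul mulmxA -(mulmxA v) vB mul0mx mxE.
Qed.

Lemma gram_unit m n (B : 'M[R]_(m, n)) : row_free B -> B *m B^T \in unitmx.
Proof.
move=> Bfree; rewrite -row_free_unit; apply/row_freeP.
have : row_free (B *m B^T).
  rewrite -kermx_eq0; apply/rowV0P => v /sub_kermxP vB.
  by have := mulmx_tr_eq0 vB; rewrite -[RHS](mul0mx _ B) => /(row_free_inj Bfree).
by move/row_freeP.
Qed.

(** The n independent rows of A together with nu form a basis of the space, so q is orthogonal to
    every vector. *)
Lemma orthogonal_eq0 n (A : 'M[R]_(n, n.+1)) (nu q : 'rV[R]_n.+1) :
  row_free A -> nu != 0 -> nu *m A^T = 0 -> q *m A^T = 0 -> dot q nu = 0 -> q = 0.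
Proof.
move=> Afree nu0 nuA qA qnu.
have Bfree : row_free (col_mx nu A).
  rewrite -kermx_eq0; apply/rowV0P => v /sub_kermxP.
  rewrite -(hsubmxK v) mul_row_col => vB.
  have l0 : lsubmx v = 0.
    have : (lsubmx v *m nu + rsubmx v *m A) *m nu^T = 0 by rewrite vB mul0mx.
    rewrite mulmxDl -!mulmxA (_ : A *m nu^T = 0) ?mulmx0 ?addr0; last first.
      by rewrite -[A]trmxK -trmx_mul nuA trmx0.
    rewrite (mx11_scalar (nu *m nu^T)) -dot_mxE mul_mx_scalar => /eqP.
    by rewrite scaler_eq0 gt_eqF ?dot_gt0//= => /eqP.
  have r0 : rsubmx v = 0.
    by move: vB; rewrite l0 mul0mx add0r -[RHS](mul0mx _ A) => /(row_free_inj Afree).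
  by rewrite l0 r0 row_mx0.
have Bunit : (col_mx nu A)^T \in unitmx.
  by rewrite unitmx_tr -row_free_unit.
have : q *m (col_mx nu A)^T = 0.
  rewrite tr_col_mx mul_mx_row qA (mx11_scalar (q *m nu^T)) -dot_mxE qnu.
  by rewrite raddf0 row_mx0.
by move=> /(congr1 (mulmx^~ (invmx (col_mx nu A)^T))); rewrite mulmxK// mul0mx.
Qed.

Lemma orthogonal_proportional n (A : 'M[R]_(n, n.+1)) (nu p : 'rV[R]_n.+1) :
  row_free A -> enorm nu = 1 -> nu *m A^T = 0 -> p *m A^T = 0 ->
  p = dot p nu *: nu.
Proof.
move=> Afree nu1 nuA pA; apply/eqP; rewrite -subr_eq0; apply/eqP.
have nu0 : nu != 0 by rewrite -enorm_gt0 nu1.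
apply: (orthogonal_eq0 Afree nu0 nuA).
  by rewrite mulmxBl -scalemxAl pA nuA scaler0 subr0.
by rewrite dotBl dotZl -[dot nu nu]enorm_sqr nu1 expr1n mulr1 subrr.
Qed.

End linear_algebra.

Lemma open_enorm_ball (R : realType) n (u : 'rV[R]_n) e :
  open [set w | enorm (w - u) < e].
Proof.
rewrite openE => w /= wu; apply/nbhs_enormP; exists (e - enorm (w - u)).
  by rewrite subr_gt0.
move=> v vw /=; apply: le_lt_trans (enorm_triangle w v u) _.
by rewrite -ltrBrDr.
Qed.

Lemma open_enormP (R : realType) n (V : set 'rV[R]_n) u : open V -> V u ->
  exists2 d, 0 < d & forall a, enorm (a - u) < d -> V a.
Proof. by move=> oV Vu; apply/nbhs_enormP; exact: open_nbhs_nbhs. Qed.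

(** * Normal fields and chart changes *)

Section charts.
Context (R : realType) (m n : nat).
Implicit Types (M : set 'rV[R]_n) (V : set 'rV[R]_m) (X : 'rV[R]_m -> 'rV[R]_n).

Lemma first_formE X u : first_form X u = tangent_frame X u *m (tangent_frame X u)^T.
Proof. by apply/matrixP => i j; rewrite !mxE; apply: eq_bigr => k _; rewrite !mxE. Qed.

Lemma continuous_near_eq k (F G : 'rV[R]_m -> 'rV[R]_k) u :
  (exists2 d, 0 < d & forall a, enorm (a - u) < d -> F a = G a) ->
  {for u, continuous F} -> {for u, continuous G}.
Proof.
move=> [d0 d00 FG] /continuous_enormP Fc; apply/continuous_enormP => e e0.
have [d dp dP] := Fc e e0; exists (Num.min d0 d); first by rewrite lt_min d00.
move=> a; rewrite lt_min => /andP[a1 a2].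
by rewrite -!FG//; [exact: dP|rewrite subrr enorm0].
Qed.

Lemma fdiff_tangent_frame X u A : fdiff X u A -> tangent_frame X u = A.
Proof.
move=> Xu; apply/matrixP => i j; rewrite mxE /partial.
by have [_ ->] := fdiff_is_derive (delta_mx 0 i) Xu; rewrite -rowE mxE.
Qed.

Lemma mcont_tangent_frame V X u : C1_on V X -> V u -> mcont u (tangent_frame X).
Proof.
move=> XC Vu i j; have [_ /row_mcontP/(_ 0 j)] := XC i u Vu.
have -> : (fun w => tangent_frame X w i j) = (fun w => partial i X w 0 j).
  by apply/funext => w; rewrite mxE.
exact.
Qed.

(** For a fixed vector nu this field on the parameter domain vanishes exactly where nu is orthogonal
    to the tangent space, and its differential is minus the second fundamental form. It replaces the
    varying unit normal throughout. *)
Definition normal_field X (nu : 'rV[R]_n) u : 'rV[R]_m := nu *m (tangent_frame X u)^T.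

Lemma normal_fieldE X nu u : normal_field X nu u = \row_i dot (partial i X u) nu.
Proof.
by apply/rowP => i; rewrite !mxE; apply: eq_bigr => k _; rewrite !mxE mulrC.
Qed.

Lemma mcont_second_form V X (nu : 'rV[R]_n) u : C2_on V X -> V u ->
  mcont u (second_form X nu).
Proof.
move=> [_ XC2] Vu i j; have [_ /row_mcontP pc] := XC2 i j u Vu.
have -> : (fun w => second_form X nu w i j) =
    (fun w => \sum_k (partial j (partial i X) w 0 k * - nu 0 k)).
  by apply/funext => w; rewrite mxE -sumrN; apply: eq_bigr => k _; rewrite mulrN.
apply: continuous_big_sum => k.
apply: (@continuousM _ _ (fun w => partial j (partial i X) w 0 k) (fun=> - nu 0 k)).
  exact: pc.
exact: cst_continuous.
Qed.

Lemma normal_field_derive V X nu u j : C2_on V X -> V u ->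
  is_derive u (delta_mx 0 j) (normal_field X nu) (row j (- (second_form X nu u)^T)).
Proof.
move=> [_ XC2] Vu; apply/is_derive_rowP => i.
have [/derivableP pd _] := XC2 i j u Vu.
rewrite !mxE opprK; have := is_derive_dot nu pd.
by rewrite (_ : (fun w => dot _ nu) = (fun w => normal_field X nu w 0 i))//;
  apply/funext => w; rewrite normal_fieldE mxE.
Qed.

Lemma normal_field_strict_diff V X nu u : open V -> C2_on V X -> V u ->
  strict_diff (normal_field X nu) u (- (second_form X nu u)^T).
Proof.
move=> oV XC Vu.
have pE w j : V w -> partial j (normal_field X nu) w = row j (- (second_form X nu w)^T).
  by move=> Vw; have [_] := normal_field_derive nu j XC Vw.
have <- : tangent_frame (normal_field X nu) u = - (second_form X nu u)^T.
  by apply/row_matrixP => j; rewrite -pE//; apply/rowP => k; rewrite !mxE.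
apply: (C1_strict_diff oV) => // j w Vw; split.
  by have [] := normal_field_derive nu j XC Vw.
have [d d0 dV] := open_enormP oV Vw.
apply: (@continuous_near_eq _ (fun w => row j (- (second_form X nu w)^T))).
  by exists d => // a /dV Va; rewrite pE.
have Sm : mcont w (second_form X nu) by apply: mcont_second_form XC Vw.
apply/row_mcontP => i k; have := Sm k j.
have -> : (fun y => row j (- (second_form X nu y)^T) i k) =
    (fun y => - second_form X nu y k j) by apply/funext => y; rewrite !mxE.
exact: (@continuousN _ _ _ (fun y => second_form X nu y k j)).
Qed.

Variable M : set 'rV[R]_n.

Lemma chart_fdiff V X u : C2_chart M V X -> V u -> fdiff X u (tangent_frame X u).
Proof.
by move=> [oV [XC _] _ _ _] Vu; apply/strict_diff_fdiff/(C1_strict_diff oV).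
Qed.

Lemma chart_mem V X u : C2_chart M V X -> V u -> M (X u).
Proof.
move=> [oV _ _ _ hom] Vu; have [U _ XU] := hom V oV (@subset_refl _ _).
by have : (X @` V) (X u) by [exists u]; rewrite XU => -[].
Qed.

(** The homeomorphism clause of a chart: points of M near X u have parameters near u, so no other
    sheet of M comes close. *)
Lemma chart_local V X u : C2_chart M V X -> V u -> forall e, 0 < e ->
  exists2 d, 0 < d & forall y, M y -> enorm (y - X u) < d ->
    exists w, [/\ V w, X w = y & enorm (w - u) < e].
Proof.
move=> [oV _ _ _ hom] Vu e e0.
have [U oU XU] := hom (V `&` [set w | enorm (w - u) < e])
  (openI oV (@open_enorm_ball _ _ u e)) (@subIsetl _ _ _).
have Uu : U (X u).
  have : (X @` (V `&` [set w | enorm (w - u) < e])) (X u).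
    by exists u => //; split => //=; rewrite subrr enorm0.
  by rewrite XU => -[].
have [d d0 dU] := open_enormP oU Uu; exists d => // y My /dU Uy.
have : (M `&` U) y by [].
by rewrite -XU => -[w [Vw we] <-]; exists w.
Qed.

Lemma chart_inj V X a b : C2_chart M V X -> V a -> V b -> X a = X b -> a = b.
Proof. by move=> [_ _ Xinj _ _] Va Vb; apply: Xinj; exact: mem_set. Qed.

Section transition.
Variables (V V' : set 'rV[R]_m) (X Y : 'rV[R]_m -> 'rV[R]_n).
Hypotheses (cX : C2_chart M V X) (cY : C2_chart M V' Y).
Variable phi : 'rV[R]_m -> 'rV[R]_m.

(** The only candidate for the differential of the transition phi: differentiating X = Y o phi gives
    A_X = C A_Y, and A_Y has the right inverse A_Y^T (A_Y A_Y^T)^(-1). *)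
Let C a := tangent_frame X a *m (tangent_frame Y (phi a))^T *m
  ((\det (first_form Y (phi a)))^-1 *: \adj (first_form Y (phi a))).

Lemma chart_first_form_unit w : V' w -> first_form Y w \in unitmx.
Proof. by move=> V'w; rewrite first_formE gram_unit//; case: cY => _ _ _ + _; apply. Qed.

Lemma transition_continuous u : V u ->
  (exists2 d, 0 < d & forall a, enorm (a - u) < d -> V' (phi a) /\ Y (phi a) = X a) ->
  {for u, continuous phi}.
Proof.
move=> Vu [d0 d00 phiP]; have [V'u Yu] : V' (phi u) /\ Y (phi u) = X u.
  by apply: phiP; rewrite subrr enorm0.
have [d1 d10 d1V] : exists2 d, 0 < d & forall a, enorm (a - u) < d -> V a.
  by apply: open_enormP Vu; case: cX.
apply/continuous_enormP => e e0; have [d dp dP] := chart_local cY V'u e0.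
have /continuous_enormP/(_ _ dp)[d2 d20 d2P] := fdiff_continuous (chart_fdiff cX Vu).
exists (Num.min d0 (Num.min d1 d2)); first by rewrite !lt_min d00 d10.
move=> a; rewrite !lt_min => /and3P[/phiP[V'a Ya] /d1V Va /d2P].
rewrite -Yu => /(dP _ (chart_mem cX Va))[w [V'w Yw wu]].
by rewrite (chart_inj cY V'a V'w)// Yw.
Qed.

(** Strict differentiability of Y makes phi Lipschitz at u. The equation Y (phi a) = X a, linearized
    on both sides and multiplied by the right inverse of the frame of Y, then determines phi a - phi
    u to first order. *)
Lemma transition_fdiff u : V u ->
  (exists2 d, 0 < d & forall a, enorm (a - u) < d -> V' (phi a) /\ Y (phi a) = X a) ->
  fdiff phi u (C u) /\ tangent_frame X u = C u *m tangent_frame Y (phi u).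
Proof.
move=> Vu phiP; have [d0 d00 {}phiPd] := phiP.
have [V'u Yu] : V' (phi u) /\ Y (phi u) = X u by apply: phiPd; rewrite subrr enorm0.
have phic := transition_continuous Vu phiP.
set w := phi u in V'u Yu *; set B := tangent_frame Y w.
have Bfree : row_free B by case: cY => _ _ _ + _; apply.
have CE : C u = tangent_frame X u *m (B^T *m invmx (B *m B^T)).
  by rewrite /C mulmxA -invmxE ?gram_unit// first_formE.
have rinv : B *m (B^T *m invmx (B *m B^T)) = 1%:M by rewrite mulmxA mulmxV ?gram_unit.
set P := B^T *m _ in CE rinv.
have [c c0 cP] := enorm_mulmx_le P.
have phid : fdiff phi u (C u).
  have oV' : open V' by case: cY.
  have YC1 : C1_on V' Y by case: cY => _ [].
  have [k k0 [dX dX0 Xlip]] := fdiff_lipschitz (chart_fdiff cX Vu).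
  have [dr dr0 ratio] := strict_diff_ratio ltr01 Bfree (C1_strict_diff oV' YC1 V'u).
  have [cB cB0 cBP] := enorm_row_free_le Bfree.
  pose L := cB * (1 + 1) * k.
  have L0 : 0 < L by rewrite !mulr_gt0// addr_gt0.
  move=> e e0.
  have [d1 d10 Ydiff] := chart_fdiff cY V'u (divr_gt0 (divr_gt0 e0 (ltr0Sn R 1)) (mulr_gt0 c0 L0)).
  have [d2 d20 Xdiff] := chart_fdiff cX Vu (divr_gt0 (divr_gt0 e0 (ltr0Sn R 1)) c0).
  have min0 : 0 < Num.min dr d1 by rewrite lt_min dr0.
  have /continuous_enormP/(_ _ min0)[d3 d30 phic3] := phic.
  exists (Num.min (Num.min d0 dX) (Num.min d2 d3)); first by rewrite !lt_min d00 dX0 d20.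
  move=> a; rewrite !lt_min => /andP[/andP[a0 aX] /andP[a2 a3]].
  have := phic3 _ a3; rewrite lt_min => /andP[ar a1].
  have [V'a Ya] := phiPd _ a0.
  have lip : enorm (phi a - w) <= L * enorm (a - u).
    apply: le_trans (cBP _) _; rewrite mulmxBl -!mulrA ler_wpM2l ?(ltW cB0)//.
    have w0 : enorm (w - w) < dr by rewrite subrr enorm0.
    have [_ r2] := ratio _ _ ar w0.
    apply: le_trans r2 _; rewrite ler_wpM2l// Ya Yu; exact: Xlip.
  have h1 := Ydiff _ a1; have h2 := Xdiff _ a2.
  rewrite Ya Yu in h1.
  have -> : phi a - w - (a - u) *m C u =
      - ((X a - X u - (phi a - w) *m B) - (X a - X u - (a - u) *m tangent_frame X u)) *m P.
    rewrite [X in - X *m P](_ : _ = (a - u) *m tangent_frame X u - (phi a - w) *m B);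
      last by rewrite opprB addrC subrKA.
    rewrite mulNmx [(_ - (phi a - w) *m B) *m P]mulmxBl opprB.
    by rewrite -[(phi a - w) *m B *m P]mulmxA rinv mulmx1 CE mulmxA.
  apply: le_trans (cP _) _; rewrite enormN.
  apply: le_trans (ler_wpM2l (ltW c0) (enormB _ _)) _.
  have h3 : c * enorm (X a - X u - (phi a - w) *m B) <= e / 2 * enorm (a - u).
    apply: le_trans (ler_wpM2l (ltW c0) h1) _.
    apply: le_trans (ler_wpM2l (ltW c0) (ler_wpM2l _ lip)) _.
      by apply/ltW; rewrite !divr_gt0 ?mulr_gt0.
    rewrite le_eqVlt; apply/orP; left; apply/eqP.
    by rewrite invfM; field; rewrite !gt_eqF.
  have h4 : c * enorm (X a - X u - (a - u) *m tangent_frame X u) <= e / 2 * enorm (a - u).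
    apply: le_trans (ler_wpM2l (ltW c0) h2) _.
    by rewrite mulrA mulrCA divff ?gt_eqF// mulr1.
  by rewrite mulrDr; apply: le_trans (lerD h3 h4) _; rewrite -mulrDl -splitr.
split => //.
apply: fdiff_unique (chart_fdiff cX Vu) _.
apply: (fdiff_near (F := fun a => Y (phi a))); first by exists d0 => // a /phiPd[].
by apply: fdiff_comp => //; exact: chart_fdiff cY _.
Qed.

End transition.

(** The normal field of X is that of Y composed with phi, times C^T. The field of Y vanishes at w,
    so differentiation yields II_X = C II_Y C^T; also I_X = C I_Y C^T, and the square of det C
    cancels in the quotient. *)
Lemma gauss_kronecker_chart_unique V V' X Y u w nu :
  C2_chart M V X -> C2_chart M V' Y -> V u -> V' w -> X u = Y w ->
  normal_field X nu u = 0 -> normal_field Y nu w = 0 ->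
  \det (second_form X nu u) / \det (first_form X u) =
  \det (second_form Y nu w) / \det (first_form Y w).
Proof.
move=> cX cY Vu V'w XY nuX nuY.
have [oV XC2 _ Xfree _] := cX; have [oV' YC2 _ Yfree _] := cY.
pose phi a := xget w [set w' | V' w' /\ Y w' = X a].
have phiu : phi u = w.
  rewrite /phi; case: xgetP => [w' _ [V'w' Yw']|]; last by [].
  by apply: (chart_inj cY) => //; rewrite Yw'.
have [d d0 phiP] : exists2 d, 0 < d & forall a, enorm (a - u) < d ->
    V a /\ (V' (phi a) /\ Y (phi a) = X a).
  have [d1 d10 d1V] := open_enormP oV Vu.
  have [d2 d20 d2P] := chart_local cY V'w ltr01.
  have /continuous_enormP/(_ _ d20)[d3 d30 d3P] := fdiff_continuous (chart_fdiff cX Vu).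
  exists (Num.min d1 d3); first by rewrite lt_min d10.
  move=> a; rewrite lt_min => /andP[/d1V Va /d3P]; rewrite XY.
  move=> /(d2P _ (chart_mem cX Va))[w' [V'w' Yw' _]]; split => //.
  by apply: (@xgetPex _ w [set w' | V' w' /\ Y w' = X a]); exists w'.
have near_phi a : enorm (a - u) < d -> exists2 d', 0 < d' &
    forall b, enorm (b - a) < d' -> V' (phi b) /\ Y (phi b) = X b.
  move=> au; exists (d - enorm (a - u)); first by rewrite subr_gt0.
  move=> b ba; apply: (phiP b _).2; apply: le_lt_trans (enorm_triangle a b u) _.
  by rewrite -ltrBrDr.
have uu : enorm (u - u) < d by rewrite subrr enorm0.
pose C a := tangent_frame X a *m (tangent_frame Y (phi a))^T *m
  ((\det (first_form Y (phi a)))^-1 *: \adj (first_form Y (phi a))).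
have trans a : enorm (a - u) < d ->
    fdiff phi a (C a) /\ tangent_frame X a = C a *m tangent_frame Y (phi a).
  by move=> au; apply: (transition_fdiff cX cY); [exact: (phiP a au).1|exact: near_phi].
have [phid XCY] := trans u uu; rewrite phiu in XCY.
have phic := fdiff_continuous phid.
have Ym : mcont u (fun a => tangent_frame Y (phi a)).
  have Ymw : mcont (phi u) (tangent_frame Y).
    by rewrite phiu; apply: mcont_tangent_frame V'w; case: YC2.
  move=> i j.
  exact: (@continuous_comp _ _ _ phi (fun y => tangent_frame Y y i j) u phic (Ymw i j)).
have Cm : mcont u C.
  apply: mcont_mul.
    by apply: mcont_mul; [apply: mcont_tangent_frame Vu; case: XC2|exact: mcont_tr].
  apply: mcont_inv; last by rewrite phiu; exact: chart_first_form_unit cY _ V'w.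
  have -> : (fun a => first_form Y (phi a)) =
      (fun a => tangent_frame Y (phi a) *m (tangent_frame Y (phi a))^T).
    by apply/funext => a; rewrite first_formE.
  by apply: mcont_mul => //; exact: mcont_tr.
have bd : fdiff (fun a => normal_field Y nu (phi a)) u (C u *m - (second_form Y nu w)^T).
  apply: fdiff_comp phid _; rewrite phiu.
  exact/strict_diff_fdiff/(normal_field_strict_diff _ oV').
have b0 : normal_field Y nu (phi u) = 0 by rewrite phiu.
have Ctm : mcont u (fun a => (C a)^T) by exact: mcont_tr.
have XF : fdiff (normal_field X nu) u (C u *m - (second_form Y nu w)^T *m (C u)^T).
  apply: (fdiff_near _ (fdiff_vanishing_mul bd b0 Ctm)); exists d => // a au.
  have := (trans a au).2; rewrite /normal_field; move: (C a) => Ca ->.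
  by rewrite trmx_mul mulmxA.
have XII := strict_diff_fdiff (normal_field_strict_diff nu oV XC2 Vu).
have IIE := fdiff_unique XII XF; move: (C u) IIE XCY => Cu IIE XCY.
have {}IIE : second_form X nu u = Cu *m second_form Y nu w *m (Cu)^T.
  apply: trmx_inj; apply: oppr_inj; rewrite IIE !trmx_mul trmxK mulmxN mulNmx.
  by rewrite mulmxA.
have Cdet : \det (Cu) != 0.
  apply/eqP => C0; have := gram_unit (Xfree u Vu).
  rewrite XCY trmx_mul mulmxA -[Cu *m _ *m _]mulmxA unitmxE !det_mulmx C0 !mul0r.
  by rewrite unitr0.
have Yu : \det (first_form Y w) != 0.
  by rewrite -unitfE -unitmxE; exact: chart_first_form_unit cY _ V'w.
rewrite IIE !first_formE XCY trmx_mul mulmxA -[Cu *m _ *m _^T]mulmxA.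
rewrite -(mulmxA _ (tangent_frame Y w)) -first_formE !det_mulmx det_tr.
by field; rewrite Yu Cdet.
Qed.

End charts.

(** * Support points of convex bodies *)

Lemma small_multiple (R : realType) n (v : 'rV[R]_n) (d : R) : 0 < d ->
  exists2 t, 0 < t & enorm (t *: v) < d.
Proof.
move=> d0; have v0 := enorm_ge0 v; have v1 : 0 < enorm v + 1 by rewrite ltr_wpDl.
have t0 : 0 < d / (enorm v + 1) / 2 by rewrite !divr_gt0.
exists (d / (enorm v + 1) / 2) => //.
rewrite enormZ gtr0_norm// mulrAC ltr_pdivrMr// mulrAC ltr_pdivrMr//; nra.
Qed.

Lemma dot_continuous (R : realType) n (p : 'rV[R]_n) : continuous (fun x => dot x p).
Proof.
move=> x; apply: continuous_big_sum => i.
apply: (@continuousM _ _ (fun x : 'rV[R]_n => x 0 i) (fun=> p 0 i)).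
  exact: coord_continuous.
exact: cst_continuous.
Qed.

(** First-order condition at a maximum: the derivative in every direction v is at most 0, and v may
    be replaced by - v. *)
Lemma fdiff_max (R : realType) m n (F : 'rV[R]_m -> 'rV[R]_n) u A (nu : 'rV[R]_n) :
  fdiff F u A -> (exists2 d, 0 < d & forall a, enorm (a - u) < d ->
    dot (F a - F u) nu <= 0) -> nu *m A^T = 0.
Proof.
move=> Fu [d d0 dmax].
have le0 v : dot (v *m A) nu <= 0.
  apply/ler_addgt0Pr => e e0; rewrite add0r.
  pose c := (enorm v + 1) * (enorm nu + 1).
  have v1 : 0 < enorm v + 1 by rewrite ltr_wpDl// enorm_ge0.
  have nu1 : 0 < enorm nu + 1 by rewrite ltr_wpDl// enorm_ge0.
  have c0 : 0 < c by exact: mulr_gt0.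
  have [d1 d10 dP] := Fu (e / c) (divr_gt0 e0 c0).
  have [|t t0 tv] := @small_multiple R m v (Num.min d d1); first by rewrite lt_min d0.
  move: tv; rewrite lt_min => /andP[td td1].
  have ua : u + t *: v - u = t *: v by rewrite addrC addKr.
  have := dmax (u + t *: v); rewrite ua => /(_ td).
  have := dP (u + t *: v); rewrite ua => /(_ td1).
  move: (F (u + t *: v) - F u) => r h1 h2.
  have h3 := cauchy_schwarz (r - (t *: v) *m A) nu.
  move: h3; rewrite dotBl -scalemxAl dotZl ler_norml => /andP[h3 _].
  have h4 : enorm (r - (t *: v) *m A) * enorm nu <= t * e.
    apply: le_trans (ler_wpM2r (enorm_ge0 nu) h1) _.
    rewrite enormZ (gtr0_norm t0).
    have -> : e / c * (t * enorm v) * enorm nu = t * (e * (enorm v * enorm nu / c)).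
      by move: (c^-1) => ci; ring.
    rewrite ler_pM2l// -[leRHS]mulr1 ler_wpM2l ?(ltW e0)// ler_pdivrMr// mul1r.
    by apply: ler_pM; rewrite ?enorm_ge0// lerDl.
  rewrite -(ler_pM2l t0); rewrite -scalemxAl in h4; lra.
have eq0 v : dot (v *m A) nu = 0.
  apply/eqP; rewrite eq_le le0/=; have := le0 (- v).
  by rewrite mulNmx dotNl oppr_le0.
apply/rowP => i; rewrite [RHS]mxE; have := eq0 (delta_mx 0 i).
by rewrite -rowE !mxE => {2}<-; apply: eq_bigr => k _; rewrite !mxE mulrC.
Qed.

Section convex_bodies.
Context (R : realType) (n : nat) (K : set 'rV[R]_n.+1).
Hypotheses (Kbody : convex_body K) (KC2 : @C2_plus R n.+1 K).
Local Notation M := (boundary setT K).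
Implicit Types (p x y : 'rV[R]_n.+1) (V : set 'rV[R]_n) (X : 'rV[R]_n -> 'rV[R]_n.+1).

Definition maximizes p x := K x /\ forall y, K y -> dot y p <= dot x p.

Definition support_point p : 'rV[R]_n.+1 := xget 0 (maximizes p).

Lemma convex_body_closed : closed K.
Proof. by apply: compact_rV_closed; case: Kbody. Qed.

Lemma convex_body_nonempty : K !=set0.
Proof. by case: Kbody => _ _ [y yK]; exists y; exact: interior_subset. Qed.

Lemma support_pointP p : maximizes p (support_point p).
Proof.
have [_ Kc _] := Kbody.
have [x xK xmax] := @compact_EVT_max _ R (fun x => dot x p) K convex_body_nonempty Kc
  (continuous_subspaceT (@dot_continuous R n.+1 p)).
apply: (@xgetPex _ 0 (maximizes p)); exists x; split; first exact: set_mem.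
by move=> y Ky; apply: xmax; exact: mem_set.
Qed.

Lemma convex_segment x y (s : R) : 0 <= s <= 1 -> K x -> K y -> K (x + s *: (y - x)).
Proof.
move=> s01 Kx Ky; have [Kconv _ _] := Kbody.
have := Kconv y x (Itv01 (andP s01).1 (andP s01).2) (mem_set Ky) (mem_set Kx).
move=> /set_mem; congr K.
change (s *: y + (1 - s) *: x = x + s *: (y - x)).
by rewrite scalerBl scale1r scalerBr addrCA.
Qed.

(** An interior point can be moved a little along p inside K, so p is not constant on K. This later
    fixes the sign of normals. *)
Lemma maximizes_interior p x : p != 0 -> maximizes p x ->
  exists2 y, K y & dot y p < dot x p.
Proof.
move=> p0 [Kx xmax]; have [_ _ [y /nbhs_enormP[d d0 dK]]] := Kbody.
have [t t0 td] := small_multiple p d0.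
exists y; first by apply: dK; rewrite subrr enorm0.
have : K (y + t *: p).
  by apply: dK; rewrite addrC addKr.
move=> /xmax; rewrite dotDl dotZl; apply: lt_le_trans.
by rewrite ltrDl mulr_gt0// dot_gt0.
Qed.

Lemma maximizes_boundary p x : p != 0 -> maximizes p x -> M x.
Proof.
move=> p0 [Kx xmax]; split; first exact: subset_closure.
move=> B /nbhs_enormP[d d0 dB].
have [t t0 td] := small_multiple p d0.
exists (x + t *: p); split; last first.
  by apply: dB; rewrite addrC addKr.
split => // /xmax; rewrite dotDl dotZl gerDl leNgt => /negP; apply.
by rewrite mulr_gt0// dot_gt0.
Qed.

Lemma boundary_sub : M `<=` K.
Proof. by move=> x [+ _]; rewrite -(closure_id _).1//; exact: convex_body_closed. Qed.

Lemma outer_normal_maximizes nu x : K x -> outer_normals K x nu -> maximizes nu x.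
Proof.
move=> Kx [_ nux]; split => // y /nux; rewrite dotC dotBl subr_le0.
by [].
Qed.

Lemma maximizes_normal_field V X u p : C2_chart M V X -> V u ->
  maximizes p (X u) -> normal_field X p u = 0.
Proof.
move=> cX Vu [Kx xmax]; apply: fdiff_max (chart_fdiff cX Vu) _.
have oV : open V by case: cX.
have [d d0 dV] := open_enormP oV Vu; exists d => // a /dV Va.
rewrite dotBl subr_le0; apply: xmax; apply: boundary_sub.
exact: chart_mem cX Va.
Qed.

(** Both p and nu are orthogonal to the tangent hyperplane of a chart at x, hence proportional; a
    point of K at which p is not maximal shows that the factor is positive. *)
Lemma maximizes_normalE x p nu V X u : C2_chart M V X -> V u -> X u = x ->
  p != 0 -> maximizes p x -> outer_normals K x nu -> nu = (enorm p)^-1 *: p.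
Proof.
move=> cX Vu Xu p0 px nux; have [nu1 _] := nux.
have xmax : maximizes nu x by apply: outer_normal_maximizes => //; case: px.
have Xfree : row_free (tangent_frame X u) by case: cX => _ _ _ + _; apply.
have pE : p = dot p nu *: nu.
  apply: (orthogonal_proportional Xfree) => //.
    by apply: maximizes_normal_field cX Vu _; rewrite Xu.
  by apply: maximizes_normal_field cX Vu _; rewrite Xu.
have t0 : 0 < dot p nu.
  have [y Ky yp] := maximizes_interior p0 px.
  have [_ /(_ y Ky)] := xmax; rewrite -subr_le0 -dotBl => ynu.
  rewrite -subr_lt0 -dotBl pE dotZr in yp.
  rewrite ltNge; apply/negP => t0; move: yp; apply/negP; rewrite -leNgt.
  exact: mulr_le0.
by rewrite {2}pE {1}pE enormZ nu1 mulr1 gtr0_norm// scalerA mulVf ?scale1r// gt_eqF.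
Qed.

(** Positivity of the curvature excludes the default value 0 of [xget], so the curvature is realized
    by an actual chart and outer normal. *)
Lemma boundary_chart x : M x -> exists V X u nu,
  [/\ C2_chart M V X, V u, X u = x, outer_normals K x nu &
    curvature_e K x = \det (second_form X nu u) / \det (first_form X u) /\
    0 < \det (second_form X nu u) / \det (first_form X u)].
Proof.
move=> Mx; have [_ /(_ x Mx)] := KC2; rewrite /curvature_e /gauss_kronecker.
case: xgetP => [h -> [V [X [u [nu [cX Vu Xu nux hE]]]]] h0|_]; last by rewrite ltxx.
by exists V, X, u, nu; split => //; rewrite -hE.
Qed.

(* The normal field of a chart vanishes at every maximizer, hence along the
   segment from x to y; it is injective near x, its differential - II being
   invertible. *)
Lemma maximizes_uniq p x y : p != 0 -> maximizes p x -> maximizes p y -> x = y.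
Proof.
move=> p0 px py; have Mx := maximizes_boundary p0 px.
have [V [X [u [nu [cX Vu Xu nux [_ det0]]]]]] := boundary_chart Mx.
have nuE := maximizes_normalE cX Vu Xu p0 px nux.
have nu1 : enorm nu = 1 by case: nux.
have nmax z : maximizes p z -> maximizes nu z.
  move=> [Kz zmax]; split => // w Kw; rewrite nuE !dotZr ler_wpM2l ?zmax//.
  by rewrite invr_ge0 enorm_ge0.
have [oV XC2 _ _ _] := cX.
have IIu : second_form X nu u \in unitmx.
  rewrite unitmxE unitfE; apply/eqP => II0.
  by move: det0; rewrite II0 mul0r ltxx.
have frame_free : row_free (- (second_form X nu u)^T).
  by rewrite row_free_unit -scaleN1r unitmxZ ?unitrN1// unitmx_tr.
have [d d0 dP] := strict_diff_ratio ltr01 frame_free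
  (normal_field_strict_diff nu oV XC2 Vu).
have [d1 d10 d1P] := chart_local cX Vu d0.
apply/eqP; rewrite eq_sym -subr_eq0 -enorm_eq0; apply/negPn/negP => xy0.
have xy : 0 < enorm (y - x) by rewrite lt_def xy0 enorm_ge0.
pose s := Num.min 1 (d1 / enorm (y - x) / 2).
have s0 : 0 < s by rewrite lt_min ltr01 !divr_gt0.
have s01 : 0 <= s <= 1 by rewrite (ltW s0) ge_min lexx.
pose z := x + s *: (y - x).
have pz : maximizes p z.
  split; first by apply: convex_segment => //; [case: px|case: py].
  move=> w /px.2; rewrite /z dotDl dotZl dotBl.
  have -> : dot y p = dot x p.
    by apply/eqP; rewrite eq_le px.2 ?py.2//; [case: px|case: py].
  by rewrite subrr mulr0 addr0.
have zx : enorm (z - X u) < d1.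
  rewrite Xu /z addrC addKr enormZ gtr0_norm// -ltr_pdivlMr//.
  apply: (@le_lt_trans _ _ (d1 / enorm (y - x) / 2)); first by rewrite ge_min lexx orbT.
  by rewrite ltr_pdivrMr// ltr_pMr ?divr_gt0// ltr1n.
have [w [Vw Xw wu]] := d1P z (maximizes_boundary p0 pz) zx.
have uu : enorm (u - u) < d by rewrite subrr enorm0.
have [_] := dP w u wu uu.
rewrite (maximizes_normal_field cX Vw) ?Xw; last exact: nmax.
rewrite (maximizes_normal_field cX Vu) ?Xu; last exact: nmax.
rewrite subrr enorm0 mulr0 -mulmxBl => wu0.
have : (w - u) *m - (second_form X nu u)^T = 0.
  by apply/eqP; rewrite -enorm_eq0 eq_le wu0 enorm_ge0.
rewrite -[RHS](mul0mx _ (- (second_form X nu u)^T)) => /(row_free_inj frame_free) /eqP.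
rewrite subr_eq0 => /eqP wuE; move: Xw; rewrite wuE Xu /z => /esym/eqP.
by rewrite -subr_eq0 addrC addKr scaler_eq0 gt_eqF//= -enorm_eq0 gt_eqF.
Qed.

Lemma support_point_uniq p x : p != 0 -> maximizes p x -> support_point p = x.
Proof. by move=> p0; apply: maximizes_uniq => //; exact: support_pointP. Qed.

Lemma maximizesZ p x a : 0 < a -> maximizes p x -> maximizes (a *: p) x.
Proof.
move=> a0 [Kx xmax]; split => // y Ky.
by rewrite !dotZr ler_pM2l// xmax.
Qed.

Lemma support_pointZ p a : 0 < a -> p != 0 -> support_point (a *: p) = support_point p.
Proof.
move=> a0 p0; apply: support_point_uniq; first by rewrite scaler_eq0 gt_eqF.
by apply: maximizesZ => //; exact: support_pointP.
Qed.

Lemma convex_body_bounded : exists2 B, 0 < B & forall x, K x -> enorm x <= B.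
Proof.
have [_ Kc _] := Kbody.
have [x _ xmax] := compact_EVT_max convex_body_nonempty Kc
  (continuous_subspaceT (@enorm_continuous R n.+1)).
exists (enorm x + 1); first by rewrite ltr_wpDl// enorm_ge0.
by move=> y Ky; apply: (@le_trans _ _ (enorm x)); [apply: xmax; exact: mem_set|rewrite lerDl].
Qed.

(** By uniqueness of the maximizer and compactness, points of K at distance at least e from x(p)
    miss the maximum by a definite gap, and K being bounded, the gap survives a small change of
    p. *)
Lemma support_point_continuous p : p != 0 -> {for p, continuous support_point}.
Proof.
move=> p0; have [Kp pmax] := support_pointP p; apply/continuous_enormP => e e0.
have [_ Kc _] := Kbody.
pose K' := K `&` [set y | e <= enorm (y - support_point p)].
have [K'0|/set0P K'0] := eqVneq K' set0.
  exists 1 => // q _; rewrite ltNge; apply/negP => qe.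
  by have : K' (support_point q) by [split => //; case: (support_pointP q)]; rewrite K'0.
have K'c : compact K'.
  apply: (subclosed_compact _ Kc); last by move=> y [].
  apply: closedI; first exact: convex_body_closed.
  rewrite (_ : mkset _ = [set y | - enorm (y - support_point p) <= - e]); last first.
    by apply/seteqP; split => y /=; rewrite lerN2.
  apply: closed_sublevel => y.
  apply: (@continuousN _ _ _ (fun y : 'rV[R]_n.+1 => enorm (y - support_point p))).
  apply: (@continuous_comp _ _ _ (fun y : 'rV[R]_n.+1 => y - support_point p) (@enorm R n.+1)).
    by apply: continuousB; [exact: id|exact: cst_continuous].
  exact: enorm_continuous.
have [z zK' zmax] := compact_EVT_max K'0 K'c
  (continuous_subspaceT (@dot_continuous R n.+1 p)).
have [Kz ze] : K' z by exact: set_mem.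
have gap : dot z p < dot (support_point p) p.
  rewrite lt_neqAle pmax// andbT; apply/eqP => zp.
  have zmax' : maximizes p z by split => // y Ky; rewrite zp pmax.
  by move: ze => /=; rewrite (support_point_uniq p0 zmax') subrr enorm0 leNgt e0.
have [B B0 KB] := convex_body_bounded.
pose g := dot (support_point p) p - dot z p.
have g0 : 0 < g by rewrite subr_gt0.
exists (g / (2 * B)); first by rewrite divr_gt0// mulr_gt0.
move=> q; rewrite ltr_pdivlMr ?mulr_gt0// => qp.
rewrite ltNge; apply/negP => qe.
have [Kq qmax] := support_pointP q.
have h1 : dot (support_point q) p <= dot z p by apply: zmax; apply: mem_set.
have h2 := qmax _ Kp.
have near y : K y -> `|dot y q - dot y p| <= B * enorm (q - p).
  move=> Ky; rewrite -dotBr; apply: le_trans (cauchy_schwarz _ _) _.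
  by rewrite ler_wpM2r ?enorm_ge0// KB.
have := near _ Kq; have := near _ Kp; rewrite !ler_norml => /andP[a1 a2] /andP[b1 b2].
by move: g0 qp; rewrite /g; lra.
Qed.

End convex_bodies.

(** * Regularity of the support point *)

Section support_point_smoothness.
Context (R : realType) (n : nat) (K : set 'rV[R]_n.+1).
Hypotheses (Kbody : convex_body K) (KC2 : @C2_plus R n.+1 K).
Local Notation M := (boundary setT K).
Local Notation xm := (support_point K).
Implicit Types (p q x y : 'rV[R]_n.+1) (V : set 'rV[R]_n)
  (X : 'rV[R]_n -> 'rV[R]_n.+1) (u w : 'rV[R]_n).

Lemma second_formZ X a p u : second_form X (a *: p) u = a *: second_form X p u.
Proof. by apply/matrixP => i j; rewrite !mxE dotZr mulrN. Qed.

Lemma support_point_boundary p : p != 0 -> M (xm p).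
Proof. by move=> p0; apply: (maximizes_boundary p0); exact: support_pointP. Qed.

Lemma nonzero_near p : p != 0 -> exists2 d, 0 < d & forall q, enorm (q - p) < d -> q != 0.
Proof.
move=> p0; exists (enorm p); first by rewrite enorm_gt0.
move=> q qp; apply/eqP => q0; move: qp; rewrite q0 sub0r enormN ltxx.
by [].
Qed.

Definition support_param V X u q : 'rV[R]_n := xget u [set w | V w /\ X w = xm q].

Lemma support_paramP V X u p : C2_chart M V X -> V u -> X u = xm p -> p != 0 ->
  [/\ support_param V X u p = u, {for p, continuous (support_param V X u)} &
    exists2 d, 0 < d & forall q, enorm (q - p) < d ->
      [/\ q != 0, V (support_param V X u q) & X (support_param V X u q) = xm q]].
Proof.
move=> cX Vu Xu p0.
have phip : support_param V X u p = u.
  rewrite /support_param; case: xgetP => [w _ [Vw Xw]|//].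
  by apply: (chart_inj cX) => //; rewrite Xu.
have near e : 0 < e -> exists2 d, 0 < d & forall q, enorm (q - p) < d ->
   [/\ q != 0, V (support_param V X u q), X (support_param V X u q) = xm q &
     enorm (support_param V X u q - u) < e].
  move=> e0; have [d1 d10 d1P] := chart_local cX Vu e0.
  have /continuous_enormP/(_ _ d10)[d2 d20 d2P] := support_point_continuous Kbody KC2 p0.
  have [d3 d30 d3P] := nonzero_near p0.
  exists (Num.min d2 d3); first by rewrite lt_min d20.
  move=> q; rewrite lt_min => /andP[/d2P + /d3P q0].
  rewrite -Xu => /(d1P _ (support_point_boundary q0))[w [Vw Xw wu]].
  have [Vq Xq] : V (support_param V X u q) /\ X (support_param V X u q) = xm q.
    by apply: (@xgetPex _ u [set w | V w /\ X w = xm q]); exists w.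
  by split => //; rewrite (chart_inj cX Vq Vw)// Xq.
split => //; last by have [d d0 dP] := near 1 ltr01; exists d => // q /dP[].
by apply/continuous_enormP => e /near[d d0 dP]; exists d => // q /dP[]; rewrite phip.
Qed.

Lemma normal_fieldD X p q u : normal_field X (p + q) u = normal_field X p u + normal_field X q u.
Proof. by rewrite /normal_field mulmxDl. Qed.

(* Implicit differentiation of normal_field X q (phi q) = 0. *)
Lemma support_param_fdiff V X u p : C2_chart M V X -> V u -> X u = xm p -> p != 0 ->
  second_form X p u \in unitmx ->
  fdiff (support_param V X u) p
    ((tangent_frame X u)^T *m invmx (second_form X p u)^T).
Proof.
move=> cX Vu Xu p0 IIu; have [oV XC2 _ _ _] := cX.
have [phip phic [d0 d00 phiP]] := support_paramP cX Vu Xu p0.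
set phi := support_param V X u in phip phic phiP *.
set A := tangent_frame X u; set II := second_form X p u.
have IItu : II^T \in unitmx by rewrite unitmx_tr.
set P := invmx II^T.
have [c c0 cP] := enorm_mulmx_le P.
have [k k0 kA] := enorm_mulmx_le A^T.
have nf := strict_diff_fdiff (normal_field_strict_diff p oV XC2 Vu).
have nfu : normal_field X p u = 0.
  by apply: (maximizes_normal_field Kbody cX Vu); rewrite Xu; exact: support_pointP.
have Am : mcont u (fun w => (tangent_frame X w)^T).
  by apply: mcont_tr; apply: mcont_tangent_frame Vu; case: XC2.
(* The normal field is linear in the vector, so its vanishing for q reads n_p(w) + (q - p) A(w)^T =
   0. Replacing n_p(w) by its linear part - (w - u) II^T plus the remainder r and solving for w - u
   gives the identity. *)
have key q w r : normal_field X q w = 0 ->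
    r = normal_field X p w + (w - u) *m II^T ->
    w - u = r *m P + (q - p) *m (tangent_frame X w)^T *m P.
  move=> nfq ->; rewrite -mulmxDl.
  have -> : normal_field X p w + (w - u) *m II^T + (q - p) *m (tangent_frame X w)^T =
      (w - u) *m II^T.
    rewrite addrAC -[X in _ + _ *m X]/(_) -/(normal_field X (q - p) w) -normal_fieldD.
    by rewrite [p + _]addrC subrK nfq add0r.
  by rewrite mulmxK.
(* A preliminary Lipschitz bound: with the constant 1/(2c) the remainder is at most half of the
   distance from phi q to u, and is absorbed in the left side. *)
have [dl dl0 lip] : exists2 d, 0 < d & forall q, enorm (q - p) < d ->
    enorm (phi q - u) <= 2 * (c * (1 + k)) * enorm (q - p).
  have [d1 d10 d1P] := nf (1 / 2 / c) (divr_gt0 (divr_gt0 ltr01 (ltr0Sn R 1)) c0).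
  have [d2 d20 d2P] := mcont_operator ltr01 Am.
  have d120 : 0 < Num.min d1 d2 by rewrite lt_min d10.
  have /continuous_enormP/(_ _ d120)[d3 d30 d3P] := phic.
  exists (Num.min d0 d3); first by rewrite lt_min d00.
  move=> q; rewrite lt_min => /andP[/phiP[q0 Vq Xq] /d3P]; rewrite phip lt_min => /andP[w1 w2].
  have nfq : normal_field X q (phi q) = 0.
    by apply: (maximizes_normal_field Kbody cX Vq); rewrite Xq; exact: support_pointP.
  have r1 := d1P _ w1; rewrite nfu subr0 mulmxN opprK in r1.
  have E := key q (phi q) _ nfq erefl.
  have h1 : enorm (phi q - u) <= c * (1 / 2 / c * enorm (phi q - u)) +
      c * ((1 + k) * enorm (q - p)).
    rewrite {1}E; apply: le_trans (enormD _ _) _; apply: lerD.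
      by apply: le_trans (cP _) _; rewrite ler_wpM2l ?(ltW c0).
    apply: le_trans (cP _) _; rewrite ler_wpM2l ?(ltW c0)//.
    rewrite -[(tangent_frame X (phi q))^T](subrK A^T) mulmxDr mulrDl.
    by apply: le_trans (enormD _ _) _; apply: lerD; [exact: d2P|exact: kA].
  have : c * (1 / 2 / c * enorm (phi q - u)) = 1 / 2 * enorm (phi q - u).
    by rewrite mulrA mulrCA divff ?mulr1// gt_eqF.
  by rewrite mulrA in h1; lra.
pose L := 2 * (c * (1 + k)).
have L0 : 0 < L by rewrite !mulr_gt0// addr_gt0.
move=> e e0.
have [d1 d10 d1P] := nf (e / 2 / (c * L)) (divr_gt0 (divr_gt0 e0 (ltr0Sn R 1)) (mulr_gt0 c0 L0)).
have [d2 d20 d2P] := mcont_operator (divr_gt0 (divr_gt0 e0 (ltr0Sn R 1)) c0) Am.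
have d120 : 0 < Num.min d1 d2 by rewrite lt_min d10.
have /continuous_enormP/(_ _ d120)[d3 d30 d3P] := phic.
exists (Num.min d0 (Num.min d3 dl)); first by rewrite !lt_min d00 d30.
move=> q; rewrite !lt_min => /and3P[/phiP[q0 Vq Xq] /d3P + /lip ql].
rewrite phip lt_min => /andP[w1 w2].
have nfq : normal_field X q (phi q) = 0.
  by apply: (maximizes_normal_field Kbody cX Vq); rewrite Xq; exact: support_pointP.
have r1 := d1P _ w1; rewrite nfu subr0 mulmxN opprK in r1.
have E := key q (phi q) _ nfq erefl.
have -> : phi q - u - (q - p) *m (A^T *m P) =
    (normal_field X p (phi q) + (phi q - u) *m II^T) *m P +
    (q - p) *m ((tangent_frame X (phi q))^T - A^T) *m P.
  by rewrite {1}E mulmxA -addrA mulmxBr [(_ - (q - p) *m A^T) *m P]mulmxBl.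
apply: le_trans (enormD _ _) _.
have h1 : enorm ((normal_field X p (phi q) + (phi q - u) *m II^T) *m P) <=
    e / 2 * enorm (q - p).
  apply: le_trans (cP _) _; apply: le_trans (ler_wpM2l (ltW c0) r1) _.
  apply: (@le_trans _ _ (c * (e / 2 / (c * L) * (L * enorm (q - p))))).
    by rewrite !ler_wpM2l ?(ltW c0)// ltW// !divr_gt0// mulr_gt0.
  rewrite le_eqVlt; apply/orP; left; apply/eqP.
  by rewrite invfM; field; rewrite !gt_eqF.
have h2 : enorm ((q - p) *m ((tangent_frame X (phi q))^T - A^T) *m P) <=
    e / 2 * enorm (q - p).
  apply: le_trans (cP _) _; apply: le_trans (ler_wpM2l (ltW c0) (d2P _ w2 _)) _.
  by rewrite mulrA mulrCA divff ?gt_eqF// mulr1.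
by apply: le_trans (lerD h1 h2) _; rewrite -mulrDl -splitr.
Qed.

Lemma support_point_fdiff V X u p : C2_chart M V X -> V u -> X u = xm p -> p != 0 ->
  second_form X p u \in unitmx ->
  fdiff xm p ((tangent_frame X u)^T *m invmx (second_form X p u)^T *m tangent_frame X u).
Proof.
move=> cX Vu Xu p0 IIu; have [phip _ [d d0 phiP]] := support_paramP cX Vu Xu p0.
apply: (fdiff_near (F := fun q => X (support_param V X u q))).
  by exists d => // q /phiP[].
apply: fdiff_comp; first exact: support_param_fdiff.
by rewrite phip; exact: chart_fdiff cX Vu.
Qed.

Lemma support_chart p : p != 0 -> exists V X u,
  [/\ C2_chart M V X, V u, X u = xm p & second_form X p u \in unitmx].
Proof.
move=> p0; have Mp := support_point_boundary p0.
have [V [X [u [nu [cX Vu Xu nux [_ det0]]]]]] := boundary_chart KC2 Mp.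
exists V, X, u; split => //.
have nuE := maximizes_normalE Kbody cX Vu Xu p0 (support_pointP Kbody p) nux.
have pE : p = enorm p *: nu by rewrite nuE scalerA divff ?scale1r// enorm_eq0.
rewrite pE second_formZ unitmxZ ?unitfE ?enorm_eq0// unitmxE unitfE.
by apply/eqP => II0; move: det0; rewrite II0 mul0r ltxx.
Qed.

Lemma mcont_second_form_param V X u p : C2_chart M V X -> V u -> X u = xm p -> p != 0 ->
  mcont p (fun q => second_form X q (support_param V X u q)).
Proof.
move=> cX Vu Xu p0; have [phip phic _] := support_paramP cX Vu Xu p0.
have [_ [_ XC2] _ _ _] := cX => i j.
have [_ pc] := XC2 i j u Vu; move: pc => /row_mcontP pc.
have -> : (fun q => second_form X q (support_param V X u q) i j) =
   (fun q => \sum_k (- partial j (partial i X) (support_param V X u q) 0 k * q 0 k)).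
  by apply/funext => q; rewrite mxE -sumrN; apply: eq_bigr => k _; rewrite mulNr.
apply: continuous_big_sum => k.
apply: (@continuousM _ _ (fun q => - partial j (partial i X) (support_param V X u q) 0 k)
  (fun q : 'rV[R]_n.+1 => q 0 k)); last exact: coord_continuous.
apply: (@continuousN _ _ _ (fun q => partial j (partial i X) (support_param V X u q) 0 k)).
apply: (@continuous_comp _ _ _ (support_param V X u)
  (fun w => partial j (partial i X) w 0 k)) => //.
by rewrite phip; exact: pc.
Qed.

Lemma mcont_frame_param V X u p : C2_chart M V X -> V u -> X u = xm p -> p != 0 ->
  mcont p (fun q => tangent_frame X (support_param V X u q)).
Proof.
move=> cX Vu Xu p0; have [phip phic _] := support_paramP cX Vu Xu p0 => i j.
have [_ [XC1 _] _ _ _] := cX.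
apply: (@continuous_comp _ _ _ (support_param V X u) (fun w => tangent_frame X w i j)) => //.
by rewrite phip; exact: (mcont_tangent_frame XC1 Vu).
Qed.

Lemma near_continuous (f g : 'rV[R]_n.+1 -> R) p :
  (exists2 d, 0 < d & forall q, enorm (q - p) < d -> f q = g q) ->
  {for p, continuous f} -> {for p, continuous g}.
Proof.
move=> [d d0 fg] fc; have E : f p = g p by apply: fg; rewrite subrr enorm0.
apply/(@cvgrPdist_lt _ _ _ (nbhs p)) => e e0.
have /(@cvgrPdist_lt _ _ _ (nbhs p))/(_ e e0)/nbhs_enormP[d1 d10 d1P] := fc.
apply/nbhs_enormP; exists (Num.min d d1); first by rewrite lt_min d0.
by move=> q; rewrite lt_min => /andP[qd /d1P]; rewrite E fg.
Qed.

Lemma mcont_near k l (F G : 'rV[R]_n.+1 -> 'M[R]_(k, l)) p :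
  (exists2 d, 0 < d & forall q, enorm (q - p) < d -> F q = G q) ->
  mcont p F -> mcont p G.
Proof.
move=> [d d0 FG] Fc i j; apply: (near_continuous (f := fun q => F q i j)) (Fc i j).
by exists d => // q /FG ->.
Qed.

(** A single chart serves all q near p, and there the differential A^T II^(-T) A is a continuous
    function of q. *)
Lemma support_point_C1 p : p != 0 ->
  fdiff xm p (tangent_frame xm p) /\ mcont p (tangent_frame xm).
Proof.
move=> p0; have [V [X [u [cX Vu Xu IIu]]]] := support_chart p0.
have xd := support_point_fdiff cX Vu Xu p0 IIu.
split; first by rewrite (fdiff_tangent_frame xd).
have [phip phic [d d0 phiP]] := support_paramP cX Vu Xu p0.
pose phi := support_param V X u.
have IIc := mcont_second_form_param cX Vu Xu p0.
have Ac := mcont_frame_param cX Vu Xu p0.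
have IItu : (second_form X p (phi p))^T \in unitmx by rewrite unitmx_tr /phi phip.
have [d1 d10 d1P] : exists2 d, 0 < d & forall q, enorm (q - p) < d ->
    second_form X q (phi q) \in unitmx.
  have := mcont_det IIc; rewrite -/phi => dc.
  apply/nbhs_enormP.
  have det0 : \det (second_form X p (phi p)) != 0.
    by rewrite -unitfE -unitmxE -unitmx_tr.
  have /(@cvgrPdist_lt _ _ _ (nbhs p))/(_ `|\det (second_form X p (phi p))|) := dc.
  rewrite normr_gt0 => /(_ det0); apply: filterS => q.
  rewrite unitmxE unitfE => qp; apply/eqP => q0.
  by move: qp; rewrite q0 subr0 ltxx.
apply: (mcont_near (F := fun q => (tangent_frame X (phi q))^T *m
   ((\det (second_form X q (phi q))^T)^-1 *: \adj (second_form X q (phi q))^T) *m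
   tangent_frame X (phi q))).
  exists (Num.min d d1); first by rewrite lt_min d0.
  move=> q; rewrite lt_min => /andP[/phiP[q0 Vq Xq] /d1P IIq].
  rewrite invmxE ?unitmx_tr//; apply/esym/fdiff_tangent_frame.
  exact: (support_point_fdiff cX Vq Xq q0 IIq).
apply: mcont_mul => //; apply: mcont_mul; first exact: mcont_tr.
by apply: mcont_inv => //; exact: mcont_tr.
Qed.

Lemma curvature_chart V X u p : C2_chart M V X -> V u -> X u = xm p -> enorm p = 1 ->
  curvature_e K (xm p) = \det (second_form X p u) / \det (first_form X u).
Proof.
move=> cX Vu Xu p1; have p0 : p != 0 by rewrite -enorm_gt0 p1.
have Mp := support_point_boundary p0; have pmax := support_pointP Kbody p.
have [V' [Y [w [nu [cY V'w Yw nux [-> _]]]]]] := boundary_chart KC2 Mp.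
have nuE := maximizes_normalE Kbody cY V'w Yw p0 pmax nux.
rewrite p1 invr1 scale1r in nuE; rewrite nuE.
apply: (gauss_kronecker_chart_unique cY cX) => //.
- by rewrite Yw.
- by apply: (maximizes_normal_field Kbody cY V'w); rewrite Yw.
- by apply: (maximizes_normal_field Kbody cX Vu); rewrite Xu.
Qed.

Lemma curvature_gt0 p : p != 0 -> 0 < curvature_e K (xm p).
Proof. by move=> p0; have [_] := KC2; apply; exact: support_point_boundary. Qed.

Lemma normalizeE p : p != 0 -> enorm ((enorm p)^-1 *: p) = 1.
Proof.
move=> p0; rewrite enormZ ger0_norm ?invr_ge0 ?enorm_ge0//.
by rewrite mulVf// enorm_eq0.
Qed.

(** The chart formula holds for unit vectors, while x(q) depends on the direction of q only. The
    second form is linear in q, so normalizing q brings in the factor |q|^(-n). *)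
Lemma curvature_continuous p : p != 0 ->
  {for p, continuous (fun q => curvature_e K (xm q))}.
Proof.
move=> p0; have [V [X [u [cX Vu Xu IIu]]]] := support_chart p0.
have [phip phic [d d0 phiP]] := support_paramP cX Vu Xu p0.
pose phi := support_param V X u.
have IIc := mcont_second_form_param cX Vu Xu p0.
have Ac := mcont_frame_param cX Vu Xu p0.
have Ic : mcont p (fun q => tangent_frame X (phi q) *m (tangent_frame X (phi q))^T).
  by apply: mcont_mul => //; exact: mcont_tr.
have Fc : {for p, continuous (fun q => (enorm q)^-1 ^+ n *
   \det (second_form X q (phi q)) * (\det (tangent_frame X (phi q) *m (tangent_frame X (phi q))^T))^-1)}.
  have I0 : \det (tangent_frame X (phi p) *m (tangent_frame X (phi p))^T) != 0.
    rewrite -unitfE -unitmxE /phi phip gram_unit//.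
    by case: cX => _ _ _ + _; apply.
  have ic : {for p, continuous (fun q : 'rV[R]_n.+1 => (enorm q)^-1)}.
    by apply: (cvgV _ (@enorm_continuous R _ p)); rewrite enorm_eq0.
  have ic' : {for p, continuous (fun q : 'rV[R]_n.+1 => (enorm q)^-1 ^+ n)}.
    exact: (@continuous_comp _ _ _ _ (fun t : R => t ^+ n) _ ic (@exprn_continuous R n _)).
  have detIc : {for p, continuous (fun q =>
      (\det (tangent_frame X (phi q) *m (tangent_frame X (phi q))^T))^-1)}.
    by apply: (cvgV _ (mcont_det Ic)).
  exact: (continuousM (continuousM ic' (mcont_det IIc)) detIc).
apply: near_continuous Fc; exists d => // q /phiP[q0 Vq Xq].
have q1 := normalizeE q0.
have xE : xm ((enorm q)^-1 *: q) = xm q.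
  by rewrite support_pointZ// invr_gt0 enorm_gt0.
rewrite -xE (curvature_chart cX Vq)// ?xE// second_formZ detZ first_formE.
by [].
Qed.

End support_point_smoothness.

(** * The dual hypersurface *)

Section row_blocks.
Context (R : realType) (d : nat).
Implicit Types (a b : R) (x y : 'rV[R]_d) (v : 'rV[R]_d.+1).

(** Head and tail are the components along the center of the half-space and in its orthogonal
    complement, in the layout of [polar_point]. *)
Definition vcons a x : 'rV[R]_d.+1 := row_mx a%:M x.
Definition vhead v : R := (lsubmx (v : 'rV_(1 + d))) 0 0.
Definition vtail v : 'rV[R]_d := rsubmx (v : 'rV_(1 + d)).

Lemma vheadK a x : vhead (vcons a x) = a.
Proof. by rewrite /vhead /vcons row_mxKl mxE eqxx mulr1n. Qed.

Lemma vtailK a x : vtail (vcons a x) = x.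
Proof. by rewrite /vtail /vcons row_mxKr. Qed.

Lemma vconsK v : vcons (vhead v) (vtail v) = v.
Proof. by rewrite /vcons /vhead /vtail -mx11_scalar hsubmxK. Qed.

Lemma dot_vcons a b x y : dot (vcons a x) (vcons b y) = a * b + dot x y.
Proof.
have El (c : R) (z : 'rV[R]_d) : vcons c z 0 (@lshift 1 d ord0) = c.
  by rewrite [LHS](row_mxEl (c%:M : 'M[R]_1) z) mxE mulr1n.
have Er (c : R) (z : 'rV[R]_d) (i : 'I_d) : vcons c z 0 (@rshift 1 d i) = z 0 i by exact: row_mxEr.
rewrite /dot (@big_split_ord _ _ _ 1 d) /= big_ord1 !El.
by under eq_bigr => i _ do rewrite !Er.
Qed.

Lemma dot_split v w : dot v w = vhead v * vhead w + dot (vtail v) (vtail w).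
Proof. by rewrite -{1}(vconsK v) -{1}(vconsK w) dot_vcons. Qed.

Lemma vheadB v w : vhead (v - w) = vhead v - vhead w.
Proof. by rewrite /vhead !mxE. Qed.

Lemma vtailB v w : vtail (v - w) = vtail v - vtail w.
Proof. by apply/rowP => i; rewrite !mxE. Qed.

Lemma vtailD v w : vtail (v + w) = vtail v + vtail w.
Proof. by apply/rowP => i; rewrite !mxE. Qed.

Lemma vheadZ c v : vhead (c *: v) = c * vhead v.
Proof. by rewrite /vhead !mxE. Qed.

Lemma vtailZ c v : vtail (c *: v) = c *: vtail v.
Proof. by apply/rowP => i; rewrite !mxE. Qed.

Lemma vcons_inj v w : vhead v = vhead w -> vtail v = vtail w -> v = w.
Proof. by move=> vw0 vw; rewrite -(vconsK v) vw0 vw vconsK. Qed.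

Lemma vconsZ c a x : c *: vcons a x = vcons (c * a) (c *: x).
Proof. by apply: vcons_inj; rewrite ?vheadZ ?vtailZ ?vheadK ?vtailK. Qed.

Lemma vconsB a b x y : vcons a x - vcons b y = vcons (a - b) (x - y).
Proof. by apply: vcons_inj; rewrite ?vheadB ?vtailB ?vheadK ?vtailK. Qed.

Lemma vhead_le v : `|vhead v| <= enorm v.
Proof. by rewrite /vhead mxE; exact: coord_le_enorm. Qed.

Lemma vtail_le v : enorm (vtail v) <= enorm v.
Proof.
rewrite -(ler_pXn2r (ltn0Sn 1)) ?nnegrE ?enorm_ge0// !enorm_sqr (dot_split v).
by rewrite lerDr -expr2 sqr_ge0.
Qed.

Lemma vtailN_continuous : continuous (fun v => - vtail v).
Proof.
move=> v; apply/continuous_enormP => e e0; exists e => // w.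
by rewrite -opprD enormN -vtailB; apply: le_lt_trans; exact: vtail_le.
Qed.

Lemma vhead_continuous : continuous vhead.
Proof.
move=> v; apply/(@cvgrPdist_lt _ _ _ (nbhs v)) => e e0.
apply/nbhs_enormP; exists e => // w.
by rewrite -vheadB enormBC; apply: le_lt_trans; exact: vhead_le.
Qed.

End row_blocks.

Section support_function.
Context (R : realType) (n : nat) (K : set 'rV[R]_n.+1).
Hypotheses (Kbody : convex_body K) (KC2 : @C2_plus R n.+1 K).
Local Notation xm := (support_point K).
Implicit Types (p q x y : 'rV[R]_n.+1).

Definition support_fun p := dot (xm p) p.
Local Notation h := support_fun.

Lemma support_fun_ge p x : K x -> dot x p <= h p.
Proof. by move=> Kx; have [_] := support_pointP Kbody p; exact. Qed.

Lemma support_funZ a p : 0 < a -> p != 0 -> h (a *: p) = a * h p.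
Proof. by move=> a0 p0; rewrite /support_fun support_pointZ// dotZr. Qed.

Lemma support_fun0 : h 0 = 0.
Proof. by rewrite /support_fun dot0r. Qed.

Lemma support_fun_lipschitz : exists2 B, 0 < B &
  (forall p q, `|h p - h q| <= B * enorm (p - q)) /\ (forall x, K x -> enorm x <= B).
Proof.
have [B B0 KB] := convex_body_bounded Kbody; exists B => //; split => // p q.
have le p' q' : h p' - h q' <= B * enorm (p' - q').
  have [Kp _] := support_pointP Kbody p'.
  apply: (@le_trans _ _ (dot (xm p') (p' - q'))).
    by rewrite dotBr lerD2l lerN2; exact: support_fun_ge.
  apply: le_trans (dot_le_enorm _ _) _; rewrite ler_wpM2r ?enorm_ge0//.
  exact: KB.
rewrite ler_norml le andbT lerNl opprB enormBC; exact: le.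
Qed.

Lemma support_fun_continuous : continuous h.
Proof.
have [B B0 [hB _]] := support_fun_lipschitz.
move=> p; apply/(@cvgrPdist_lt _ _ _ (nbhs p)) => e e0.
apply/nbhs_enormP; exists (e / B); first exact: divr_gt0.
move=> q; rewrite ltr_pdivlMr// mulrC => qp.
by apply: le_lt_trans (hB _ _) _; rewrite enormBC.
Qed.

End support_function.

Section dual_hypersurface.
Context (R : realType) (n : nat) (K : set 'rV[R]_n.+1).
Hypotheses (Kbody : convex_body K) (KC2 : @C2_plus R n.+1 K).
Variable lambda : R.
Hypothesis lambda0 : 0 < lambda.
Local Notation xm := (support_point K).
Local Notation h := (support_fun K).
Local Notation kappa := (Num.sqrt lambda).
Local Notation D := (dual lambda (gnomonic_preimage lambda K)).
Local Notation N := (boundary (@sphere R n.+1 lambda) D).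
Implicit Types (p q x y : 'rV[R]_n.+1) (v w : 'rV[R]_n.+2).

Lemma kappa_gt0 : 0 < kappa. Proof. by rewrite sqrtr_gt0. Qed.
Lemma kappa_sqr : kappa ^+ 2 = lambda. Proof. by rewrite sqr_sqrtr// ltW. Qed.
Local Hint Resolve kappa_gt0 : core.

(** With x the gnomonic image of a point of the preimage, that point is the positive multiple cos
    (kappa r) of (1 / kappa, x), so the signs in the definition of the dual can be tested on the
    latter vectors. *)
Lemma dual_memP v : D v <->
  sphere lambda v /\ forall x, K x -> 0 <= dot v (vcons kappa^-1 x).
Proof.
have k0 : kappa != 0 by rewrite gt_eqF.
split=> -[sv vK]; split => //.
  move=> x Kx.
  have [u u1 xu] : exists2 u, enorm u = 1 & x = enorm x *: u.
    have [->|x0] := eqVneq x 0.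
      by exists (delta_mx 0 0); [exact: enorm_delta|rewrite enorm0 scale0r].
    exists ((enorm x)^-1 *: x); first exact: normalizeE.
    by rewrite scalerA divff ?scale1r// enorm_eq0.
  pose r := atan (kappa * enorm x) / kappa.
  have rk : kappa * r = atan (kappa * enorm x) by rewrite mulrCA divff// mulr1.
  have c0 : 0 < cos (kappa * r).
    by apply: cos_gt0_pihalf; rewrite rk atan_gtNpi2 atan_ltpi2.
  have tanE : tan (kappa * r) / kappa = enorm x.
    by rewrite rk atanK mulrAC divff// mul1r.
  have : 0 <= dot v (polar_point lambda r u).
    apply: vK; exists r, u; split => //.
      have a0 : 0 <= atan (kappa * enorm x).
        by rewrite -(@atan0 R) le_atan// mulr_ge0 ?enorm_ge0 ?(ltW kappa_gt0).
      rewrite divr_ge0 ?sqrtr_ge0//= ltr_pdivrMr// invfM -!mulrA mulVf// mulr1.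
      exact: atan_ltpi2.
    by rewrite tanE -xu.
  rewrite (_ : polar_point _ _ _ = cos (kappa * r) *: vcons kappa^-1 x).
    by rewrite dotZr pmulr_rge0.
  rewrite vconsZ -[LHS]/(vcons _ _); congr vcons.
  rewrite xu scalerA -tanE /tan; congr (_ *: _).
  by field; rewrite k0 gt_eqF.
move=> _ [r [u [/andP[r0 rpi] u1 -> Ku]]].
have kr0 : 0 <= kappa * r by rewrite mulr_ge0// ltW.
have krpi : kappa * r < pi / 2.
  by rewrite mulrC -ltr_pdivlMr// -mulrA -invfM.
have c0 : 0 < cos (kappa * r).
  by apply: cos_gt0_pihalf; rewrite krpi andbT; have := pi_gt0 R; lra.
rewrite (_ : polar_point _ _ _ =
    cos (kappa * r) *: vcons kappa^-1 ((tan (kappa * r) / kappa) *: u)).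
  by rewrite dotZr mulr_ge0 ?(ltW c0)//; exact: vK.
rewrite vconsZ -[LHS]/(vcons _ _); congr vcons.
rewrite scalerA /tan; congr (_ *: _).
by field; rewrite k0 gt_eqF.
Qed.

Lemma dual_supportP v : D v <-> sphere lambda v /\ h (- vtail v) <= vhead v / kappa.
Proof.
rewrite dual_memP; split=> -[sv vK]; split => //.
  have [Kx _] := support_pointP Kbody (- vtail v).
  have := vK _ Kx; rewrite dot_split vheadK vtailK /support_fun dotNr (dotC (vtail v)).
  by lra.
move=> x Kx; rewrite dot_split vheadK vtailK.
have := support_fun_ge Kbody (- vtail v) Kx; rewrite dotNr (dotC x).
by lra.
Qed.

Lemma sphere_closed : closed (@sphere R n.+1 lambda).
Proof.
rewrite (_ : sphere lambda = [set v | enorm v <= kappa^-1] `&`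
   [set v : 'rV[R]_n.+2 | - enorm v <= - kappa^-1]).
  apply: closedI; apply: closed_sublevel; first exact: enorm_continuous.
  by move=> v; apply: (@continuousN _ _ _ (@enorm R n.+2)); exact: enorm_continuous.
have ki : lambda^-1 = kappa^-1 ^+ 2 by rewrite exprVn kappa_sqr.
apply/seteqP; split => v /=.
  rewrite /sphere /= -enorm_sqr ki lerN2 => /eqP.
  by rewrite eqrXn2 ?enorm_ge0 ?invr_ge0 ?(ltW kappa_gt0)// => /eqP ->.
rewrite lerN2 => -[v1 v2]; rewrite /sphere /= -enorm_sqr ki; congr (_ ^+ 2).
by apply/eqP; rewrite eq_le v1.
Qed.

(** On the sphere, nonnegative exactly on the dual; its zero set there turns out to be the
    boundary. *)
Definition support_defect v := vhead v / kappa - h (- vtail v).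

Lemma support_defect_continuous : continuous support_defect.
Proof.
move=> v.
have c1 : {for v, continuous (fun v => vhead v / kappa)}.
  apply: (@continuousM _ _ (@vhead R n.+1) (fun=> kappa^-1)).
    exact: vhead_continuous.
  exact: cst_continuous.
have c2 : {for v, continuous (fun v => - h (- vtail v))}.
  apply: (@continuousN _ _ _ (fun v => h (- vtail v))).
  apply: (@continuous_comp _ _ _ (fun v => - vtail v) h); last exact: support_fun_continuous.
  exact: vtailN_continuous.
exact: (@continuousD _ _ _ _ _ _ c1 c2).
Qed.

Lemma dual_boundaryP v : N v <-> sphere lambda v /\ vhead v = kappa * h (- vtail v).
Proof.
have k0 : kappa != 0 by rewrite gt_eqF.
have eqk : vhead v = kappa * h (- vtail v) <-> support_defect v = 0.
  rewrite /support_defect; split=> [->|/eqP].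
    by rewrite mulrAC divff// mul1r subrr.
  by rewrite subr_eq0 => /eqP <-; rewrite mulrCA divff// mulr1.
rewrite eqk; split.
  move=> [clD clS].
  have Dcl : D `<=` sphere lambda `&` [set w | - support_defect w <= 0].
    by move=> w /dual_supportP[sw hw]; split => //=; rewrite oppr_le0 subr_ge0.
  have Scl : sphere lambda `\` D `<=` [set w | support_defect w <= 0].
    move=> w [sw Dw] /=; rewrite subr_le0 leNgt; apply/negP => hw; apply: Dw.
    by apply/dual_supportP; split => //; exact: ltW.
  have [sv v1] : (sphere lambda `&` [set w | - support_defect w <= 0]) v.
    apply: (_ : closure _ `<=` _) clD; rewrite [X in _ `<=` X](closure_id _).1.
      exact: closure_subset.
    apply: closedI; first exact: sphere_closed.
    apply: closed_sublevel => w; apply: (@continuousN _ _ _ support_defect).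
    exact: support_defect_continuous.
  split => //; apply/eqP; rewrite eq_le; apply/andP; split; last by rewrite -oppr_le0.
  apply: (_ : closure _ `<=` [set w | support_defect w <= 0]) clS.
  rewrite [X in _ `<=` X](closure_id _).1; first exact: closure_subset.
  by apply: closed_sublevel; exact: support_defect_continuous.
move=> [sv v0]; split.
  apply: subset_closure; apply/dual_supportP; split => //.
  by rewrite -subr_ge0 -/(support_defect v) v0.
move=> B /nbhs_enormP[d d0 dB].
(* With a zero tail the boundary equation would make the head vanish too, but v has positive
   norm. *)
have tail0 : vtail v != 0.
  apply/eqP => t0; move: v0; rewrite /support_defect t0 oppr0 support_fun0 subr0.
  move=> /eqP; rewrite mulf_eq0 invr_eq0 (negbTE k0) orbF => /eqP h0.
  have : lambda^-1 != 0 by rewrite invr_eq0 gt_eqF.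
  by rewrite -sv dot_split h0 t0 mul0r dot0l addr0 eqxx.
(* Lowering the head and rescaling to the sphere leaves the dual for t > 0 and returns to v as t
   goes to 0, so v is a limit of points outside the dual. *)
pose f t : 'rV[R]_n.+2 := (kappa * enorm (vcons (vhead v - t) (vtail v)))^-1 *:
   vcons (vhead v - t) (vtail v).
have vnorm : kappa * enorm v = 1.
  rewrite /enorm sv sqrtrV ?(ltW lambda0)// divff//.
have f0 : f 0 = v by rewrite /f subr0 vconsK vnorm invr1 scale1r.
have vc0 t : vcons (vhead v - t) (vtail v) != 0.
  by apply/eqP => /(congr1 (@vtail R n.+1)); rewrite vtailK => tl; move: tail0; rewrite tl;
    rewrite /vtail linear0 eqxx.
have fpos t : 0 < (kappa * enorm (vcons (vhead v - t) (vtail v)))^-1.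
  by rewrite invr_gt0 mulr_gt0// enorm_gt0.
have fs t : sphere lambda (f t).
  rewrite /sphere /= -enorm_sqr /f enormZ gtr0_norm// invfM -mulrA mulVf ?mulr1.
    by rewrite exprVn kappa_sqr.
  by rewrite enorm_eq0.
have fn t : 0 < t -> ~ D (f t).
  move=> t0 /dual_supportP[_]; rewrite /f vconsZ vheadK vtailK -scalerN.
  rewrite support_funZ ?oppr_eq0// -mulrA ler_pM2l// leNgt => /negP; apply.
  have : vhead v / kappa = h (- vtail v) by apply/eqP; rewrite -subr_eq0; apply/eqP.
  by move=> <-; rewrite ltr_pM2r ?invr_gt0// gtrBl.
have vcc (t : R) : {for t, continuous (fun t => vcons (vhead v - t) (vtail v))}.
  move=> W /nbhs_enormP[e e0 eW]; apply/nbhs_ballP; exists e => // s ts; apply: eW.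
  rewrite vconsB subrr opprB addrC subrKA.
  rewrite /enorm dot_vcons dot0l addr0 -expr2 sqrtr_sqr.
  by [].
have fc : {for 0, continuous f}.
  apply: cvgZ; last exact: vcc.
  apply: cvgV; first by rewrite mulf_neq0// enorm_eq0.
  apply: cvgM; first exact: cvg_cst.
  exact: (continuous_comp (vcc 0) (@enorm_continuous R n.+2 _)).
have /fc : nbhs (f 0) [set w | enorm (w - v) < d].
  by rewrite f0; apply/nbhs_enormP; exists d.
move=> /nbhs_ballP[e /= e0 eP]; exists (f (e / 2)); split.
  by split; [exact: fs|apply: fn; rewrite divr_gt0].
apply: dB; apply: eP; rewrite /ball /= sub0r normrN gtr0_norm ?divr_gt0//.
by lra.
Qed.

End dual_hypersurface.

(** * Real functions of class C^1 and C^2 with explicit gradients *)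

Section scalar_classes.
Context (R : realType) (m : nat).
Implicit Types (f : 'rV[R]_m -> R) (g : 'I_m -> 'rV[R]_m -> R).
Local Notation e_ i := (delta_mx 0 i : 'rV[R]_m).

(** The partial derivatives are carried as data, so that second order regularity can be read off a
    formula for the first derivatives. No domain appears because the charts of the dual are defined
    on the whole parameter space. *)
Definition gradient f g := continuous f /\
  forall i, continuous (g i) /\ forall u, is_derive u (e_ i) f (g i u).

Definition has_C1 f := exists g, gradient f g.

Definition has_C2 f := exists2 g, gradient f g & forall i, has_C1 (g i).

Lemma gradient_unique f g g' : gradient f g -> gradient f g' -> g = g'.
Proof.
move=> [_ fg] [_ fg']; apply/funext => i; apply/funext => u.
by have [_ /(_ u)[_ <-]] := fg i; have [_ /(_ u)[_ <-]] := fg' i.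
Qed.

Lemma gradient_cst c : gradient (fun=> c) (fun _ _ => 0).
Proof.
split; first by move=> u; exact: cst_continuous.
by move=> i; split; [move=> u; exact: cst_continuous|move=> u; exact: is_derive_cst].
Qed.

Lemma gradientD f f' g g' : gradient f g -> gradient f' g' ->
  gradient (fun u => f u + f' u) (fun i u => g i u + g' i u).
Proof.
move=> [fc fg] [fc' fg']; split.
  by move=> u; exact: (@continuousD _ _ _ _ _ _ (fc u) (fc' u)).
move=> i; have [gc gd] := fg i; have [gc' gd'] := fg' i; split => u.
  exact: (@continuousD _ _ _ _ _ _ (gc u) (gc' u)).
exact: is_deriveD (gd u) (gd' u).
Qed.

Lemma gradientM f f' g g' : gradient f g -> gradient f' g' ->
  gradient (fun u => f u * f' u) (fun i u => f u * g' i u + f' u * g i u).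
Proof.
move=> [fc fg] [fc' fg']; split.
  by move=> u; exact: (continuousM (fc u) (fc' u)).
move=> i; have [gc gd] := fg i; have [gc' gd'] := fg' i; split => u.
  exact: (@continuousD _ _ _ _ _ _ (continuousM (fc u) (gc' u)) (continuousM (fc' u) (gc u))).
exact: is_deriveM (gd u) (gd' u).
Qed.

Lemma gradient_comp f g (phi dphi : R -> R) : gradient f g ->
  (forall u, is_derive (f u) 1 phi (dphi (f u)) /\ {for f u, continuous dphi}) ->
  gradient (fun u => phi (f u)) (fun i u => dphi (f u) * g i u).
Proof.
move=> [fc fg] fphi; split.
  move=> u; apply: (continuous_comp (fc u)).
  apply: differentiable_continuous; apply/derivable1_diffP.
  by case: (fphi u) => -[].
move=> i; have [gc gd] := fg i; split => u.
  exact: (continuousM (continuous_comp (fc u) (fphi u).2) (gc u)).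
exact: is_derive_comp1 (gd u) (fphi u).1.
Qed.

Lemma has_C1_cst c : has_C1 (fun=> c).
Proof. by eexists; exact: gradient_cst. Qed.

Lemma has_C2_C1 f : has_C2 f -> has_C1 f.
Proof. by move=> [g fg _]; exists g. Qed.

Lemma has_C1D f f' : has_C1 f -> has_C1 f' -> has_C1 (fun u => f u + f' u).
Proof. by move=> [g fg] [g' fg']; eexists; exact: gradientD fg fg'. Qed.

Lemma has_C1M f f' : has_C1 f -> has_C1 f' -> has_C1 (fun u => f u * f' u).
Proof. by move=> [g fg] [g' fg']; eexists; exact: gradientM fg fg'. Qed.

Lemma has_C2_cst c : has_C2 (fun=> c).
Proof. by eexists; [exact: gradient_cst|move=> i; exact: has_C1_cst]. Qed.

Lemma has_C2D f f' : has_C2 f -> has_C2 f' -> has_C2 (fun u => f u + f' u).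
Proof.
move=> [g fg gC] [g' fg' gC']; eexists; first exact: gradientD fg fg'.
by move=> i; exact: has_C1D.
Qed.

Lemma has_C2M f f' : has_C2 f -> has_C2 f' -> has_C2 (fun u => f u * f' u).
Proof.
move=> fC fC'; move: (fC) (fC') => [g fg gC] [g' fg' gC'].
eexists; first exact: gradientM fg fg'.
by move=> i; apply: has_C1D; apply: has_C1M => //; exact: has_C2_C1.
Qed.

Lemma has_C2_sum n (F : 'I_n -> 'rV[R]_m -> R) : (forall k, has_C2 (F k)) ->
  has_C2 (fun u => \sum_k F k u).
Proof.
move=> FC; rewrite (_ : (fun u => _) = \sum_k F k); last first.
  by apply/funext => u; rewrite fct_sumE.
elim/big_ind : _ => //; first exact: has_C2_cst.
by move=> f f'; exact: has_C2D.
Qed.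

Lemma is_derive_inv_sqrt (x : R) : 0 < x ->
  is_derive x 1 (fun t => (Num.sqrt t)^-1) (- 2^-1 * (Num.sqrt x)^-1 * x^-1).
Proof.
move=> x0; have sx0 : Num.sqrt x != 0 by rewrite gt_eqF// sqrtr_gt0.
have := is_deriveV sx0 (is_derive1_sqrt x0).
rewrite (_ : _ *: _ = - 2^-1 * (Num.sqrt x)^-1 * x^-1)//.
have -> : x^-1 = (Num.sqrt x ^+ 2)^-1 by rewrite sqr_sqrtr// ltW.
by rewrite /GRing.scale /=; field.
Qed.

Lemma has_C1_inv f : has_C1 f -> (forall u, 0 < f u) -> has_C1 (fun u => (f u)^-1).
Proof.
move=> [g fg] f0; eexists.
apply: (@gradient_comp f g (fun t => t^-1) (fun t => - (t ^+ 2)^-1)) => // u.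
have fu0 : f u != 0 by rewrite gt_eqF.
split.
  have -> : - (f u ^+ 2)^-1 = - (f u) ^- 2 *: (1 : R) by rewrite /GRing.scale /= mulr1.
  exact: (is_deriveV (f := id) fu0 (is_derive_id _ _)).
apply: (@continuousN _ _ _ (fun t : R => (t ^+ 2)^-1)).
apply: (@continuous_comp _ _ _ (fun t : R => t ^+ 2) GRing.inv).
  exact: exprn_continuous.
by apply: inv_continuous; rewrite expf_neq0.
Qed.

Lemma gradient_inv_sqrt f g : gradient f g -> (forall u, 0 < f u) ->
  gradient (fun u => (Num.sqrt (f u))^-1)
    (fun i u => - 2^-1 * (Num.sqrt (f u))^-1 * (f u)^-1 * g i u).
Proof.
move=> fg f0.
apply: (@gradient_comp f g (fun t => (Num.sqrt t)^-1)
  (fun t => - 2^-1 * (Num.sqrt t)^-1 * t^-1)) => // u.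
split; first exact: is_derive_inv_sqrt.
have ic : {for f u, continuous (fun t : R => t^-1)}.
  by apply: inv_continuous; rewrite gt_eqF.
apply: continuousM ic; apply: continuousM; first exact: cst_continuous.
apply: (@continuous_comp _ _ _ Num.sqrt GRing.inv); first exact: sqrt_continuous.
by apply: inv_continuous; rewrite gt_eqF// sqrtr_gt0.
Qed.

Lemma has_C2_inv_sqrt f : has_C2 f -> (forall u, 0 < f u) ->
  has_C2 (fun u => (Num.sqrt (f u))^-1).
Proof.
move=> fC f0; move: (fC) => [g fg gC]; have G := gradient_inv_sqrt fg f0.
exists (fun i u => - 2^-1 * (Num.sqrt (f u))^-1 * (f u)^-1 * g i u) => // i.
apply: has_C1M => //; apply: has_C1M; last by apply: has_C1_inv => //; exact: has_C2_C1.
by apply: has_C1M; [exact: has_C1_cst|eexists; exact: G].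
Qed.

Lemma gradient_is_derive n (Y : 'rV[R]_m -> 'rV[R]_n) G i u :
  (forall j, gradient (fun u => Y u 0 j) (G j)) ->
  is_derive u (e_ i) Y (\row_j G j i u).
Proof.
by move=> YG; apply/is_derive_rowP => j; rewrite mxE; have [_ /(_ i)[_]] := YG j; exact.
Qed.

Lemma gradient_partial n (Y : 'rV[R]_m -> 'rV[R]_n) G i u :
  (forall j, gradient (fun u => Y u 0 j) (G j)) -> partial i Y u = \row_j G j i u.
Proof. by move=> YG; case: (gradient_is_derive i u YG). Qed.

Lemma has_C1_on n (Y : 'rV[R]_m -> 'rV[R]_n) :
  (forall j, has_C1 (fun u => Y u 0 j)) -> C1_on setT Y.
Proof.
move=> /choice[G YG] i u _.
split; first by case: (gradient_is_derive i u YG).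
have -> : partial i Y = (fun w => \row_j G j i w).
  by apply/funext => w; exact: gradient_partial.
apply/row_mcontP => a j; rewrite (_ : (fun y => _) = G j i).
  by have [_ /(_ i)[+ _]] := YG j; exact.
by apply/funext => w; rewrite mxE.
Qed.

Lemma has_C2_on n (X : 'rV[R]_m -> 'rV[R]_n) :
  (forall j, has_C2 (fun u => X u 0 j)) -> C2_on setT X.
Proof.
move=> XC; split; first by apply: has_C1_on => j; exact: has_C2_C1.
move=> i; apply: has_C1_on => j.
have /choice[G XG] : forall j, exists g, gradient (fun u => X u 0 j) g.
  by move=> k; have [g ? _] := XC k; exists g.
have [g Xg gC] := XC j.
rewrite (_ : (fun u => _) = g i)//; apply/funext => u.
by rewrite (gradient_partial i u XG) mxE (gradient_unique (XG j) Xg).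
Qed.

End scalar_classes.

Lemma is_derive_affine (R : realType) m n (f : 'rV[R]_n -> R) (p : 'rV[R]_n)
    (A : 'M[R]_(m, n)) u v df :
  is_derive (p + u *m A) (v *m A) f df -> is_derive u v (fun s => f (p + s *m A)) df.
Proof.
move=> fd; apply: is_derive_from_line.
rewrite (_ : (fun _ => _) = (fun t : R => f (p + u *m A + t *: (v *m A)))).
  by apply: is_derive_line; rewrite scale0r addr0.
by apply/funext => t; rewrite mulmxDl addrA scalemxAl.
Qed.

Lemma is_derive_dot2 (R : realType) m n (X Y : 'rV[R]_m -> 'rV[R]_n) u v dX dY :
  is_derive u v X dX -> is_derive u v Y dY ->
  is_derive u v (fun x => dot (X x) (Y x)) (dot (X u) dY + dot (Y u) dX).
Proof.
move=> /is_derive_rowP Xd /is_derive_rowP Yd.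
have := @is_derive_sum R _ R n (fun i x => X x 0 i * Y x 0 i) u v
  (fun i => X u 0 i *: dY 0 i + Y u 0 i *: dX 0 i).
rewrite (_ : \sum_(i < n) _ = (fun x => dot (X x) (Y x))); last first.
  by apply/funext => x; rewrite fct_sumE.
rewrite (_ : dot _ _ + _ = \sum_(i < n) (X u 0 i *: dY 0 i + Y u 0 i *: dX 0 i)).
  by apply => i; exact: is_deriveM (Xd i) (Yd i).
by rewrite /dot -big_split.
Qed.

Lemma affine_continuous (R : realType) m n (p : 'rV[R]_n) (A : 'M[R]_(m, n)) :
  continuous (fun s : 'rV[R]_m => p + s *m A).
Proof.
move=> s; apply/row_mcontP; apply: mcontD; first exact: mcont_cst.
by apply: mcont_mul; [apply/row_mcontP => B; exact|exact: mcont_cst].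
Qed.

(** * The gradient of the support function *)

Section support_function_derivative.
Context (R : realType) (n : nat) (K : set 'rV[R]_n.+1).
Hypotheses (Kbody : convex_body K) (KC2 : @C2_plus R n.+1 K).
Local Notation xm := (support_point K).
Local Notation h := (support_fun K).

(** Among all support points, x(p) maximizes the product with p, so q = p is a critical point of the
    product of x(q) with p. *)
Lemma support_frame_normal (p : 'rV[R]_n.+1) : p != 0 -> p *m (tangent_frame xm p)^T = 0.
Proof.
move=> p0; have [xd _] := support_point_C1 Kbody KC2 p0.
apply: (fdiff_max xd); exists 1 => // q _; rewrite dotBl subr_le0.
by apply: (support_fun_ge Kbody); have [] := support_pointP Kbody q.
Qed.

(** In the derivative of x(p) . p the variation of x is orthogonal to p and drops out. The gradient
    of h is thus x itself, which makes h of class C^2 although x is only C^1. *)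
Lemma support_fun_is_derive (p v : 'rV[R]_n.+1) : p != 0 -> is_derive p v h (dot (xm p) v).
Proof.
move=> p0; have [xd _] := support_point_C1 Kbody KC2 p0.
have := is_derive_dot2 (fdiff_is_derive v xd) (is_derive_id p v).
by rewrite (dotC p) dot_mulmx support_frame_normal// dot0r addr0.
Qed.

Section affine.
Context (k : nat) (p0 : 'rV[R]_n.+1) (A : 'M[R]_(k, n.+1)).
Hypothesis P0 : forall s, p0 + s *m A != 0.
Local Notation P s := (p0 + s *m A).

Lemma support_point_gradient (v : 'rV[R]_n.+1) :
  gradient (fun s => dot (xm (P s)) v)
    (fun i s => dot (row i A *m tangent_frame xm (P s)) v).
Proof.
split=> [|i].
  move=> s; apply: (@continuous_comp _ _ _ (fun s : 'rV[R]_k => xm (P s)) (fun x : 'rV[R]_n.+1 => dot x v)).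
    apply: (@continuous_comp _ _ _ (fun s : 'rV[R]_k => P s) xm); first exact: affine_continuous.
    exact: support_point_continuous.
  exact: dot_continuous.
split=> s.
  have [_ Tc] := support_point_C1 Kbody KC2 (P0 s).
  have Tc' : mcont s (fun s : 'rV[R]_k => tangent_frame xm (P s)).
    move=> a b; apply: (@continuous_comp _ _ _ (fun s : 'rV[R]_k => P s) (fun q => tangent_frame xm q a b)).
      exact: affine_continuous.
    exact: Tc.
  apply: (@continuous_comp _ _ _ (fun s : 'rV[R]_k => row i A *m tangent_frame xm (P s))
    (fun x : 'rV[R]_n.+1 => dot x v)).
    by apply/row_mcontP; apply: mcont_mul Tc'; exact: mcont_cst.
  exact: dot_continuous.
apply: (is_derive_affine (f := fun q => dot (xm q) v)).
rewrite -rowE; apply: is_derive_dot; apply: fdiff_is_derive.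
by have [] := support_point_C1 Kbody KC2 (P0 s).
Qed.

Lemma support_fun_gradient :
  gradient (fun s => h (P s)) (fun i s => dot (xm (P s)) (row i A)).
Proof.
split=> [|i].
  move=> s; apply: (@continuous_comp _ _ _ (fun s : 'rV[R]_k => P s) h); first exact: affine_continuous.
  exact: support_fun_continuous.
split; first by case: (support_point_gradient (row i A)).
move=> s; apply: is_derive_affine; rewrite -rowE; exact: support_fun_is_derive.
Qed.

Lemma support_fun_has_C2 : has_C2 (fun s => h (P s)).
Proof.
exists (fun i s => dot (xm (P s)) (row i A)); first exact: support_fun_gradient.
by move=> i; eexists; exact: support_point_gradient.
Qed.

Lemma affine_gradient (v : 'rV[R]_n.+1) :
  gradient (fun s => dot (P s) v) (fun i _ => dot (row i A) v).
Proof.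
split=> [s|i].
  apply: (@continuous_comp _ _ _ (fun s : 'rV[R]_k => P s) (fun x : 'rV[R]_n.+1 => dot x v)).
    exact: affine_continuous.
  exact: dot_continuous.
split=> s; first exact: cst_continuous.
apply: (is_derive_affine (f := fun q => dot q v)).
by rewrite -rowE; apply: is_derive_dot; exact: is_derive_id.
Qed.

Lemma affine_has_C2 j : has_C2 (fun s => P s 0 j).
Proof.
rewrite (_ : (fun s => _) = (fun s => dot (P s) (delta_mx 0 j))).
  by eexists; [exact: affine_gradient|move=> i; exact: has_C1_cst].
by apply/funext => s; rewrite dot_delta.
Qed.

Lemma affine_gradient_norm :
  gradient (fun s => dot (P s) (P s)) (fun i s => 2 * dot (P s) (row i A)).
Proof.
split=> [s|i].
  have c : {for s, continuous (fun s : 'rV[R]_k => P s)} by exact: affine_continuous.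
  have -> : (fun s => dot (P s) (P s)) = (fun s => enorm (P s) ^+ 2).
    by apply/funext => s'; rewrite enorm_sqr.
  have c' := continuous_comp c (@enorm_continuous R n.+1 (P s)).
  exact: (@continuous_comp _ _ _ _ (fun t : R => t ^+ 2) _ c' (@exprn_continuous R 2 _)).
split=> s.
  have -> : (fun s => 2 * dot (P s) (row i A)) = (fun s => dot (P s) (2 *: row i A)).
    by apply/funext => s'; rewrite dotZr.
  by have [+ _] := affine_gradient (2 *: row i A); exact.
apply: (is_derive_affine (f := fun q => dot q q)); rewrite -rowE mulr_natl mulr2n.
exact: is_derive_dot2 (is_derive_id _ _) (is_derive_id _ _).
Qed.

Lemma affine_norm_has_C2 : has_C2 (fun s => dot (P s) (P s)).
Proof. by apply: has_C2_sum => j; apply: has_C2M; exact: affine_has_C2. Qed.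

End affine.
End support_function_derivative.

(** * Charts of the dual boundary *)

Section dual_parametrization.
Context (R : realType) (n : nat) (K : set 'rV[R]_n.+1).
Hypotheses (Kbody : convex_body K) (KC2 : @C2_plus R n.+1 K).
Variable lambda : R.
Hypothesis lambda0 : 0 < lambda.
Local Notation xm := (support_point K).
Local Notation h := (support_fun K).
Local Notation kappa := (Num.sqrt lambda).
Local Notation D := (dual lambda (gnomonic_preimage lambda K)).
Local Notation N := (boundary (@sphere R n.+1 lambda) D).
Implicit Types (p q x y : 'rV[R]_n.+1) (v w : 'rV[R]_n.+2).

(** Normalizes for every nonzero p, not just unit vectors; the dual point is then homogeneous of
    degree 0 and can be evaluated on an affine hyperplane instead of the sphere. *)
Definition dual_radius p : R := kappa^-1 * (Num.sqrt (dot p p + lambda * h p ^+ 2))^-1.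

Definition dual_point p : 'rV[R]_n.+2 := dual_radius p *: vcons (kappa * h p) (- p).

Lemma dual_norm_gt0 p : p != 0 -> 0 < dot p p + lambda * h p ^+ 2.
Proof.
by move=> p0; rewrite ltr_pwDl ?dot_gt0// mulr_ge0 ?sqr_ge0// ltW.
Qed.

Lemma dual_radius_gt0 p : p != 0 -> 0 < dual_radius p.
Proof.
move=> p0; rewrite mulr_gt0// invr_gt0 ?(kappa_gt0 lambda0)// sqrtr_gt0.
exact: dual_norm_gt0.
Qed.

Lemma dual_pointZ a p : 0 < a -> p != 0 -> dual_point (a *: p) = dual_point p.
Proof.
move=> a0 p0; rewrite /dual_point /dual_radius support_funZ// dotZl dotZr.
rewrite (_ : a * (a * dot p p) + lambda * (a * h p) ^+ 2 =
   a ^+ 2 * (dot p p + lambda * h p ^+ 2)); last by ring.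
rewrite sqrtrM ?sqr_ge0// sqrtr_sqr gtr0_norm// -scalerN (mulrCA kappa) -vconsZ scalerA.
by congr (_ *: _); rewrite invfM -mulrA mulrAC mulVf ?mul1r// gt_eqF.
Qed.

Lemma dual_point_sphere p : p != 0 -> sphere lambda (dual_point p).
Proof.
move=> p0; have F0 := dual_norm_gt0 p0.
rewrite /sphere /= /dual_point dotZl dotZr dot_vcons dotNl dotNr opprK.
rewrite (_ : kappa * h p * (kappa * h p) + dot p p = dot p p + lambda * h p ^+ 2); last first.
  by rewrite -{3}(kappa_sqr lambda0); ring.
rewrite mulrA -expr2 /dual_radius exprMn !exprVn (kappa_sqr lambda0) sqr_sqrtr ?(ltW F0)//.
by rewrite -mulrA mulVf ?mulr1// gt_eqF.
Qed.

Lemma vhead_dual_point p : vhead (dual_point p) = dual_radius p * (kappa * h p).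
Proof. by rewrite /dual_point vheadZ vheadK. Qed.

Lemma vtail_dual_point p : vtail (dual_point p) = - (dual_radius p *: p).
Proof. by rewrite /dual_point vtailZ vtailK scalerN. Qed.

Lemma dual_point_mem p : p != 0 -> N (dual_point p).
Proof.
move=> p0; apply/(dual_boundaryP Kbody KC2 lambda0); split; first exact: dual_point_sphere.
rewrite vhead_dual_point vtail_dual_point opprK.
by rewrite (support_funZ Kbody KC2) ?dual_radius_gt0// mulrCA.
Qed.

Lemma dual_tail_neq0 v : N v -> vtail v != 0.
Proof.
move=> /(dual_boundaryP Kbody KC2 lambda0)[sv vh]; apply/eqP => t0.
have : lambda^-1 != 0 by rewrite invr_eq0 gt_eqF.
rewrite -sv dot_split vh t0 oppr0 support_fun0 mulr0 mul0r dot0l addr0 eqxx.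
by [].
Qed.

Lemma dual_pointE v : N v -> dual_point (- vtail v) = v.
Proof.
move=> Nv; have := dual_tail_neq0 Nv.
case/(dual_boundaryP Kbody KC2 lambda0): Nv => sv vh t0.
have vv : dot (- vtail v) (- vtail v) + lambda * h (- vtail v) ^+ 2 = lambda^-1.
  rewrite dotNl dotNr opprK -sv [RHS]dot_split vh -{1}(kappa_sqr lambda0); ring.
have r1 : dual_radius (- vtail v) = 1.
  rewrite /dual_radius vv sqrtrV ?(ltW lambda0)// invrK mulVf//.
  by rewrite gt_eqF// (kappa_gt0 lambda0).
by rewrite /dual_point r1 scale1r opprK -vh vconsK.
Qed.

Lemma dual_boundary_sub : N `<=` D.
Proof.
move=> v /(dual_boundaryP Kbody KC2 lambda0)[sv vh].
apply/(dual_supportP Kbody lambda0); split => //.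
by rewrite vh mulrC mulrA mulVf ?mul1r// gt_eqF// (kappa_gt0 lambda0).
Qed.

Section chart.
Variables (p0 : 'rV[R]_n.+1) (A : 'M[R]_(n, n.+1)).
Hypotheses (p01 : enorm p0 = 1) (Afree : row_free A) (pA : p0 *m A^T = 0).
Local Notation P s := (p0 + s *m A).

Lemma dot_frame0 (s : 'rV[R]_n) : dot (s *m A) p0 = 0.
Proof. by rewrite dot_mulmx pA dot0r. Qed.

Lemma dot_p0 : dot p0 p0 = 1.
Proof. by rewrite -enorm_sqr p01 expr1n. Qed.

Lemma dot_affine (s : 'rV[R]_n) : dot (P s) p0 = 1.
Proof. by rewrite dotDl dot_frame0 addr0 dot_p0. Qed.

Lemma affine_neq0 (s : 'rV[R]_n) : P s != 0.
Proof. by apply/eqP => E; have := dot_affine s; rewrite E dot0l => /eqP; rewrite eq_sym oner_eq0. Qed.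

(** The affine hyperplane through p0 orthogonal to p0 represents the directions with positive
    product with p0. Being affine in s, it keeps the derivatives of h along the chart simple. *)
Definition dual_param (s : 'rV[R]_n) := dual_point (P s).

(** Inverse of the central projection: q is scaled onto the hyperplane and its coordinates in the
    frame A are read off by least squares. *)
Definition affine_coord q : 'rV[R]_n := (dot q p0)^-1 *: q *m A^T *m invmx (A *m A^T).

Lemma affine_coordK s : affine_coord (P s) = s.
Proof.
rewrite /affine_coord dot_affine invr1 scale1r mulmxDl pA add0r -mulmxA -mulmxA.
by rewrite (mulmxA A) mulmxV ?mulmx1// gram_unit.
Qed.

Lemma affine_coordE q : dot q p0 != 0 -> P (affine_coord q) = (dot q p0)^-1 *: q.
Proof.
move=> q0; apply/esym/eqP; rewrite -subr_eq0; apply/eqP.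
apply: (orthogonal_eq0 Afree (enorm1_neq0 p01) pA).
  rewrite mulmxBl mulmxDl pA add0r /affine_coord -!mulmxA mulVmx ?gram_unit//.
  by rewrite mulmx1 subrr.
by rewrite dotBl dot_affine dotZl mulVf// subrr.
Qed.

Lemma affine_coordZ a q : a != 0 -> affine_coord (a *: q) = affine_coord q.
Proof.
move=> a0; rewrite /affine_coord dotZl invfM scalerA mulrAC mulVf//.
by rewrite mul1r.
Qed.

Lemma affine_inj : injective (fun s : 'rV[R]_n => P s).
Proof. by move=> s s' /addrI; exact: row_free_inj. Qed.

Lemma affine_coord_continuous q : dot q p0 != 0 -> {for q, continuous affine_coord}.
Proof.
move=> q0; apply/row_mcontP; apply: mcont_mul; last exact: mcont_cst.
apply: mcont_mul; last exact: mcont_cst.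
have c1 : {for q, continuous (fun q => (dot q p0)^-1)}.
  exact: (cvgV q0 (@dot_continuous R n.+1 p0 q)).
apply/row_mcontP; exact: (cvgZ c1 cvg_id).
Qed.

Lemma dual_param_inj : injective dual_param.
Proof.
move=> s s' /(congr1 (@vtail R n.+1)); rewrite !vtail_dual_point => /oppr_inj ss'.
apply: affine_inj => /=; move: (ss') => /(congr1 (fun q => dot q p0)).
rewrite !dotZl !dot_affine !mulr1 => r; move: ss'; rewrite r.
move=> /(congr1 (fun q => (dual_radius (P s'))^-1 *: q)).
by rewrite !scalerA mulVf ?scale1r// gt_eqF// dual_radius_gt0// affine_neq0.
Qed.

Lemma dual_radius_has_C2 : has_C2 (fun s => dual_radius (P s)).
Proof.
have hC := support_fun_has_C2 Kbody KC2 affine_neq0.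
apply: has_C2M; first exact: has_C2_cst.
apply: has_C2_inv_sqrt; last by move=> s; exact/dual_norm_gt0/affine_neq0.
apply: has_C2D; first exact: affine_norm_has_C2.
by apply: has_C2M; [exact: has_C2_cst|exact: has_C2M].
Qed.

Lemma dual_param_has_C2 : C2_on setT dual_param.
Proof.
have hC := support_fun_has_C2 Kbody KC2 affine_neq0.
have rC := dual_radius_has_C2.
apply: has_C2_on => j.
rewrite (_ : (fun s => _) = (fun s => dual_radius (P s) *
    vcons (kappa * h (P s)) (- P s) 0 j)); last first.
  by apply/funext => s; rewrite [LHS]mxE.
apply: has_C2M => //.
have [i ->|i ->] := @split_ordP 1 n.+1 j.
  rewrite (_ : (fun s => _) = (fun s => kappa * h (P s))).
    by apply: has_C2M => //; exact: has_C2_cst.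
  apply/funext => s; rewrite [LHS](row_mxEl ((kappa * h (P s))%:M : 'M[R]_1)).
  by rewrite ord1 mxE mulr1n.
rewrite (_ : (fun s => _) = (fun s => -1 * P s 0 i)).
  by apply: has_C2M; [exact: has_C2_cst|exact: affine_has_C2].
by apply/funext => s; rewrite [LHS]row_mxEr mxE mulN1r.
Qed.

(** [B] is the dual point before normalization, and [C s i] is the i-th partial derivative of [B] at
    s. *)
Let B s := vcons (kappa * h (P s)) (- P s).
Let C s i := vcons (kappa * dot (xm (P s)) (row i A)) (- row i A).

Definition radius_gradient (i : 'I_n) s : R :=
  kappa^-1 * (- 2^-1 * (Num.sqrt (dot (P s) (P s) + lambda * h (P s) ^+ 2))^-1 *
  (dot (P s) (P s) + lambda * h (P s) ^+ 2)^-1 *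
   (2 * dot (P s) (row i A) + lambda * (2 * h (P s) * dot (xm (P s)) (row i A)))).

Lemma radius_gradientP : gradient (fun s => dual_radius (P s)) radius_gradient.
Proof.
have hg := support_fun_gradient Kbody KC2 affine_neq0.
have Fg : gradient (fun s => dot (P s) (P s) + lambda * h (P s) ^+ 2)
    (fun i s => 2 * dot (P s) (row i A) + lambda * (2 * h (P s) * dot (xm (P s)) (row i A))).
  apply: gradientD; first exact: affine_gradient_norm.
  have := gradientM (gradient_cst _ lambda) (gradientM hg hg).
  congr (gradient _ _).
  apply/funext => i; apply/funext => s; ring.
have rg : gradient (fun s => (Num.sqrt (dot (P s) (P s) + lambda * h (P s) ^+ 2))^-1)
    (fun i s => - 2^-1 * (Num.sqrt (dot (P s) (P s) + lambda * h (P s) ^+ 2))^-1 *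
  (dot (P s) (P s) + lambda * h (P s) ^+ 2)^-1 *
   (2 * dot (P s) (row i A) + lambda * (2 * h (P s) * dot (xm (P s)) (row i A)))).
  apply: (gradient_inv_sqrt Fg) => s; exact/dual_norm_gt0/affine_neq0.
have := gradientM (gradient_cst _ kappa^-1) rg.
congr (gradient _ _).
by apply/funext => i; apply/funext => s; rewrite mulr0 addr0.
Qed.

Lemma dual_partial i s :
  partial i dual_param s = radius_gradient i s *: B s + dual_radius (P s) *: C s i.
Proof.
have [_ /(_ i)[_ /(_ s) rd]] := radius_gradientP.
have [_ /(_ i)[_ /(_ s) hd]] := support_fun_gradient Kbody KC2 affine_neq0.
suff [_ <-] : is_derive s (delta_mx 0 i) dual_param
   (radius_gradient i s *: B s + dual_radius (P s) *: C s i) by [].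
apply/is_derive_rowP => j.
rewrite (_ : (fun s => _) = (fun s => dual_radius (P s) * B s 0 j)); last first.
  by apply/funext => s'; rewrite [LHS]mxE.
suff Bd : is_derive s (delta_mx 0 i) (fun s => B s 0 j) (C s i 0 j).
  have := is_deriveM rd Bd; congr (is_derive _ _ _ _).
  by rewrite !mxE addrC [X in _ + X = _]mulrC.
have [k ->|k ->] := @split_ordP 1 n.+1 j.
  rewrite (_ : (fun s => _) = (fun s => kappa * h (P s))); last first.
    apply/funext => s'; rewrite [LHS](row_mxEl ((kappa * h (P s'))%:M : 'M[R]_1)).
    by rewrite ord1 mxE mulr1n.
  rewrite [X in is_derive _ _ _ X](row_mxEl ((kappa * dot (xm (P s)) (row i A))%:M : 'M[R]_1)).
  by rewrite ord1 mxE mulr1n; exact: is_deriveZ.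
rewrite (_ : (fun s => _) = (fun s => dot (P s) (- delta_mx 0 k))); last first.
  by apply/funext => s'; rewrite [LHS]row_mxEr mxE dotNr dot_delta.
rewrite [X in is_derive _ _ _ X]row_mxEr.
have [_ /(_ i)[_ /(_ s)]] := affine_gradient p0 A (- delta_mx 0 k).
by congr (is_derive _ _ _ _); rewrite dotNr mxE dot_delta.
Qed.

(** The tail of a vanishing combination of tangent vectors reads a P(s) + rho v A = 0. Pairing with
    p0 gives a = 0, and the freeness of A gives v = 0. *)
Lemma dual_param_row_free s : row_free (tangent_frame dual_param s).
Proof.
rewrite -kermx_eq0; apply/eqP/row_matrixP => k; rewrite row0.
set v := row k _.
have : v *m tangent_frame dual_param s = 0 by rewrite /v -row_mul mulmx_ker row0.
have -> : v *m tangent_frame dual_param s = \sum_i v 0 i *: partial i dual_param s.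
  rewrite mulmx_sum_row; apply: eq_bigr => i _; congr (_ *: _).
  by apply/rowP => j; rewrite !mxE.
under eq_bigr => i _ do rewrite dual_partial scalerDr scalerA.
rewrite big_split -scaler_suml /= => E.
set a := \sum_i _ in E.
have vt : - (a *: P s + dual_radius (P s) *: (v *m A)) = 0.
  move: E => /(congr1 (@vtail R n.+1)).
  rewrite vtailD vtailZ vtailK => E.
  have E0 : vtail (0 : 'rV[R]_n.+2) = 0 by rewrite /vtail linear0.
  rewrite E0 in E; rewrite -[RHS]E opprD -scalerN; congr (_ + _).
  rewrite (_ : vtail _ = \sum_i v 0 i *: (dual_radius (P s) *: - row i A)).
    rewrite (mulmx_sum_row v A) scaler_sumr -sumrN; apply: eq_bigr => i _.
    by rewrite !scalerN !scalerA mulrC.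
  elim/big_ind2 : _ => //; first by move=> x1 x2 y1 y2 <- <-; rewrite vtailD.
  by move=> i _; rewrite !vtailZ vtailK.
move/eqP: vt; rewrite oppr_eq0 => /eqP vt.
have a0 : a = 0.
  have := congr1 (fun q => dot q p0) vt.
  by rewrite dotDl !dotZl dot_affine dot_frame0 mulr0 addr0 mulr1 dot0l.
move: vt; rewrite a0 scale0r add0r => /eqP; rewrite scaler_eq0.
rewrite gt_eqF ?dual_radius_gt0 ?affine_neq0//= => /eqP vA.
by apply: (row_free_inj Afree); rewrite vA mul0mx.
Qed.

Lemma dual_chart : C2_chart N setT dual_param.
Proof.
split.
- exact: openT.
- exact: dual_param_has_C2.
- by move=> s s' _ _; exact: dual_param_inj.
- by move=> s _; exact: dual_param_row_free.
move=> W oW _.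
pose g v := dot (- vtail v) p0.
have tc := @vtailN_continuous R n.+1.
have gc : continuous g.
  move=> v; apply: (@continuous_comp _ _ _ (fun v => - vtail v) (fun q => dot q p0)).
    exact: tc.
  exact: dot_continuous.
(* The inverse of the chart is explicit and continuous on the open set where the negated tail has
   positive product with p0; this is the homeomorphism clause. *)
exists [set v | 0 < g v /\ W (affine_coord (- vtail v))].
  rewrite openE => v [gv Wv]; rewrite /interior /=.
  have sc : {for v, continuous (fun v => affine_coord (- vtail v))}.
    apply: continuous_comp; first exact: tc.
    by apply: affine_coord_continuous; rewrite gt_eqF.
  have n1 : nbhs v [set w | 0 < g w].
    by apply: (gc v [set x | 0 < x]); apply: open_nbhs_nbhs; split => //; exact: open_gt.
  have n2 : nbhs v [set w | W (affine_coord (- vtail w))].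
    by apply: (sc W); exact: open_nbhs_nbhs.
  exact: filterI n1 n2.
apply/seteqP; split => [_ [s Ws <-]|v [Nv [gv Wv]]].
  have r0 := dual_radius_gt0 (affine_neq0 s).
  split; first exact/dual_point_mem/affine_neq0.
  rewrite /g /dual_param /= vtail_dual_point opprK dotZl dot_affine mulr1; split => //.
  by rewrite affine_coordZ ?gt_eqF// affine_coordK.
exists (affine_coord (- vtail v)) => //.
rewrite /dual_param affine_coordE ?gt_eqF// dual_pointZ ?invr_gt0//; first exact: dual_pointE.
by rewrite oppr_eq0; exact: dual_tail_neq0.
Qed.

End chart.
End dual_parametrization.

(** The matrix determinant lemma, by block elimination. *)
Lemma det_rank1 (R : comNzRingType) n (u : 'cV[R]_n) (w : 'rV[R]_n) :
  \det (1%:M + u *m w) = 1 + (w *m u) 0 0.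
Proof.
have E : block_mx 1%:M 0 w 1%:M *m block_mx (1%:M + u *m w) u 0 1%:M *m
    block_mx 1%:M 0 (- w) 1%:M = block_mx 1%:M u 0 (1%:M + w *m u) :> 'M[R]_(n + 1).
  rewrite !mulmx_block !mul1mx !mul0mx !mulmx1 !mulmx0 !addr0 !add0r !mulmxDr !mulmxDl.
  rewrite !mulmx1 !mul1mx !mulmxN !mulmxA addrK.
  by congr block_mx; [rewrite addrA addrK subrr|rewrite addrC].
have := congr1 determinant E.
rewrite !det_mulmx det_lblock det_ublock det_lblock det_ublock !det1 !mul1r !mulr1 => ->.
by rewrite det_mx11 !mxE.
Qed.

Lemma det_gram_rank1 (R : fieldType) n (G : 'M[R]_n) (xi : 'rV[R]_n) (t : R) :
  G \in unitmx ->
  \det (G + t *: (xi^T *m xi)) = \det G * (1 + t * (xi *m invmx G *m xi^T) 0 0).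
Proof.
move=> Gu; rewrite (_ : G + _ = G *m (1%:M + (t *: (invmx G *m xi^T)) *m xi)); last first.
  by rewrite mulmxDr mulmx1 -scalemxAl -scalemxAr !mulmxA mulmxV// mul1mx.
by rewrite det_mulmx det_rank1 -scalemxAr mulmxA [X in 1 + X]mxE.
Qed.

Lemma mulmx_trE (R : realType) m n (y : 'rV[R]_n) (A : 'M[R]_(m, n)) i :
  (y *m A^T) 0 i = dot y (row i A).
Proof. by rewrite dot_mxE tr_row !mxE; apply: eq_bigr => k _; rewrite !mxE. Qed.

(** * Curvature of the dual boundary *)

Section dual_curvature.
Context (R : realType) (n : nat) (K : set 'rV[R]_n.+1).
Hypotheses (Kbody : convex_body K) (KC2 : @C2_plus R n.+1 K).
Variable lambda : R.
Hypothesis lambda0 : 0 < lambda.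
Local Notation xm := (support_point K).
Local Notation h := (support_fun K).
Local Notation kappa := (Num.sqrt lambda).
Local Notation D := (dual lambda (gnomonic_preimage lambda K)).
Local Notation N := (boundary (@sphere R n.+1 lambda) D).
Local Notation M := (boundary setT K).
Implicit Types (p q x y : 'rV[R]_n.+1) (v w : 'rV[R]_n.+2).

Variables (p0 : 'rV[R]_n.+1) (V : set 'rV[R]_n) (X : 'rV[R]_n -> 'rV[R]_n.+1) (u : 'rV[R]_n).
Hypotheses (p01 : enorm p0 = 1) (cX : C2_chart M V X) (Vu : V u) (Xu : X u = xm p0).
Hypothesis IIu : second_form X p0 u \in unitmx.
(** The tangent frame of the boundary of K at x(p0) spans the orthogonal complement of p0, so it
    also serves as the frame of the dual chart. Both curvatures are thereby expressed through the
    same Gram matrix. *)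
Let A := tangent_frame X u.
Let x0 := xm p0.
(** Duality at the level of normals: z lies on the ray through the spherical preimage of x(p0), and
    its negative, normalized, is the outer normal of the dual at the dual point of p0. *)
Let z := vcons kappa^-1 x0.
Let nu := - (enorm z)^-1 *: z.
Local Notation Y := (dual_param K lambda p0 A).
Local Notation P s := (p0 + s *m A).

Let Afree : row_free A. Proof. by case: cX => _ _ _ + _; apply. Qed.
Let pA : p0 *m A^T = 0.
Proof. by apply: (maximizes_normal_field Kbody cX Vu); rewrite Xu; exact: support_pointP. Qed.
Let p00 : p0 != 0. Proof. exact: enorm1_neq0. Qed.
Let k0 : kappa != 0. Proof. by rewrite gt_eqF// kappa_gt0. Qed.
Let kk : kappa * kappa = lambda. Proof. by rewrite -expr2 kappa_sqr. Qed.
Let cY : C2_chart N setT Y. Proof. exact: dual_chart. Qed.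
Let G := A *m A^T.
Let Gu : G \in unitmx. Proof. exact: gram_unit. Qed.
Let xi := x0 *m A^T.
Let rho := dual_radius K lambda p0.
Let rho0 : 0 < rho. Proof. exact: dual_radius_gt0. Qed.
Let P0 : P (0 : 'rV[R]_n) = p0. Proof. by rewrite mul0mx addr0. Qed.
Let Y0 : Y 0 = dual_point K lambda p0. Proof. by rewrite /dual_param P0. Qed.
Let pA0 i : dot p0 (row i A) = 0.
Proof. by rewrite rowE dotC dot_mulmx pA dot0r. Qed.
Let xiE i : dot x0 (row i A) = xi 0 i.
Proof. by rewrite /xi mulmx_trE. Qed.

Let B := vcons (kappa * h p0) (- p0).
Let C i := vcons (kappa * dot x0 (row i A)) (- row i A).
Let Y0B : Y 0 = rho *: B. Proof. by rewrite Y0. Qed.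
Let dY i : partial i Y 0 = radius_gradient K lambda p0 A i 0 *: B + rho *: C i.
Proof. by rewrite dual_partial// P0. Qed.

Let z_sqr : enorm z ^+ 2 = lambda^-1 * (1 + lambda * enorm x0 ^+ 2).
Proof.
rewrite !enorm_sqr dot_vcons -expr2 exprVn kappa_sqr// mulrDr mulr1 mulrA mulVf ?mul1r//.
by rewrite gt_eqF.
Qed.

Let z_gt0 : 0 < enorm z.
Proof.
rewrite enorm_gt0; apply/eqP => /(congr1 (@vhead R n.+1)); rewrite vheadK.
rewrite /vhead linear0 mxE => /eqP; rewrite invr_eq0; exact/negP.
Qed.

Lemma dual_normal_unique v' : outer_normals D (Y 0) v' -> dot v' (Y 0) = 0 -> v' = nu.
Proof.
move=> [v1 vD] vY.
have vB : dot v' B = 0.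
  by move: vY; rewrite Y0B dotZr => /eqP; rewrite mulf_eq0 gt_eqF//= => /eqP.
have vT : v' *m (tangent_frame Y 0)^T = 0.
  apply: (fdiff_max (chart_fdiff cY I)); exists 1 => // a _; rewrite dotC.
  by apply: vD; apply: dual_boundary_sub => //; exact: chart_mem cY I.
have vC i : dot v' (C i) = 0.
  have : dot v' (partial i Y 0) = 0.
    have := congr1 (fun w : 'rV_n => w 0 i) vT; rewrite mulmx_trE [RHS]mxE => E.
    by rewrite -[RHS]E; congr (dot _ _); apply/rowP => k; rewrite !mxE.
  rewrite dY dotDr !dotZr vB mulr0 add0r => /eqP; rewrite mulf_eq0 gt_eqF//= => /eqP //.
pose al := vhead v'; pose y := vtail v'.
have yE : y = (al * kappa) *: x0.
  apply/eqP; rewrite -subr_eq0; apply/eqP; apply: (orthogonal_eq0 Afree p00 pA).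
    apply/rowP => i; have := vC i; rewrite dot_split vheadK vtailK -/al -/y dotNr => E.
    rewrite mulmx_trE dotBl dotZl mxE; move/eqP: E; rewrite subr_eq0 => /eqP <-; ring.
  have := vB; rewrite dot_split vheadK vtailK -/al -/y dotNr dotBl dotZl => /eqP.
  by rewrite subr_eq0 => /eqP <-; rewrite /support_fun -/x0; ring.
have vE : v' = (al * kappa) *: z.
  by rewrite -(vconsK v') -/al -/y yE /z vconsZ mulfK.
(* The center of the half-space belongs to the dual; testing the normal inequality there fixes the
   sign of the multiple of z. *)
have y0D : D (vcons kappa^-1 0).
  apply/(dual_memP K lambda0); split.
    by rewrite /sphere /= dot_vcons dot0l addr0 -expr2 exprVn kappa_sqr.
  by move=> x Kx; rewrite dot_vcons dot0l addr0 mulr_ge0// invr_ge0 sqrtr_ge0.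
have ak : al * kappa <= 0.
  have := vD _ y0D; rewrite dotBr vY subr0 vE dotZl dot_vcons dot0r addr0.
  by rewrite pmulr_lle0// mulr_gt0// invr_gt0 kappa_gt0.
move: v1; rewrite vE enormZ ler0_norm// => v1.
congr (_ *: _); have z0 := z_gt0.
by apply: (mulIf (lt0r_neq0 z0)); rewrite mulNr mulVf ?gt_eqF// -v1 mulNr opprK.
Qed.

Lemma dual_normal_mem : (outer_normals D (Y 0) `&` [set v' | dot v' (Y 0) = 0]) nu.
Proof.
have z0 := z_gt0.
have zY : dot nu (Y 0) = 0.
  rewrite Y0B dotZl dotZr dot_vcons dotNr mulKf// /support_fun -/x0 subrr.
  by rewrite !mulr0.
split=> //; split.
  by rewrite enormZ normrN gtr0_norm ?invr_gt0// mulVf// gt_eqF.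
move=> y /(dual_memP K lambda0)[_ yD]; rewrite dotBr zY subr0 dotZl mulNr oppr_le0.
rewrite mulr_ge0 ?invr_ge0 ?(ltW z0)// dotC; apply: yD.
by have [] := support_pointP Kbody p0.
Qed.

Lemma curvature_s_forms : curvature_s lambda D (dual_point K lambda p0) =
  \det (second_form Y nu 0) / \det (first_form Y 0).
Proof.
have [nuD nuY] := dual_normal_mem.
rewrite -Y0 /curvature_s /gauss_kronecker.
case: xgetP => [k -> [V' [X' [u' [nu' [cX' Vu' Xu' [nuD' nuY'] ->]]]]]|
    /(_ (\det (second_form Y nu 0) / \det (first_form Y 0)))].
  rewrite (dual_normal_unique nuD' nuY').
  apply: (gauss_kronecker_chart_unique cX' cY) => //.
    have : nu *m (tangent_frame X' u')^T = 0; last by [].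
    apply: (fdiff_max (chart_fdiff cX' Vu')).
    have [d d0 dV] := open_enormP (let: And5 o _ _ _ _ := cX' in o) Vu'.
    exists d => // a ad; rewrite dotC Xu'; apply: nuD.2.
    by apply: dual_boundary_sub => //; apply: chart_mem cX' _; exact: dV.
  apply: (fdiff_max (chart_fdiff cY I)); exists 1 => // a _; rewrite dotC.
  by apply: nuD.2; apply: dual_boundary_sub => //; exact: chart_mem cY I.
move=> H; exfalso; apply: H.
by exists setT, Y, 0, nu; split => //; exact: dual_normal_mem.
Qed.

Let F0 := 1 + lambda * h p0 ^+ 2.

Let F0E : dot p0 p0 + lambda * h p0 ^+ 2 = F0.
Proof. by rewrite dot_p0. Qed.

Let F0_gt0 : 0 < F0.
Proof. by rewrite -F0E; exact: dual_norm_gt0. Qed.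

Lemma radius_gradient0 i :
  radius_gradient K lambda p0 A i 0 = - rho * F0^-1 * (lambda * h p0 * xi 0 i).
Proof.
rewrite /radius_gradient P0 pA0 -/x0 xiE mulr0 add0r /rho /dual_radius !F0E.
by field; rewrite k0 !gt_eqF ?sqrtr_gt0 ?F0_gt0.
Qed.

(** The heads contribute [lambda] xi^T xi to the Gram matrix, and the derivative of the normalizing
    radius subtracts lambda^2 h^2 / F0 times the same matrix; the difference of coefficients is
    lambda / F0. *)
Lemma dual_first_form : first_form Y 0 =
  rho ^+ 2 *: (G + (lambda / F0) *: (xi^T *m xi)).
Proof.
apply/matrixP => i j; rewrite [LHS]mxE !dY !radius_gradient0.
have -> : (rho ^+ 2 *: (G + (lambda / F0) *: (xi^T *m xi))) i j =
    rho ^+ 2 * (dot (row i A) (row j A) + lambda / F0 * (xi 0 i * xi 0 j)).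
  rewrite [LHS]mxE [X in _ * X]mxE; congr (_ * (_ + _)).
    by rewrite -mulmx_trE -row_mul [RHS]mxE.
  rewrite [LHS]mxE; congr (_ * _).
  by rewrite [LHS]mxE big_ord1; congr (_ * _); rewrite [LHS]mxE.
rewrite dotDl !dotDr !dotZl !dotZr !dot_vcons !dotNl !dotNr !opprK.
rewrite (dotC (row i A) p0) !pA0 dot_p0// !xiE !addr0; set d := dot _ _.
have kkE a b : kappa * a * (kappa * b) = lambda * (a * b) by rewrite mulrACA kk.
rewrite !kkE.
have F0n : F0 != 0 by rewrite gt_eqF// F0_gt0.
by move: F0n; rewrite /F0 => F0n; field.
Qed.

(** No second derivative of the chart is computed. The product of its i-th partial derivative with
    the fixed normal is a combination of k and l i, which vanish at 0 together with the gradient of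
    k. Only the derivative of l i survives, that is, the differential of x. *)
Lemma dual_second_form : second_form Y nu 0 =
  (rho / enorm z) *: (G *m invmx (second_form X p0 u)^T *m G)^T.
Proof.
have Pn0 := affine_neq0 p01 pA.
have nuE v : dot v nu = - (enorm z)^-1 * dot v z by rewrite dotZr.
have xT : tangent_frame xm p0 = A^T *m invmx (second_form X p0 u)^T *m A.
  by apply: fdiff_tangent_frame; exact: (support_point_fdiff Kbody KC2 cX Vu Xu p00 IIu).
have [rg rgP rgC] := dual_radius_has_C2 Kbody KC2 lambda0 p01 pA.
have rgE := gradient_unique rgP (radius_gradientP Kbody KC2 lambda0 p01 pA).
pose k s := h (P s) - dot (P s) x0.
pose l i s := dot (xm (P s)) (row i A) - dot (row i A) x0.
have gE i : (fun s => dot (partial i Y s) nu) =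
    (fun s => - (enorm z)^-1 * (rg i s * k s + dual_radius K lambda (P s) * l i s)).
  apply/funext => s; rewrite nuE dual_partial// -rgE; congr (_ * _).
  rewrite dotDl !dotZl !dot_vcons !dotNl.
  by rewrite ![_ / kappa]mulrC !mulKf.
have k00 : k 0 = 0 by rewrite /k P0 /support_fun dotC subrr.
have l00 i : l i 0 = 0 by rewrite /l P0 dotC subrr.
apply/matrixP => i j; rewrite [LHS]mxE.
pose ej := delta_mx 0 j : 'rV[R]_n.
have Yd : is_derive 0 ej (fun s => dot (partial i Y s) nu) (dot (partial j (partial i Y) 0) nu).
  apply: is_derive_dot; apply: DeriveDef => //.
  by have [_ /(_ i j 0 I)[]] := dual_param_has_C2 Kbody KC2 lambda0 p01 pA.
have kd : is_derive 0 ej k 0.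
  have [_ /(_ j)[_ /(_ 0) d1]] := support_fun_gradient Kbody KC2 Pn0.
  have [_ /(_ j)[_ /(_ 0) d2]] := affine_gradient p0 A x0.
  have := is_deriveB d1 d2.
  by rewrite P0 dotC subrr.
have ld : is_derive 0 ej (l i) (dot (row j A *m tangent_frame xm p0) (row i A)).
  have [_ /(_ j)[_ /(_ 0) d1]] := support_point_gradient Kbody KC2 Pn0 (row i A).
  have := is_deriveB d1 (is_derive_cst (dot (row i A) x0) _ _).
  by rewrite P0 subr0.
have [g' [_ /(_ j)[_ /(_ 0) rgd]]] := rgC i.
have [_ /(_ j)[_ /(_ 0) rd]] := rgP.
have := is_deriveM (is_derive_cst (- (enorm z)^-1) 0 ej) (is_deriveD (is_deriveM rgd kd) (is_deriveM rd ld)).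
rewrite k00 l00 P0 !scale0r !scaler0 !addr0 add0r => Yd'.
move: Yd; rewrite gE => -[_ <-].
rewrite (@derive_val _ _ _ _ _ _ _ Yd') [RHS]mxE [X in _ = _ * X]mxE.
rewrite (_ : (G *m _ *m G) j i = dot (row j A *m tangent_frame xm p0) (row i A)); last first.
  by rewrite -mulmx_trE xT -!row_mul [RHS]mxE /G !mulmxA.
by rewrite /GRing.scale /= -/rho; ring.
Qed.

(** The left side is the squared length of the orthogonal projection q of x0 onto the row space of
    A, and x0 = h p0 + q is an orthogonal decomposition. *)
Lemma frame_norm : (xi *m invmx G *m xi^T) 0 0 = enorm x0 ^+ 2 - h p0 ^+ 2.
Proof.
set q := xi *m invmx G *m A.
have qE : x0 = h p0 *: p0 + q.
  apply/eqP; rewrite -subr_eq0; apply/eqP; apply: (orthogonal_eq0 Afree p00 pA).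
    by rewrite mulmxBl mulmxDl -scalemxAl pA scaler0 add0r /q -!mulmxA mulVmx// mulmx1 subrr.
  rewrite dotBl dotDl dotZl dot_p0// mulr1 dot_mulmx pA dot0r addr0.
  by rewrite /support_fun -/x0 subrr.
have -> : (xi *m invmx G *m xi^T) 0 0 = dot x0 q.
  by rewrite /q dotC dot_mulmx -/xi dot_mxE.
have pq : dot p0 q = 0 by rewrite dotC dot_mulmx pA dot0r.
rewrite enorm_sqr {2 3}qE dotDl !dotDr !dotZl !dotZr pq (dotC q p0) pq dot_p0//.
rewrite {1}qE dotDl dotZl pq; ring.
Qed.

(** The second form contributes det(G)^2 / det(II), and the first form det(G) times E / F0 by the
    rank-one determinant formula. The quotient contains det(G) / det(II), the reciprocal of the
    curvature of K; the powers of [rho] and of the norm of z supply the rest. *)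
Lemma dual_curvature_chart : curvature_s lambda D (dual_point K lambda p0) =
  lambda ^+ n * (curvature_e K (xm p0))^-1 *
  (Num.sqrt (1 + lambda * h p0 ^+ 2) / Num.sqrt (1 + lambda * enorm (xm p0) ^+ 2)) ^+ n.+2.
Proof.
rewrite curvature_s_forms dual_second_form dual_first_form.
rewrite (curvature_chart Kbody KC2 cX Vu Xu p01) first_formE -/A -/G.
rewrite detZ det_tr !det_mulmx det_inv det_tr detZ (det_gram_rank1 _ _ Gu) frame_norm -/x0.
rewrite -/F0; set g := \det G; set b := \det _.
have g0 : g != 0 by rewrite -unitfE -unitmxE.
have b0 : b != 0 by rewrite -unitfE -unitmxE.
have F00 := F0_gt0; set E := 1 + lambda * enorm x0 ^+ 2.
have E0 : 0 < E by rewrite ltr_pwDl// mulr_ge0 ?sqr_ge0// ltW.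
have sF : Num.sqrt F0 != 0 by rewrite gt_eqF// sqrtr_gt0.
have sE : Num.sqrt E != 0 by rewrite gt_eqF// sqrtr_gt0.
have zE : enorm z = kappa^-1 * Num.sqrt E.
  rewrite -[enorm z]ger0_norm ?enorm_ge0// -sqrtr_sqr z_sqr -/E sqrtrM ?invr_ge0 ?(ltW lambda0)//.
  by rewrite sqrtrV// ltW.
have rhoE : rho = kappa^-1 * (Num.sqrt F0)^-1 by rewrite /rho /dual_radius F0E.
have -> : 1 + lambda / F0 * (enorm x0 ^+ 2 - h p0 ^+ 2) = Num.sqrt E ^+ 2 / Num.sqrt F0 ^+ 2.
  rewrite (sqr_sqrtr (ltW E0)) (sqr_sqrtr (ltW F00)).
  have fld (s t l : R) : 1 + l * t ^+ 2 != 0 ->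
      1 + l / (1 + l * t ^+ 2) * (s ^+ 2 - t ^+ 2) = (1 + l * s ^+ 2) / (1 + l * t ^+ 2).
    by move=> st0; field.
  exact: fld (lt0r_neq0 F00).
have lE : lambda ^+ n = kappa ^+ n * kappa ^+ n by rewrite -exprMn kk.
rewrite zE rhoE lE.
move: (Num.sqrt F0) (Num.sqrt E) kappa sF sE k0 => sf se ka sf0 se0 ka0.
rewrite -exprM mulnC exprM !exprS !expr_div_n !exprMn !exprVn.
move: (sf ^+ n) (se ^+ n) (ka ^+ n) (expf_neq0 n sf0) (expf_neq0 n se0) (expf_neq0 n ka0).
move=> sfn sen kan sfn0 sen0 kan0.
by field; rewrite ?g0 ?b0 ?sf0 ?se0 ?ka0 ?sfn0 ?sen0 ?kan0.
Qed.

End dual_curvature.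

Lemma dual_curvature (R : realType) n (K : set 'rV[R]_n.+1) (lambda : R) (p : 'rV[R]_n.+1) :
  convex_body K -> @C2_plus R n.+1 K -> 0 < lambda -> enorm p = 1 ->
  curvature_s lambda (dual lambda (gnomonic_preimage lambda K)) (dual_point K lambda p) =
  lambda ^+ n * (curvature_e K (support_point K p))^-1 *
  (Num.sqrt (1 + lambda * support_fun K p ^+ 2) /
   Num.sqrt (1 + lambda * enorm (support_point K p) ^+ 2)) ^+ n.+2.
Proof.
move=> Kbody KC2 lambda0 p1.
have [V [X [u [cX Vu Xu IIu]]]] := support_chart Kbody KC2 (enorm1_neq0 p1).
exact: dual_curvature_chart p1 cX Vu Xu IIu.
Qed.

(** * Integrals over the unit sphere *)

Lemma within_continuous_near (R : realType) p (S : set 'rV[R]_p) (f : 'rV[R]_p -> R) a e :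
  {within S, continuous f} -> S a -> 0 < e ->
  exists W, [/\ open W, W a & forall b, S b -> W b -> `|f b - f a| <= e].
Proof.
move=> /subspace_continuousP fc Sa e0.
have nb : nbhs (f a) [set y | `|y - f a| <= e].
  by apply/nbhs_ballP; exists e => // y; rewrite /ball /= distrC => /ltW.
have : within S (nbhs a) [set b | `|f b - f a| <= e] := fc a Sa _ nb.
rewrite /within /= nbhsE => -[W [oW Wa] WP].
by exists W; split => // b Sb Wb; exact: WP.
Qed.

Lemma within_continuous_image (T U V : topologicalType) (S : set T) (f : T -> U) (g : U -> V) :
  {within S, continuous f} -> {within f @` S, continuous g} ->
  {within S, continuous (fun x => g (f x))}.
Proof.
move=> /subspace_continuousP fc /subspace_continuousP gc; apply/subspace_continuousP => a Sa.
have fSa : (f @` S) (f a) by exists a.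
move=> W gfW.
have gW : nbhs (f a) [set y | (f @` S) y -> W (g y)] := gc _ fSa W gfW.
have fW : nbhs a [set b | S b -> (f @` S) (f b) -> W (g (f b))] := fc a Sa _ gW.
apply: (@filterS _ (nbhs a) _ _ _ _ fW) => b fb Sb; apply: fb => //; exists b.
Qed.

Section change_of_variables.
Context (R : realType) (m p q : nat).
Variables (S : set 'rV[R]_p) (Phi : 'rV[R]_p -> 'rV[R]_q) (J : 'rV[R]_p -> R).
Local Notation N := (Phi @` S).

(** A Jacobian stated without derivatives or integrals: up to 1 + e, the measures of all small
    pieces of S and of their images have ratio j. *)
Definition has_jacobian a (j : R) := forall e, 0 < e ->
  exists W, [/\ open W, W a & forall B : set 'rV[R]_p, B `<=` S `&` W ->
    (hausdorff m (Phi @` B) <= ((1 + e) * j)%:E * hausdorff m B)%E /\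
    (j%:E * hausdorff m B <= (1 + e)%:E * hausdorff m (Phi @` B))%E].

Hypotheses (Scompact : compact S) (Phi_cont : {within S, continuous Phi})
  (Phi_inj : set_inj S Phi) (Sfin : (hausdorff m S < +oo)%E)
  (J_cont : {within S, continuous J}) (J_ge0 : forall a, S a -> 0 <= J a)
  (jacobianP : forall a, S a -> has_jacobian a (J a)).

Lemma jacobian_image_fin : (hausdorff m N < +oo)%E.
Proof.
apply: finite_measure_image => // a Sa.
have [W [oW Wa WB]] := jacobianP Sa ltr01.
exists W, ((1 + 1) * J a); split => //; first by rewrite mulr_ge0// J_ge0.
by move=> B /WB[].
Qed.

(** The transfer estimate with c = 1 holds for every small e with one constant C, so the two
    integrals coincide. *)
Lemma change_of_variables (g : 'rV[R]_q -> R) : {within N, continuous g} ->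
  {within S, continuous (fun x => g (Phi x) * J x)} ->
  hausdorff_integral m N g = hausdorff_integral m S (fun x => g (Phi x) * J x).
Proof.
move=> gc gJc.
have bounded n (A : set 'rV[R]_n) (h : 'rV[R]_n -> R) : compact A ->
    {within A, continuous h} -> exists M, forall x, A x -> `|h x| <= M.
  move=> cA ch; have [M [_ hM]] := compact_bounded (continuous_compact ch cA).
  exists (M + 1) => x Ax; apply: (hM (M + 1)); first by rewrite ltrDl.
  by exists x.
have [K1 JK] := bounded _ _ _ Scompact J_cont.
have [K2 gK] := bounded _ _ _ (image_compact Scompact Phi_cont) gc.
pose K := Num.max K1 K2; pose C := (1 + 2 * K + 2 * K ^+ 2) * fine (hausdorff m S).
have est e : 0 < e <= 1 -> `|hausdorff_integral m S (fun x => g (Phi x) * J x) -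
    1 * hausdorff_integral m N g| <= e * C.
  move=> /andP[e0 e1]; rewrite /C mulrA.
  apply: transfer_estimate => //; first by rewrite e0.
    exact: jacobian_image_fin.
  move=> a Sa; have [W1 [oW1 W1a W1P]] := jacobianP Sa e0.
  have [W2 [oW2 W2a W2P]] := within_continuous_near gJc Sa e0.
  have [W3 [oW3 W3a W3P]] : exists W, [/\ open W, W a &
      forall b, S b -> W b -> `|g (Phi b) - g (Phi a)| <= e].
    apply: (within_continuous_near (f := fun b => g (Phi b))) => //.
    exact: within_continuous_image gc.
  exists (W1 `&` W2 `&` W3), (J a), (g (Phi a)); split.
  - by apply: openI => //; exact: openI.
  - by [].
  - by rewrite J_ge0//= le_max (le_trans (ler_norm _) (JK _ Sa)).
  - by rewrite le_max orbC gK//; exists a.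
  split=> [B BSW|b Sb [[Wb1 Wb2] Wb3]]; last by split; [exact: W2P|exact: W3P].
  have [|h1 h2] := W1P B; first by move=> x /BSW[Sx [[]]].
  by rewrite mul1e mulr1.
apply/eqP; rewrite eq_sym -subr_eq0 -normr_le0; apply/ler_addgt0Pr => e e0; rewrite add0r.
have C0 : 0 <= `|C| + 1 by rewrite addr_ge0.
have k0 : 0 < Num.min 1 (e / (`|C| + 1)) <= 1.
  by rewrite lt_min ltr01 ge_min lexx/= andbT divr_gt0// ltr_wpDl.
have := est _ k0; rewrite mul1r => /le_trans; apply.
apply: (@le_trans _ _ (e / (`|C| + 1) * (`|C| + 1))); last by rewrite divfK// gt_eqF// ltr_wpDl.
have [/andP[k1 k2]] := k0; apply: (@le_trans _ _ (Num.min 1 (e / (`|C| + 1)) * (`|C| + 1))).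
  by rewrite ler_wpM2l ?(ltW k1)// ler_wpDr// ler_norm.
by rewrite ler_wpM2r// ge_min lexx orbT.
Qed.

End change_of_variables.

(** A continuous map on a compact set is closed, hence a quotient map onto its image. *)
Lemma within_continuous_factor (R : realType) p q (S : set 'rV[R]_p)
    (Phi : 'rV[R]_p -> 'rV[R]_q) (g : 'rV[R]_q -> R) :
  compact S -> {within S, continuous Phi} ->
  {within S, continuous (fun x => g (Phi x))} -> {within Phi @` S, continuous g}.
Proof.
move=> Sc Phic gc; apply/continuous_closedP => D cD.
have Sclosed := compact_rV_closed Sc.
apply/closed_subspaceP; exists (Phi @` (S `&` (fun x => g (Phi x)) @^-1` D)).
  apply: compact_rV_closed; apply: continuous_compact.
    by apply: continuous_subspaceW Phic => x [].
  apply: (subclosed_compact _ Sc); last by move=> x [].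
  exact: closed_level.
apply/seteqP; split => [_ [[x [Sx Dx] <-] _]|y [Dy [x Sx xy]]]; first by split => //; exists x.
by subst y; split; exists x.
Qed.

Lemma lee_cancel_scale (R : realType) (a k : R) (x y : \bar R) : 0 < a ->
  (a%:E * x <= (a * k)%:E * y)%E -> (x <= k%:E * y)%E.
Proof.
move=> a0 /(lee_wpmul2l (x := a^-1%:E)); rewrite lee_fin invr_ge0 (ltW a0) => /(_ isT).
by rewrite !muleA -!EFinM mulrA mulVf ?gt_eqF// mul1r mul1e.
Qed.

Section sphere_param.
Context (R : realType) (n : nat) (p0 : 'rV[R]_n.+1) (A : 'M[R]_(n, n.+1)).
Hypotheses (p01 : enorm p0 = 1) (Afree : row_free A) (pA : p0 *m A^T = 0).
Local Notation P s := (p0 + s *m A).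

Definition sphere_param (s : 'rV[R]_n) := (enorm (P s))^-1 *: P s.

Lemma enorm_sphere_param s : enorm (sphere_param s) = 1.
Proof. by apply: normalizeE; exact: affine_neq0. Qed.

Lemma sphere_param_coord p : enorm p = 1 -> 0 < dot p p0 ->
  sphere_param (affine_coord p0 A p) = p.
Proof.
move=> p1 pp; rewrite /sphere_param affine_coordE ?gt_eqF//.
rewrite enormZ p1 mulr1 gtr0_norm ?invr_gt0// invrK scalerA divff ?scale1r//.
by rewrite gt_eqF.
Qed.

Lemma affine_coord_base : affine_coord p0 A p0 = 0.
Proof. by rewrite -[X in affine_coord _ _ X](addr0 p0) -[X in _ + X](mul0mx _ A) affine_coordK. Qed.

Lemma affine_coord_open (W : set 'rV[R]_n) : open W ->
  open [set q | 0 < dot q p0 /\ W (affine_coord p0 A q)].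
Proof.
move=> oW; rewrite openE => q [q0 Wq]; rewrite /interior /=.
have n1 : nbhs q [set w | 0 < dot w p0].
  apply: (@dot_continuous R n.+1 p0 q [set x | 0 < x]).
  by apply: open_nbhs_nbhs; split => //; exact: open_gt.
have n2 : nbhs q [set w | W (affine_coord p0 A w)].
  have sc : {for q, continuous (affine_coord p0 A)}.
    by apply: affine_coord_continuous; rewrite gt_eqF.
  by apply: (sc W); exact: open_nbhs_nbhs.
exact: filterI n1 n2.
Qed.

(** The derivative of the norm of P(s) at 0 is the product of p0 with the rows of A, which vanishes,
    so normalization does not alter the differential A. *)
Lemma sphere_param_strict_diff : strict_diff sphere_param 0 A.
Proof.
have Pn s : 0 < dot (P s) (P s) by rewrite dot_gt0 affine_neq0.
have P0 : P (0 : 'rV[R]_n) = p0 by rewrite mul0mx addr0.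
have rg := gradient_inv_sqrt (affine_gradient_norm p0 A) Pn.
have cg j := gradientM rg (affine_gradient p0 A (delta_mx 0 j)).
have E j : (fun s => sphere_param s 0 j) = (fun s => (Num.sqrt (dot (P s) (P s)))^-1 *
    dot (P s) (delta_mx 0 j)).
  by apply/funext => s; rewrite [LHS]mxE dot_delta.
have C1 : C1_on setT sphere_param.
  by apply: has_C1_on => j; rewrite E; eexists; exact: cg.
rewrite (_ : A = tangent_frame sphere_param 0); first exact: C1_strict_diff openT C1 I.
apply/matrixP => i j; rewrite mxE.
pose G j := (fun i s => (Num.sqrt (dot (P s) (P s)))^-1 * dot (row i A) (delta_mx 0 j) +
  dot (P s) (delta_mx 0 j) * (- 2^-1 * (Num.sqrt (dot (P s) (P s)))^-1 *
     (dot (P s) (P s))^-1 * (2 * dot (P s) (row i A)))).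
have GP j' : gradient (fun s => sphere_param s 0 j') (G j').
  by rewrite E; exact: cg.
rewrite (gradient_partial i 0 GP) mxE /G P0 dot_p0// sqrtr1 invr1 mul1r dot_delta.
have -> : dot p0 (row i A) = 0 by rewrite -mulmx_trE pA mxE.
by rewrite !mulr0 addr0 mxE.
Qed.

End sphere_param.

Section sphere_jacobian.
Context (R : realType) (m : nat).
Local Notation n := m.+1.
Local Notation S := [set p : 'rV[R]_n.+1 | enorm p = 1].
Variables (p0 : 'rV[R]_n.+1) (A : 'M[R]_(n, n.+1)).
Hypotheses (p01 : enorm p0 = 1) (Afree : row_free A) (pA : p0 *m A^T = 0).

Lemma sphere_piece (B : set 'rV[R]_n.+1) :
  (forall p, B p -> enorm p = 1 /\ 0 < dot p p0) ->
  B = sphere_param p0 A @` (affine_coord p0 A @` B).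
Proof.
move=> BS; apply/seteqP; split=> [p Bp|_ [_ [p Bp <-] <-]].
  have [p1 pp] := BS p Bp; exists (affine_coord p0 A p); first by exists p.
  exact: sphere_param_coord.
by have [p1 pp] := BS p Bp; rewrite sphere_param_coord.
Qed.

(** The sphere and its image are parametrized by the same s, with differentials A and C at 0.
    Comparing areas in both directions gives the ratio of their factors, in which the unknown factor
    a of the frame cancels. *)
Lemma sphere_jacobian q (Phi : 'rV[R]_n.+1 -> 'rV[R]_q) (Psi : 'rV[R]_n -> 'rV[R]_q) C a (j : R) :
  strict_diff Psi 0 C -> row_free C -> (forall s, Phi (sphere_param p0 A s) = Psi s) ->
  0 < a -> 0 < j -> scales_hausdorff A a -> scales_hausdorff C (j * a) ->
  has_jacobian n S Phi p0 j.
Proof.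
move=> Psid Cfree PhiE a0 j0 Aa Cj e e0.
have od := sphere_param_strict_diff p01 pA.
have ja : 0 < j * a by rewrite mulr_gt0.
have [d1 d10 d1P] := area_comparison e0 Afree Cfree od Psid a0 ja Aa Cj.
have [d2 d20 d2P] := area_comparison e0 Cfree Afree Psid od ja a0 Cj Aa.
exists [set p | 0 < dot p p0 /\ [set s : 'rV[R]_n | enorm (s - 0) < Num.min d1 d2] (affine_coord p0 A p)].
split.
- by apply: affine_coord_open => //; exact: open_enorm_ball.
- by split; rewrite /= ?dot_p0// affine_coord_base// subrr enorm0 lt_min d10.
move=> B BSW.
have BE := sphere_piece (fun p Bp => conj (BSW p Bp).1 (BSW p Bp).2.1).
set T := affine_coord p0 A @` B in BE.
have Td s : T s -> enorm (s - 0) < Num.min d1 d2 by move=> [p /BSW[_ [_ sd]] <-].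
have PE : Phi @` B = Psi @` T.
  rewrite BE image_comp; apply: eq_imagel => s _ /=; exact: PhiE.
have le1 : Num.min d1 d2 <= d1 by rewrite ge_min lexx.
have le2 : Num.min d1 d2 <= d2 by rewrite ge_min lexx orbT.
have h1 := d1P T (fun s Ts => lt_le_trans (Td s Ts) le1).
have h2 := d2P T (fun s Ts => lt_le_trans (Td s Ts) le2).
have Bm : hausdorff n B = hausdorff n (sphere_param p0 A @` T) by rewrite -BE.
rewrite PE Bm; split; apply: (lee_cancel_scale a0).
  rewrite (_ : a * ((1 + e) * j) = (1 + e) * (j * a)); last by ring.
  exact: h1.
by rewrite muleA -EFinM [a * j]mulrC [a * (1 + e)]mulrC.
Qed.

Lemma sphere_ball_fin (B : set 'rV[R]_n) (r : R) : 0 < r ->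
  (forall s, B s -> enorm s < r) -> (hausdorff n B < +oo)%E.
Proof.
move=> r0 Br; pose t : 'rV[R]_n := const_mx (- r).
have sub : B `<=` (fun x => t + x) @` ((fun x => (2 * r) *: x) @` @unit_cube R n).
  move=> s /Br sr; exists (s - t); last by rewrite addrC subrK.
  exists ((2 * r)^-1 *: (s - t)); last by rewrite scalerA divff ?scale1r// mulf_neq0// gt_eqF.
  move=> i; rewrite !mxE opprK.
  have := le_lt_trans (coord_le_enorm s i) sr; rewrite ltr_norml => /andP[s1 s2].
  rewrite mulrC divr_ge0 ?mulr_ge0 ?(ltW r0)//=; last by lra.
  by rewrite ltr_pdivrMr ?mulr_gt0// mul1r; lra.
apply: le_lt_trans (le_hausdorff _ sub) _.
rewrite hausdorff_translate hausdorff_scale ?mulr_gt0//.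
rewrite lte_mul_pinfty ?hausdorff_unit_cube_fin//.
by rewrite lee_fin exprn_ge0// mulr_ge0// ltW.
Qed.

Lemma ball_measure_gt0 (r : R) : 0 < r ->
  (0 < hausdorff n [set s : 'rV[R]_n | (enorm s < r)%R])%E.
Proof.
move=> r0; pose k := r / (n%:R * 2).
have k0 : 0 < k by rewrite divr_gt0// mulr_gt0// ltr0n.
have sub : (fun x => k *: x) @` @unit_cube R n `<=` [set s : 'rV[R]_n | enorm s < r].
  move=> _ [x Qx <-] /=; rewrite enormZ gtr0_norm//.
  have x1 : `|x| <= 1.
    by apply/norm_leP => // i; have /andP[x0 x1] := Qx i; rewrite ger0_norm// ltW.
  apply: (@le_lt_trans _ _ (k * (n%:R * 1))).
    rewrite ler_wpM2l ?(ltW k0)//; apply: le_trans (enorm_le_norm _) _.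
    by rewrite ler_wpM2l.
  have n0 : (n%:R : R) != 0 by rewrite pnatr_eq0.
  rewrite (_ : k * (n%:R * 1) = r / 2); first by rewrite ltr_pdivrMr//; lra.
  by rewrite /k; move: (n%:R : R) n0 => N N0; field.
apply: lt_le_trans (le_hausdorff _ sub).
rewrite hausdorff_scale// mule_gt0 ?hausdorff_unit_cube_gt0//.
by rewrite lte_fin exprn_gt0.
Qed.

Lemma sphere_measure_gt0 : (0 < hausdorff n S)%E.
Proof.
have [a a0 Aa] := scales_hausdorff_ex Afree.
have [d d0 dP] := strict_diff_ratio ltr01 Afree (sphere_param_strict_diff p01 pA).
set B := [set s : 'rV[R]_n | enorm s < d].
have := hausdorff_lip n (B := B) (F := fun s => s *m A) (G := sphere_param p0 A)
  (k := 1 + 1) (addr_gt0 ltr01 ltr01).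
move=> /(_ _)/wrap[s t sd td|].
  by have [] := dP s t; rewrite ?subr0.
rewrite Aa => h1; have : (0 < a%:E * hausdorff n B)%E.
  by rewrite mule_gt0 ?lte_fin// ball_measure_gt0.
move=> /lt_le_trans/(_ h1).
have sub : sphere_param p0 A @` B `<=` S by move=> _ [s _ <-]; exact: enorm_sphere_param.
case: (ltgtP 0%E (hausdorff n S)) => //; first by rewrite ltNge hausdorff_ge0.
move=> S0 h2; have := le_hausdorff n sub; rewrite -S0 => B0; move: h2.
rewrite (_ : hausdorff _ (_ @` B) = 0%E) ?mule0 ?ltxx//.
by apply/eqP; rewrite eq_le B0 hausdorff_ge0.
Qed.

Lemma sphere_local_fin : exists W, [/\ open W, W p0 &
  forall B, B `<=` S -> B `<=` W -> (hausdorff n B < +oo)%E].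
Proof.
have [a a0 Aa] := scales_hausdorff_ex Afree.
have [d d0 dP] := strict_diff_ratio ltr01 Afree (sphere_param_strict_diff p01 pA).
exists [set p | 0 < dot p p0 /\ [set s : 'rV[R]_n | enorm (s - 0) < d] (affine_coord p0 A p)].
split.
- by apply: affine_coord_open => //; exact: open_enorm_ball.
- by split; rewrite /= ?dot_p0// affine_coord_base// subrr enorm0.
move=> B BS BW; rewrite (sphere_piece (fun p Bp => conj (BS p Bp) (BW p Bp).1)).
set T := affine_coord p0 A @` B.
have Td s : T s -> enorm (s - 0) < d by move=> [p /BW[_ +] <-].
apply: (@le_lt_trans _ _ (((1 + 1) ^+ n)%:E * hausdorff n ((fun s => s *m A) @` T))%E).
  by apply: hausdorff_lip => // s t /Td sd /Td td; have [] := dP s t sd td.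
rewrite lte_mul_pinfty ?lee_fin ?exprn_ge0// Aa.
rewrite lte_mul_pinfty ?lee_fin ?(ltW a0)//.
by apply: (sphere_ball_fin d0) => s /Td; rewrite subr0.
Qed.

End sphere_jacobian.

Section unit_sphere.
Context (R : realType) (n : nat).
Local Notation S := [set p : 'rV[R]_n.+1 | enorm p = 1].

Lemma unit_sphere_compact : compact S.
Proof.
apply: bounded_closed_compact.
  exists 1; split; first exact: num_real.
  by move=> x x1 p /= p1; apply: le_trans (norm_le_enorm p) _; rewrite p1 ltW.
rewrite (_ : S = [set p | enorm p <= 1] `&` [set p : 'rV[R]_n.+1 | - enorm p <= -1]).
  apply: closedI; apply: closed_sublevel; first exact: enorm_continuous.
  by move=> v; apply: (@continuousN _ _ _ (@enorm R n.+1)); exact: enorm_continuous.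
apply/seteqP; split => p /=; first by move=> ->.
by rewrite lerN2 => -[p1 p2]; apply/eqP; rewrite eq_le p1.
Qed.

End unit_sphere.

(** A rank-one perturbation of the identity whose congruence action on G adds a multiple of xi^T xi.
    It exhibits the Gram matrix of the dual chart as that of a square matrix times A, which reduces
    its scaling factor to a determinant. *)
Lemma gram_root (R : fieldType) n (G : 'M[R]_n) (xi : 'rV[R]_n) (b : R) :
  G \in unitmx -> G^T = G ->
  (1%:M + (b *: xi^T) *m (xi *m invmx G)) *m G *m
  (1%:M + (b *: xi^T) *m (xi *m invmx G))^T =
  G + (b * (2 + b * (xi *m invmx G *m xi^T) 0 0)) *: (xi^T *m xi).
Proof.
move=> Gu Gt.
have Zt : (1%:M + (b *: xi^T) *m (xi *m invmx G))^T = 1%:M + b *: (invmx G *m xi^T *m xi).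
  by rewrite -scalemxAl linearD /= linearZ /= trmx1 !trmx_mul trmxK trmx_inv Gt.
have ZG : (1%:M + (b *: xi^T) *m (xi *m invmx G)) *m G = G + b *: (xi^T *m xi).
  by rewrite mulmxDl mul1mx -!scalemxAl -!mulmxA mulVmx// mulmx1.
rewrite ZG Zt.
rewrite mulmxDr mulmx1 mulmxDl -!scalemxAr -!scalemxAl scalerA !mulmxA mulmxV// mul1mx.
have -> : xi^T *m xi *m invmx G *m xi^T *m xi =
    (xi *m invmx G *m xi^T) 0 0 *: (xi^T *m xi).
  rewrite -(mulmxA xi^T) -(mulmxA xi^T) [xi *m invmx G *m xi^T in LHS]mx11_scalar.
  by rewrite mul_mx_scalar -scalemxAl.
by rewrite -addrA !scalerA -!scalerDl; congr (_ + _ *: _); ring.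
Qed.

(** * The boundary of K and that of the dual as images of the unit sphere *)

Section sphere_changes.
Context (R : realType) (m : nat).
Local Notation n := m.+1.
Context (K : set 'rV[R]_n.+1).
Hypotheses (Kbody : convex_body K) (KC2 : @C2_plus R n.+1 K).
Local Notation xm := (support_point K).
Local Notation h := (support_fun K).
Local Notation M := (boundary setT K).
Local Notation S := [set p : 'rV[R]_n.+1 | enorm p = 1].

(** The tangent frame of the boundary of K at x(p) is a basis of the orthogonal complement of p. *)
Lemma sphere_frame (p : 'rV[R]_n.+1) : enorm p = 1 ->
  exists A : 'M[R]_(n, n.+1), row_free A /\ p *m A^T = 0.
Proof.
move=> p1; have [V [X [u [cX Vu Xu _]]]] := support_chart Kbody KC2 (enorm1_neq0 p1).
exists (tangent_frame X u); split; first by case: cX => _ _ _ + _; apply.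
by apply: (maximizes_normal_field Kbody cX Vu); rewrite Xu; exact: support_pointP.
Qed.

Lemma sphere_fin : (hausdorff n S < +oo)%E.
Proof.
have idc : {within S, continuous (@id 'rV[R]_n.+1)}.
  by apply: continuous_subspaceT => x; exact: cvg_id.
pose fin B := (@hausdorff R n.+1 n B < +oo)%E.
have idi : set_inj S (@id 'rV[R]_n.+1) by [].
apply: (piece_induction (m := n) (P := fin) (unit_sphere_compact (n := n)) idc idi); rewrite /fin.
- by rewrite hausdorff0.
- move=> p p1; have [A [Af pA]] := sphere_frame p1.
  have [W [oW Wp WB]] := sphere_local_fin p1 Af pA.
  by exists W; split => // B [BS _ _]; exact: WB.
move=> B C _ _ _ Bfin Cfin.
apply: le_lt_trans (outer_measureU2 (@hausdorff_outer R n.+1 n) _ _) _.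
exact: lte_add_pinfty.
Qed.

Lemma sphere_gt0 : (0 < hausdorff n S)%E.
Proof.
pose p : 'rV[R]_n.+1 := delta_mx 0 0.
have p1 : enorm p = 1 by exact: enorm_delta.
have [A [Af pA]] := sphere_frame p1.
exact: sphere_measure_gt0 p1 Af pA.
Qed.

Lemma support_image : xm @` S = M.
Proof.
apply/seteqP; split => [_ [p p1 <-]|x Mx].
  by apply: support_point_boundary => //; exact: enorm1_neq0.
have [V [X [u [nu [_ _ _ nux _]]]]] := boundary_chart KC2 Mx.
have nu1 := nux.1; exists nu => //.
apply: (support_point_uniq Kbody KC2); first exact: enorm1_neq0.
by apply: outer_normal_maximizes => //; exact: boundary_sub.
Qed.

Lemma unit_outer_normal p : enorm p = 1 -> outer_normals K (xm p) p.
Proof.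
move=> p1; split => // y Ky; have [_ /(_ y Ky)] := support_pointP Kbody p.
by rewrite (dotC p) dotBl subr_le0.
Qed.

Lemma support_inj : set_inj S xm.
Proof.
move=> p q /set_mem p1 /set_mem q1 pq.
have [V [X [u [cX Vu Xu _]]]] := support_chart Kbody KC2 (enorm1_neq0 p1).
have := maximizes_normalE Kbody cX Vu Xu (enorm1_neq0 p1) (support_pointP Kbody p).
by move=> /(_ q); rewrite p1 invr1 scale1r pq => /(_ (unit_outer_normal q1)).
Qed.

Lemma support_within : {within S, continuous xm}.
Proof.
apply: continuous_in_subspaceT => p /set_mem p1.
by apply: support_point_continuous => //; exact: enorm1_neq0.
Qed.

(** The differential of x along the frame is W A with W = G II^(-T). The square matrix W has
    determinant det(G) / det(II), the reciprocal of the curvature. *)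
Lemma support_jacobian p : enorm p = 1 ->
  has_jacobian n S xm p (curvature_e K (xm p))^-1.
Proof.
move=> p1; have p0 := enorm1_neq0 p1.
have [V [X [u [cX Vu Xu IIu]]]] := support_chart Kbody KC2 p0.
have H0 := curvature_gt0 Kbody KC2 p0.
have HE := curvature_chart Kbody KC2 cX Vu Xu p1.
set A := tangent_frame X u; set II := second_form X p u in IIu HE.
have Af : row_free A by case: cX => _ _ _ + _; apply.
have pA : p *m A^T = 0.
  by apply: (maximizes_normal_field Kbody cX Vu); rewrite Xu; exact: support_pointP.
have Gu := gram_unit Af.
have [a a0 Aa] := scales_hausdorff_ex Af.
pose Psi s := xm (p + s *m A).
have Pn0 := affine_neq0 p1 pA.
pose W := A *m A^T *m invmx II^T.
have xT : tangent_frame xm p = A^T *m invmx II^T *m A.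
  by apply: fdiff_tangent_frame; exact: (support_point_fdiff Kbody KC2 cX Vu Xu p0 IIu).
have PG j : gradient (fun s => Psi s 0 j)
    (fun i s => dot (row i A *m tangent_frame xm (p + s *m A)) (delta_mx 0 j)).
  rewrite (_ : (fun s => _) = (fun s => dot (xm (p + s *m A)) (delta_mx 0 j))).
    exact: support_point_gradient.
  by apply/funext => s; rewrite dot_delta.
have Pd : strict_diff Psi 0 (W *m A).
  have C1 : C1_on setT Psi by apply: has_C1_on => j; eexists; exact: PG.
  rewrite (_ : W *m A = tangent_frame Psi 0); first exact: C1_strict_diff openT C1 I.
  apply/matrixP => i j; rewrite [RHS]mxE (gradient_partial i 0 PG) [RHS]mxE dot_delta.
  by rewrite mul0mx addr0 xT -row_mul [RHS]mxE /W !mulmxA.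
have Wu : W \in unitmx by rewrite unitmx_mul Gu unitmx_inv unitmx_tr.
have WE : \det W = (curvature_e K (xm p))^-1.
  by rewrite HE first_formE invf_div det_mulmx det_inv det_tr.
apply: (sphere_jacobian p1 Af pA Pd _ _ a0 _ Aa).
- by rewrite /row_free mxrankMfree// mxrank_unit.
- by move=> s; rewrite /sphere_param support_pointZ// ?invr_gt0 ?enorm_gt0.
- by rewrite invr_gt0.
- have := scales_hausdorff_det Wu; rewrite WE gtr0_norm ?invr_gt0// => Ws.
  exact: scales_hausdorffM Ws Aa.
Qed.

Section dual.
Variable lambda : R.
Hypothesis lambda0 : 0 < lambda.
Local Notation D := (dual lambda (gnomonic_preimage lambda K)).
Local Notation N := (boundary (@sphere R n.+1 lambda) D).
Local Notation w := (dual_point K lambda).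

Lemma dual_image : w @` S = N.
Proof.
apply/seteqP; split => [_ [p p1 <-]|v Nv].
  by apply: dual_point_mem => //; exact: enorm1_neq0.
have t0 : - vtail v != 0 by rewrite oppr_eq0 (dual_tail_neq0 Kbody KC2 lambda0).
exists ((enorm (- vtail v))^-1 *: - vtail v); first exact: normalizeE.
by rewrite dual_pointZ// ?invr_gt0 ?enorm_gt0//; exact: dual_pointE.
Qed.

Lemma dual_inj : set_inj S w.
Proof.
move=> p q /set_mem p1 /set_mem q1 /(congr1 (@vtail R n.+1)).
rewrite !vtail_dual_point => /oppr_inj pq.
have rp := dual_radius_gt0 K lambda0 (enorm1_neq0 p1).
have rq := dual_radius_gt0 K lambda0 (enorm1_neq0 q1).
have := congr1 (@enorm R n.+1) pq; rewrite !enormZ p1 q1 !mulr1 !gtr0_norm// => r.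
move: pq; rewrite r => /(congr1 (fun x => (dual_radius K lambda q)^-1 *: x)).
by rewrite !scalerA mulVf ?scale1r// gt_eqF.
Qed.

Lemma dual_within : {within S, continuous w}.
Proof.
apply: continuous_in_subspaceT => p /set_mem p1; have p0 := enorm1_neq0 p1.
have hc : {for p, continuous h} by exact: support_fun_continuous.
have rc : {for p, continuous (dual_radius K lambda)}.
  apply: continuousM; first exact: cst_continuous.
  have c1 : {for p, continuous (fun q => enorm q ^+ 2 + lambda * h q ^+ 2)}.
    apply: (@continuousD _ _ _ (fun q => enorm q ^+ 2) (fun q => lambda * h q ^+ 2)).
      exact: (@continuous_comp _ _ _ _ (fun t : R => t ^+ 2) _ (@enorm_continuous R n.+1 p)
        (@exprn_continuous R 2 _)).
    apply: continuousM; first exact: cst_continuous.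
    exact: (@continuous_comp _ _ _ _ (fun t : R => t ^+ 2) _ hc (@exprn_continuous R 2 _)).
  have -> : (fun q => (Num.sqrt (dot q q + lambda * h q ^+ 2))^-1) =
      (fun q => (Num.sqrt (enorm q ^+ 2 + lambda * h q ^+ 2))^-1).
    by apply/funext => q; rewrite enorm_sqr.
  apply: (cvgV _ (continuous_comp c1 (@sqrt_continuous R _))).
  by rewrite gt_eqF// sqrtr_gt0 enorm_sqr (dual_norm_gt0 K lambda0).
have vc : {for p, continuous (fun q => vcons (Num.sqrt lambda * h q) (- q))}.
  apply/row_mcontP => i j; rewrite ord1.
  have [k ->|k ->] := @split_ordP 1 n.+1 j.
    rewrite (_ : (fun s => _) = (fun s => Num.sqrt lambda * h s)).
      by apply: continuousM => //; exact: cst_continuous.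
    apply/funext => s; rewrite [LHS](row_mxEl ((Num.sqrt lambda * h s)%:M : 'M[R]_1)).
    by rewrite ord1 mxE mulr1n.
  rewrite (_ : (fun s => _) = (fun s : 'rV[R]_n.+1 => - s 0 k)).
    apply: (@continuousN _ _ _ (fun s : 'rV[R]_n.+1 => s 0 k)); exact: coord_continuous.
  by apply/funext => s; rewrite [LHS]row_mxEr mxE.
exact: cvgZ rc vc.
Qed.

Definition dual_density p : R := dual_radius K lambda p ^+ n *
  (Num.sqrt (1 + lambda * enorm (xm p) ^+ 2) / Num.sqrt (1 + lambda * h p ^+ 2)).

Lemma dual_density_gt0 p : p != 0 -> 0 < dual_density p.
Proof.
move=> p0; rewrite mulr_gt0 ?exprn_gt0 ?(dual_radius_gt0 K lambda0)//.
by rewrite divr_gt0// sqrtr_gt0 ltr_pwDl// mulr_ge0 ?sqr_ge0// ltW.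
Qed.

Lemma dual_has_jacobian p : enorm p = 1 -> has_jacobian n S w p (dual_density p).
Proof.
move=> p1; have p0 := enorm1_neq0 p1.
have [V [X [u [cX Vu Xu IIu]]]] := support_chart Kbody KC2 p0.
set A := tangent_frame X u.
have Af : row_free A by case: cX => _ _ _ + _; apply.
have pA : p *m A^T = 0.
  by apply: (maximizes_normal_field Kbody cX Vu); rewrite Xu; exact: support_pointP.
have Gu := gram_unit Af.
have [a a0 Aa] := scales_hausdorff_ex Af.
have cY := dual_chart Kbody KC2 lambda0 p1 Af pA.
have Yd : strict_diff (dual_param K lambda p A) 0 (tangent_frame (dual_param K lambda p A) 0).
  by case: cY => oV [YC1 _] _ _ _; exact: C1_strict_diff oV YC1 I.
have Yfree : row_free (tangent_frame (dual_param K lambda p A) 0).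
  by case: cY => _ _ _ + _; apply.
apply: (sphere_jacobian p1 Af pA Yd Yfree _ a0 (dual_density_gt0 p0) Aa).
  move=> s; rewrite /sphere_param /dual_param dual_pointZ ?invr_gt0 ?enorm_gt0//.
    exact: affine_neq0.
  exact: affine_neq0.
have FE := dual_first_form Kbody KC2 lambda0 p1 cX Vu Xu.
have qE := frame_norm Kbody p1 cX Vu Xu.
rewrite -/A in FE qE.
set xi := xm p *m A^T in FE qE; set G := A *m A^T in Gu FE qE.
set F0 := 1 + lambda * h p ^+ 2 in FE.
set rho := dual_radius K lambda p in FE.
have F00 : 0 < F0 by rewrite ltr_pwDl// mulr_ge0 ?sqr_ge0// ltW.
set q := enorm (xm p) ^+ 2 - h p ^+ 2 in qE.
pose s := Num.sqrt (1 + lambda * enorm (xm p) ^+ 2) / Num.sqrt F0.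
have E0 : 0 < 1 + lambda * enorm (xm p) ^+ 2 by rewrite ltr_pwDl// mulr_ge0 ?sqr_ge0// ltW.
have s0 : 0 < s by rewrite divr_gt0// sqrtr_gt0.
have s2 : s ^+ 2 = 1 + lambda / F0 * q.
  rewrite expr_div_n (sqr_sqrtr (ltW E0)) (sqr_sqrtr (ltW F00)) /q /F0.
  have fld (x y l : R) : 1 + l * y ^+ 2 != 0 ->
      (1 + l * x ^+ 2) / (1 + l * y ^+ 2) = 1 + l / (1 + l * y ^+ 2) * (x ^+ 2 - y ^+ 2).
    by move=> xy0; field.
  exact: fld (lt0r_neq0 F00).
(* Solves beta (2 + beta q) = lambda / F0. The root is (s - 1) / q, rewritten with s^2 - 1 = lambda
   q / F0 so that q = 0 is allowed. *)
pose beta := lambda / F0 / (1 + s).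
(* Z A has the same Gram matrix as the frame of the dual chart, so both scale
   measures by the same factor. *)
pose Z := rho *: (1%:M + (beta *: xi^T) *m (xi *m invmx G)).
have s1 : 1 + s != 0 by rewrite gt_eqF// addr_gt0.
have b1 : beta * (1 + s) = lambda / F0 by rewrite /beta divfK.
have bq : 1 + beta * q = s.
  apply: (mulIf s1); rewrite (_ : _ * (1 + s) = 1 + s + beta * (1 + s) * q); last by ring.
  by rewrite b1 (_ : lambda / F0 * q = s ^+ 2 - 1); [ring|rewrite s2; ring].
have detZ' : \det Z = rho ^+ n * s.
  by rewrite /Z detZ det_rank1 -scalemxAr mxE qE bq.
have rho0 : 0 < rho by exact: dual_radius_gt0.
have Zu : Z \in unitmx by rewrite unitmxE unitfE detZ' gt_eqF// mulr_gt0// exprn_gt0.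
have ZG : Z *m A *m (Z *m A)^T =
    tangent_frame (dual_param K lambda p A) 0 *m (tangent_frame (dual_param K lambda p A) 0)^T.
  have Gt : G^T = G by rewrite /G trmx_mul trmxK.
  rewrite -first_formE FE trmx_mul mulmxA -(mulmxA Z) -/G.
  rewrite /Z -scalemxAl linearZ /= -scalemxAl -scalemxAr scalerA -expr2.
  rewrite gram_root// qE; congr (_ *: (_ + _ *: _)).
  by rewrite -b1 -bq; ring.
have ZA : scales_hausdorff (Z *m A) (rho ^+ n * s * a).
  rewrite -detZ' -[X in X * a]ger0_norm; last by rewrite detZ' mulr_ge0 ?exprn_ge0 ?(ltW rho0)// ltW.
  by apply: scales_hausdorffM Aa; exact: scales_hausdorff_det.
move=> B; rewrite -[RHS]ZA; apply: hausdorff_isometry => x y _ _.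
rewrite -!mulmxBl /enorm; congr Num.sqrt.
by rewrite !dot_mxE !trmx_mul !mulmxA -!(mulmxA (x - y)) -ZG trmx_mul !mulmxA.
Qed.

End dual.
End sphere_changes.

(** * Entropies *)

(** From exp(-t) at least 1 - t, together with (1 + t + 2 t^2)(1 - t) = 1 + t^2 (1 - 2t). *)
Lemma expR_quadratic (R : realType) (t : R) : t <= 1 / 2 -> expR t <= 1 + t + 2 * t ^+ 2.
Proof.
move=> t2; have t1 : 0 < 1 - t by lra.
have e1 : expR t <= (1 - t)^-1.
  rewrite -[expR t]invrK lef_pV2 ?posrE ?invr_gt0 ?expR_gt0// -expRN.
  exact: expR_ge1Dx.
apply: le_trans e1 _; rewrite -[(1 - t)^-1]mul1r ler_pdivrMr//.
have : 0 <= t ^+ 2 * (1 - 2 * t) by rewrite mulr_ge0 ?sqr_ge0//; lra.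
by lra.
Qed.

(** * Integrals over compact sets and power means *)

Section compact_integrals.
Context (R : realType) (k m : nat) (N : set 'rV[R]_k).
Hypotheses (Nc : compact N) (Nfin : (hausdorff m N < +oo)%E).
Local Notation integral := (hausdorff_integral m N).
Implicit Types f g : 'rV[R]_k -> R.

Lemma compact_measurable : measurable (N : set (caratheodory_type (@hausdorff_outer R k m))).
Proof. by apply: hausdorff_closed_measurable; exact: compact_rV_closed. Qed.

Lemma compact_bound f : {within N, continuous f} -> exists2 L, 0 < L & forall x, N x -> `|f x| <= L.
Proof.
move=> fc; have [M [_ hM]] := compact_bounded (continuous_compact fc Nc).
exists (`|M| + 1); first by rewrite ltr_wpDl.
by move=> x Nx; apply: (hM (`|M| + 1)); [rewrite ltr_pwDr// ler_norm|exists x].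
Qed.

Lemma compact_integrable f : {within N, continuous f} ->
  (@hausdorff_measure R k m).-integrable (N : set (caratheodory_type _)) (EFin \o f).
Proof.
move=> fc; have [L _ fL] := compact_bound fc.
apply: (hausdorff_bounded_integrable (M := L)) => //; first exact: compact_measurable.
by apply: hausdorff_continuous_measurable => //; exact: compact_rV_closed.
Qed.

Lemma compact_integralD f g : {within N, continuous f} -> {within N, continuous g} ->
  integral (fun x => f x + g x) = integral f + integral g.
Proof.
move=> fc gc; apply: RintegralD; first exact: compact_measurable.
  exact: compact_integrable.
exact: compact_integrable.
Qed.

Lemma compact_integralZ c f : {within N, continuous f} ->
  integral (fun x => c * f x) = c * integral f.
Proof.
by move=> fc; apply: RintegralZl; [exact: compact_measurable|exact: compact_integrable].
Qed.

Lemma compact_integral_cst c : integral (fun=> c) = c * fine (hausdorff m N).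
Proof. by apply: Rintegral_cst; exact: compact_measurable. Qed.

Lemma compact_integral_le f g : {within N, continuous f} -> {within N, continuous g} ->
  (forall x, N x -> f x <= g x) -> integral f <= integral g.
Proof.
move=> fc gc fg; apply: le_Rintegral => //; first exact: compact_measurable.
  exact: compact_integrable.
exact: compact_integrable.
Qed.

Lemma compact_integral_eq f g : (forall x, N x -> f x = g x) -> integral f = integral g.
Proof. by move=> fg; apply: eq_Rintegral => x /set_mem; exact: fg. Qed.

Lemma within_cst c : {within N, continuous (fun=> c : R)}.
Proof. by apply: continuous_subspaceT => x; exact: cst_continuous. Qed.

Lemma within_comp (phi : R -> R) f : {within N, continuous f} ->
  (forall x, N x -> {for f x, continuous phi}) -> {within N, continuous (fun x => phi (f x))}.
Proof.
move=> fc phic; apply: within_continuous_comp fc => _ /set_mem[x Nx <-]; exact: phic.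
Qed.

Lemma withinD f g : {within N, continuous f} -> {within N, continuous g} ->
  {within N, continuous (fun x => f x + g x)}.
Proof. by move=> fc gc x; exact: (@cvgD _ _ _ _ _ _ _ _ _ (fc x) (gc x)). Qed.

Lemma withinM f g : {within N, continuous f} -> {within N, continuous g} ->
  {within N, continuous (fun x => f x * g x)}.
Proof. by move=> fc gc x; exact: (@cvgM _ _ _ _ _ _ _ _ (fc x) (gc x)). Qed.

Lemma within_ln f : {within N, continuous f} -> (forall x, N x -> 0 < f x) ->
  {within N, continuous (fun x => ln (f x))}.
Proof. by move=> fc f0; apply: within_comp => // x Nx; exact: continuous_ln (f0 x Nx). Qed.

Hypothesis Ngt0 : (0 < hausdorff m N)%E.
Local Notation mu := (fine (hausdorff m N)).

Lemma compact_mu_gt0 : 0 < mu.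
Proof. by rewrite fine_gt0// Ngt0. Qed.

Variable f : 'rV[R]_k -> R.
Hypotheses (fc : {within N, continuous f}) (f0 : forall x, N x -> 0 < f x).

(* The lower bound is Jensen's inequality, obtained from exp t >= 1 + t. *)
Lemma power_mean_bounds : exists L dl, [/\ 0 < dl, 0 <= L & forall p, 0 < p < dl ->
  0 < integral (fun x => f x `^ p) / mu /\
  integral (fun x => ln (f x)) / mu <= ln (integral (fun x => f x `^ p) / mu) / p <=
  integral (fun x => ln (f x)) / mu + p * L].
Proof.
have lc := within_ln fc f0; have [L L0 fL] := compact_bound lc.
have mu0 := compact_mu_gt0.
(* Here L bounds the logarithm of f. The second constant keeps p ln f below 1/2, where the quadratic
   bound on exp holds; the first is the quadratic term after division by p. *)
exists (2 * L ^+ 2), (1 / (2 * L)); split.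
- by rewrite divr_gt0// mulr_gt0.
- by rewrite mulr_ge0// sqr_ge0.
move=> p /andP[p0 pL]; set a := integral (fun x => ln (f x)) / mu.
have powE x : N x -> f x `^ p = expR (p * ln (f x)).
  by move=> Nx; rewrite /powR gt_eqF// f0.
have plc : {within N, continuous (fun x => p * ln (f x))}.
  by apply: withinM => //; exact: within_cst.
have ec : {within N, continuous (fun x => expR (p * ln (f x)))}.
  by apply: (within_comp (f := fun x => p * ln (f x)) plc) => x _; exact: continuous_expR.
rewrite (compact_integral_eq powE).
have le1 x : N x -> expR (p * ln (f x)) <= (1 + 2 * (p * L) ^+ 2) + p * ln (f x).
  move=> Nx; have tL : `|p * ln (f x)| <= p * L.
    by rewrite normrM gtr0_norm// ler_wpM2l ?(ltW p0)// fL.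
  have pL2 : p * L <= 1 / 2.
    move: pL; rewrite ltr_pdivlMr ?mulr_gt0//; lra.
  have := expR_quadratic (le_trans (ler_norm _) (le_trans tL pL2)).
  move=> /le_trans; apply; rewrite addrAC lerD2r lerD2l ler_wpM2l//.
  by rewrite -[leLHS]real_normK ?num_real// lerXn2r ?nnegrE// mulr_ge0 ?(ltW p0) ?(ltW L0).
(* The tangent line of exp at p a, with a the mean of ln f; integrating it gives the lower bound. *)
have ge1 x : N x -> expR (p * a) * (1 - p * a) + expR (p * a) * (p * ln (f x)) <= expR (p * ln (f x)).
  move=> Nx; rewrite -mulrDr (_ : p * ln (f x) = p * a + (p * ln (f x) - p * a)); last by ring.
  rewrite [leRHS]expRD ler_wpM2l ?expR_ge0//.
  by apply: le_trans (expR_ge1Dx _); lra.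
have aE : integral (fun x => ln (f x)) = a * mu by rewrite /a divfK// gt_eqF.
have u1 : integral (fun x => expR (p * ln (f x))) <= (1 + 2 * (p * L) ^+ 2 + p * a) * mu.
  apply: le_trans (compact_integral_le ec _ le1) _.
    by apply: withinD => //; exact: within_cst.
  rewrite compact_integralD//; last exact: within_cst.
  by rewrite compact_integral_cst compact_integralZ// aE (mulrA p) -mulrDl.
have u2 : expR (p * a) * mu <= integral (fun x => expR (p * ln (f x))).
  apply: le_trans (compact_integral_le _ ec ge1).
    rewrite compact_integralD; [|exact: within_cst|by apply: withinM => //; exact: within_cst].
    rewrite compact_integral_cst compact_integralZ// compact_integralZ// aE.
    by rewrite le_eqVlt; apply/orP; left; apply/eqP; ring.
  by apply: withinD; [exact: within_cst|apply: withinM => //; exact: within_cst].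
set A := integral _ in u1 u2 *.
have A1 : expR (p * a) <= A / mu by rewrite ler_pdivlMr.
have A2 : A / mu <= 1 + 2 * (p * L) ^+ 2 + p * a by rewrite ler_pdivrMr.
have A0 : 0 < A / mu by exact: lt_le_trans (expR_gt0 _) A1.
split=> //; apply/andP; split.
  by rewrite ler_pdivlMr// mulrC -ler_expR lnK.
rewrite ler_pdivrMr//; have : ln (A / mu) <= A / mu - 1.
  have := @le_ln1Dx R (A / mu - 1); rewrite (addrC 1) subrK; apply; lra.
move=> /le_trans; apply; rewrite lerBlDl; apply: le_trans A2 _.
by rewrite le_eqVlt; apply/orP; left; apply/eqP; ring.
Qed.

End compact_integrals.

Section entropies.
Context (R : realType) (m : nat).
Local Notation n := m.+1.
Context (K : set 'rV[R]_n.+1).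
Hypotheses (Kbody : convex_body K) (KC2 : @C2_plus R n.+1 K).
Local Notation xm := (support_point K).
Local Notation h := (support_fun K).
Local Notation M := (boundary setT K).
Local Notation S := [set p : 'rV[R]_n.+1 | enorm p = 1].
Local Notation curv p := (curvature_e K (xm p)).

Let Sc : compact S := unit_sphere_compact (n := n).
Let Sfin : (hausdorff n S < +oo)%E := sphere_fin Kbody KC2.

Lemma within_curvature : {within S, continuous (fun p => curv p)}.
Proof.
apply: continuous_in_subspaceT => p /set_mem p1.
by apply: curvature_continuous => //; exact: enorm1_neq0.
Qed.

Lemma within_log_curvature : {within S, continuous (fun p => ln (curv p))}.
Proof.
apply: within_ln; first exact: within_curvature.
by move=> p p1; apply: curvature_gt0 => //; exact: enorm1_neq0.
Qed.

Lemma within_support_fun : {within S, continuous h}.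
Proof. by apply: continuous_subspaceT; exact: support_fun_continuous. Qed.

Lemma within_support_norm : {within S, continuous (fun p => enorm (xm p))}.
Proof.
apply: (within_continuous_image (f := xm) (g := @enorm R n.+1)).
  exact: support_within.
by apply: continuous_subspaceT; exact: enorm_continuous.
Qed.

Lemma gaussian_entropyE : gaussian_entropy K =
  hausdorff_integral n S (fun p => ln (curv p)) / fine (hausdorff n S).
Proof.
rewrite /gaussian_entropy /sphere_area mulrC; congr (_ / _).
have H0 p : S p -> 0 < curv p.
  by move=> p1; apply: curvature_gt0 => //; exact: enorm1_neq0.
pose g x := curvature_e K x * ln (curvature_e K x).
have gc : {within S, continuous (fun p => g (xm p))}.
  by apply: withinM; [exact: within_curvature|exact: within_log_curvature].
have E p : S p -> g (xm p) * (curv p)^-1 = ln (curv p).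
  by move=> p1; rewrite /g mulrAC divff ?mul1r// gt_eqF// H0.
rewrite -(support_image Kbody KC2).
have := @change_of_variables R n n.+1 n.+1 S xm (fun p => (curv p)^-1) Sc
  (support_within Kbody KC2) (support_inj Kbody KC2) Sfin.
move=> /(_ _ _ _ g) ->.
- exact: compact_integral_eq.
- apply: (within_comp (phi := GRing.inv) within_curvature) => p p1.
  by apply: inv_continuous; rewrite gt_eqF// H0.
- by move=> p p1; rewrite invr_ge0 ltW// H0.
- by move=> p p1; exact: support_jacobian.
- exact: within_continuous_factor (support_within Kbody KC2) gc.
- apply: (withinM (f := fun p => g (xm p))) => //.
  apply: (within_comp (phi := GRing.inv) within_curvature) => p p1.
  by apply: inv_continuous; rewrite gt_eqF// H0.
Qed.

(** The constant [lambda]^(-(d-1)/2) of the Jacobian is left out: it cancels in the average, and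
    without it the weight makes sense at [lambda] = 0 and slightly below. *)
Definition entropy_weight (lambda : R) p : R :=
  Num.sqrt (1 + lambda * enorm (xm p) ^+ 2) * (Num.sqrt (1 + lambda * h p ^+ 2))^-1 ^+ n.+1.

Definition entropy_density (lambda : R) p : R := ln (curv p) - n.+2%:R *
  (ln (Num.sqrt (1 + lambda * h p ^+ 2)) - ln (Num.sqrt (1 + lambda * enorm (xm p) ^+ 2))).

Definition entropy_average (lambda : R) : R :=
  hausdorff_integral n S (fun p => entropy_density lambda p * entropy_weight lambda p) /
  hausdorff_integral n S (entropy_weight lambda).

Section weights.
Variable lambda : R.

Lemma within_sqrt1D (g : 'rV[R]_n.+1 -> R) : {within S, continuous g} ->
  {within S, continuous (fun p => Num.sqrt (1 + lambda * g p ^+ 2))}.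
Proof.
move=> gc; apply: (within_comp (phi := Num.sqrt) (f := fun p => 1 + lambda * g p ^+ 2)).
  apply: withinD; first exact: within_cst.
  apply: withinM; first exact: within_cst.
  by apply: (within_comp (phi := fun t => t ^+ 2) gc) => p _; exact: exprn_continuous.
by move=> p _; exact: sqrt_continuous.
Qed.

(* True for slightly negative lambda, so that 0 is interior to the range of
   lambda. *)
Definition admissible := forall p, enorm p = 1 ->
  0 < 1 + lambda * h p ^+ 2 /\ 0 < 1 + lambda * enorm (xm p) ^+ 2.

Hypothesis adm : admissible.

Lemma within_weight : {within S, continuous (entropy_weight lambda)}.
Proof.
apply: withinM; first by apply: within_sqrt1D; exact: within_support_norm.
apply: (within_comp (phi := fun t : R => t^-1 ^+ n.+1) (within_sqrt1D within_support_fun)).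
move=> p p1; have [hp _] := adm p1.
have c1 : {for Num.sqrt (1 + lambda * h p ^+ 2), continuous (fun t : R => t^-1)}.
  by apply: inv_continuous; rewrite gt_eqF// sqrtr_gt0.
exact: (@continuous_comp _ _ _ _ (fun t : R => t ^+ n.+1) _ c1 (@exprn_continuous R n.+1 _)).
Qed.

Lemma within_density : {within S, continuous (entropy_density lambda)}.
Proof.
have lc (g : 'rV[R]_n.+1 -> R) : {within S, continuous g} ->
    (forall p, S p -> 0 < 1 + lambda * g p ^+ 2) ->
    {within S, continuous (fun p => ln (Num.sqrt (1 + lambda * g p ^+ 2)))}.
  move=> gc g0; apply: within_ln; first exact: within_sqrt1D.
  by move=> p p1; rewrite sqrtr_gt0; exact: g0.
have lh := lc _ within_support_fun (fun p p1 => (adm p1).1).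
have lx := lc _ within_support_norm (fun p p1 => (adm p1).2).
apply: withinD; first exact: within_log_curvature.
apply: (within_comp (phi := fun t => - t)
  (f := fun p => n.+2%:R * (ln (Num.sqrt (1 + lambda * h p ^+ 2)) -
     ln (Num.sqrt (1 + lambda * enorm (xm p) ^+ 2))))); last by move=> p _; exact: opp_continuous.
apply: withinM; first exact: within_cst.
apply: withinD => //.
by apply: (within_comp (phi := fun t => - t) lx) => p _; exact: opp_continuous.
Qed.

End weights.

Section positive_curvature.
Variable lambda : R.
Hypothesis lambda0 : 0 < lambda.
Local Notation kappa := (Num.sqrt lambda).
Local Notation D := (dual lambda (gnomonic_preimage lambda K)).
Local Notation N := (boundary (@sphere R n.+1 lambda) D).
Local Notation w := (dual_point K lambda).
Local Notation f := (curvature_s lambda D).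

Lemma sqrt1D_gt0 (t : R) : 0 < Num.sqrt (1 + lambda * t ^+ 2).
Proof. by rewrite sqrtr_gt0 ltr_pwDl// mulr_ge0 ?sqr_ge0// ltW. Qed.

Lemma positive_admissible : admissible lambda.
Proof.
by move=> p _; split; rewrite ltr_pwDl// mulr_ge0 ?sqr_ge0// ltW.
Qed.
Let pos := positive_admissible.

Lemma dual_densityE p : enorm p = 1 ->
  dual_density K lambda p = kappa^-1 ^+ n * entropy_weight lambda p.
Proof.
move=> p1; rewrite /dual_density /dual_radius /entropy_weight exprMn [_ ^+ n.+1]exprSr dot_p0//.
by rewrite mulrA mulrCA -!mulrA; congr (_ * _); rewrite [RHS]mulrCA mulrCA.
Qed.

Lemma curvature_sE p : enorm p = 1 -> 0 < f (w p) /\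
  ln (f (w p)) = n%:R * ln lambda - entropy_density lambda p.
Proof.
move=> p1; have H0 := curvature_gt0 Kbody KC2 (enorm1_neq0 p1).
rewrite (dual_curvature Kbody KC2 lambda0 p1).
have r0 : 0 < Num.sqrt (1 + lambda * h p ^+ 2) / Num.sqrt (1 + lambda * enorm (xm p) ^+ 2).
  by rewrite divr_gt0// sqrt1D_gt0.
have h1 := sqrt1D_gt0 (h p); have h2 := sqrt1D_gt0 (enorm (xm p)).
have l0 : 0 < lambda ^+ n by rewrite exprn_gt0.
have i0 : 0 < (curv p)^-1 by rewrite invr_gt0.
have li0 := mulr_gt0 l0 i0; have rn0 := exprn_gt0 n.+2 r0.
split; first exact: mulr_gt0.
rewrite lnM ?posrE// lnM ?posrE// !lnXn// lnV ?posrE//.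
rewrite ln_div ?posrE// /entropy_density.
rewrite -[ln lambda *+ _]mulr_natl -[_ *+ n.+2]mulr_natl; ring.
Qed.

Lemma within_curvature_s : {within N, continuous f}.
Proof.
rewrite -(dual_image Kbody KC2 lambda0).
suff fc : {within S, continuous (fun p => f (w p))}.
  exact: (@within_continuous_factor R _ _ S w f Sc (dual_within Kbody lambda0) fc).
have E : {in S, (fun p => expR (n%:R * ln lambda - entropy_density lambda p)) =1
    (fun p => f (w p))}.
  by move=> p /set_mem p1; have [f0 <-] := curvature_sE p1; rewrite lnK.
apply: (subspace_eq_continuous E).
apply: (within_comp (phi := fun t => expR (n%:R * ln lambda - t)) (within_density pos)) => p _.
apply: (@continuous_comp _ _ _ (fun t => n%:R * ln lambda - t) (@expR R)).
  apply: continuousD; first exact: cst_continuous.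
  exact: opp_continuous.
exact: continuous_expR.
Qed.

Lemma curvature_s_gt0 v : N v -> 0 < f v.
Proof.
rewrite -(dual_image Kbody KC2 lambda0) => -[p p1 <-].
by have [] := curvature_sE p1.
Qed.

Lemma dual_boundary_compact : compact N.
Proof.
rewrite -(dual_image Kbody KC2 lambda0).
exact: image_compact (dual_within Kbody lambda0).
Qed.

Let kn0 : 0 < kappa^-1 ^+ n.
Proof. by rewrite exprn_gt0// invr_gt0 sqrtr_gt0. Qed.

Lemma within_dual_density : {within S, continuous (dual_density K lambda)}.
Proof.
have E : {in S, (fun p => kappa^-1 ^+ n * entropy_weight lambda p) =1 dual_density K lambda}.
  by move=> p /set_mem p1; rewrite dual_densityE.
apply: (subspace_eq_continuous E); apply: withinM; last exact: (within_weight pos).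
exact: within_cst.
Qed.

Lemma dual_density_ge0 p : S p -> 0 <= dual_density K lambda p.
Proof. by move=> p1; rewrite ltW// dual_density_gt0//; exact: enorm1_neq0. Qed.

Lemma dual_boundary_fin : (hausdorff n N < +oo)%E.
Proof.
rewrite -(dual_image Kbody KC2 lambda0).
apply: (jacobian_image_fin (J := dual_density K lambda)) => //.
- exact: dual_within.
- exact: dual_inj.
- exact: dual_density_ge0.
- by move=> p p1; exact: dual_has_jacobian.
Qed.

Lemma dual_integral g : {within N, continuous g} ->
  hausdorff_integral n N g =
  kappa^-1 ^+ n * hausdorff_integral n S (fun p => g (w p) * entropy_weight lambda p).
Proof.
rewrite -(dual_image Kbody KC2 lambda0) => gc.
have gwc : {within S, continuous (fun p => g (w p))}.
  exact: within_continuous_image (dual_within Kbody lambda0) gc.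
rewrite (change_of_variables (J := dual_density K lambda) (S := S)) //.
- rewrite -compact_integralZ//; last by apply: withinM => //; exact: (within_weight pos).
  by apply: compact_integral_eq => p p1; rewrite dual_densityE//; ring.
- exact: dual_within.
- exact: dual_inj.
- exact: within_dual_density.
- exact: dual_density_ge0.
- by move=> p p1; exact: dual_has_jacobian.
- by apply: (withinM (f := fun p => g (w p))) => //; exact: within_dual_density.
Qed.

Lemma weight_gt0 p : 0 < entropy_weight lambda p.
Proof. by rewrite mulr_gt0 ?exprn_gt0 ?invr_gt0 ?sqrt1D_gt0. Qed.

Lemma weight_integral_gt0 : 0 < hausdorff_integral n S (entropy_weight lambda).
Proof.
have ic : {within S, continuous (fun p => (entropy_weight lambda p)^-1)}.
  apply: (within_comp (phi := GRing.inv) (within_weight pos)) => p _.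
  by apply: inv_continuous; rewrite gt_eqF// weight_gt0.
have [L L0 wL] := compact_bound Sc ic.
have S0 := compact_mu_gt0 Sfin (sphere_gt0 Kbody KC2).
apply: (@lt_le_trans _ _ (hausdorff_integral n S (fun=> L^-1))).
  by rewrite compact_integral_cst// mulr_gt0// invr_gt0.
apply: compact_integral_le => //; [exact: within_cst|exact: (within_weight pos)|].
move=> p p1; have w0 := weight_gt0 p; have := wL p p1.
rewrite gtr0_norm ?invr_gt0// => wi.
by rewrite -[leRHS]invrK lef_pV2 ?posrE ?invr_gt0.
Qed.

Lemma dual_boundary_measure :
  fine (hausdorff n N) = kappa^-1 ^+ n * hausdorff_integral n S (entropy_weight lambda).
Proof.
have := dual_integral (@within_cst R _ N 1).
rewrite (compact_integral_cst n dual_boundary_compact) ?mul1r.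
by move=> ->; congr (_ * _); apply: compact_integral_eq => p _; rewrite mul1r.
Qed.

Lemma dual_boundary_gt0 : (0 < hausdorff n N)%E.
Proof.
have : 0 < fine (hausdorff n N).
  by rewrite dual_boundary_measure mulr_gt0// weight_integral_gt0.
move=> mu0; rewrite lt_neqAle hausdorff_ge0 andbT; apply/eqP => E.
by move: mu0; rewrite -E ltxx.
Qed.

Lemma log_curvature_average :
  hausdorff_integral n N (fun v => ln (f v)) / fine (hausdorff n N) =
  n%:R * ln lambda - entropy_average lambda.
Proof.
have w0 := weight_integral_gt0.
rewrite dual_boundary_measure dual_integral; last first.
  by apply: within_ln; [exact: within_curvature_s|exact: curvature_s_gt0].
rewrite -mulf_div divff ?gt_eqF// mul1r /entropy_average.
set I := hausdorff_integral n S (entropy_weight lambda) in w0 *.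
have dwc := withinM (within_density pos) (within_weight pos).
have -> : hausdorff_integral n S (fun p => ln (f (w p)) * entropy_weight lambda p) =
    hausdorff_integral n S (fun p => n%:R * ln lambda * entropy_weight lambda p +
      -1 * (entropy_density lambda p * entropy_weight lambda p)).
  by apply: compact_integral_eq => p p1; have [_ ->] := curvature_sE p1; ring.
rewrite compact_integralD//; last 2 first.
- by apply: withinM; [exact: within_cst|exact: (within_weight pos)].
- by apply: withinM; first exact: within_cst.
rewrite compact_integralZ//; last exact: (within_weight pos).
rewrite compact_integralZ// -/I mulN1r mulrBl mulfK// gt_eqF//.
Qed.

(** With p = q / (d + q) the exponent 1 + d / q equals 1 / p, so the quotient is the p-mean of the
    curvature for the normalized boundary measure, and tends to the geometric mean. *)
Lemma entropy_quotient_cvg :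
  entropy_quotient lambda (gnomonic_preimage lambda K) q @[q --> 0^'+] -->
  expR (n%:R * ln lambda - entropy_average lambda).
Proof.
have [L [dl [dl0 L0 bnd]]] := power_mean_bounds dual_boundary_compact dual_boundary_fin
  dual_boundary_gt0 within_curvature_s curvature_s_gt0.
rewrite log_curvature_average in bnd; set a := _ - _ in bnd *.
pose d : R := n.+1%:R; have d0 : 0 < d by rewrite ltr0n.
pose A q := hausdorff_integral n N (fun x => f x `^ (q / (d + q))) / fine (hausdorff n N).
have perE : perimeter lambda D = fine (hausdorff n N).
  rewrite /perimeter /Omega mul0r.
  rewrite (@compact_integral_eq R _ n N _ (fun=> 1)); last by move=> v _; rewrite powRr0.
  by rewrite (compact_integral_cst n dual_boundary_compact) mul1r.
have est q : 0 < q < dl -> a <= ln (A q) * (1 + d / q) <= a + q * L /\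
    entropy_quotient lambda (gnomonic_preimage lambda K) q = expR (ln (A q) * (1 + d / q)).
  move=> /andP[q0 qd]; have dq : 0 < d + q by rewrite addr_gt0.
  have p0 : 0 < q / (d + q) by rewrite divr_gt0.
  have d1 : 1 <= d by rewrite /d ler1n.
  (* Since d is at least 1, the bound [dl] on q also applies to p = q / (d + q), and the error p L
     is at most q L. *)
  have pq : q / (d + q) <= q by rewrite ler_pdivrMr// ler_pMr//; lra.
  have [|A0 /andP[b1 b2]] := bnd (q / (d + q)); first by rewrite p0 (le_lt_trans pq).
  have iE : (q / (d + q))^-1 = 1 + d / q.
    by rewrite invf_div mulrDl divff ?gt_eqF// addrC.
  rewrite iE in b1 b2; split.
    by rewrite b1 /=; apply: le_trans b2 _; rewrite lerD2l ler_wpM2r.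
  by rewrite /entropy_quotient perE /powR gt_eqF// mulrC.
have near0 : \forall q \near (0 : R)^'+, 0 < q < dl.
  by near=> q; apply/andP; split; near: q; [exact: nbhs_right_gt|exact: nbhs_right_lt].
have lim : ln (A q) * (1 + d / q) @[q --> 0^'+] --> a.
  apply: (@squeeze_cvgr _ _ _ _ (fun=> a) (fun q => a + q * L)).
  - by apply: filterS near0 => q /est[].
  - exact: cvg_cst.
  rewrite -[X in _ --> X]addr0 -[X in _ --> _ + X](mul0r L).
  apply: cvgD; first exact: cvg_cst.
  apply: cvgM; last exact: cvg_cst.
  exact: (cvg_at_right_filter cvg_id).
apply: (cvg_trans _ (continuous_cvg _ (@continuous_expR R a) lim)).
apply: near_eq_cvg; apply: filterS near0 => q /est[_ ->]; by [].
Unshelve. all: by end_near.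
Qed.

(** The factor [lambda]^(-(d-1)) in the entropy power cancels the term (d - 1) ln [lambda], which
    would diverge at 0. *)
Lemma curvature_entropyE :
  curvature_entropy lambda (gnomonic_preimage lambda K) = entropy_average lambda.
Proof.
rewrite /curvature_entropy /entropy_power (cvg_lim _ entropy_quotient_cvg)//.
rewrite -exprVn lnM ?posrE ?expR_gt0 ?exprn_gt0 ?invr_gt0//.
rewrite lnXn ?invr_gt0// lnV ?posrE// expRK -[_ *+ _]mulr_natl [_.-1]/=; ring.
Qed.

End positive_curvature.

Lemma spherical_entropyE :
  spherical_entropy (gnomonic_preimage 1 K) = entropy_average 1.
Proof.
rewrite /spherical_entropy (cvg_lim _ (entropy_quotient_cvg ltr01))// expRK ln1.
by rewrite mulr0 sub0r opprK.
Qed.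

Lemma gaussian_entropy_average : gaussian_entropy K = entropy_average 0.
Proof.
have w1 p : S p -> entropy_weight 0 p = 1.
  by move=> _; rewrite /entropy_weight !mul0r addr0 sqrtr1 invr1 expr1n mulr1.
rewrite gaussian_entropyE /entropy_average (compact_integral_eq n w1).
rewrite compact_integral_cst// mul1r; congr (_ / _).
apply: compact_integral_eq => p p1; rewrite w1// mulr1 /entropy_density.
by rewrite !mul0r addr0 subrr mulr0 subr0.
Qed.

End entropies.

(** * Continuity of the entropy average in the curvature parameter *)

Section continuity.
Context (R : realType) (m : nat).
Local Notation n := m.+1.
Context (K : set 'rV[R]_n.+1).
Hypotheses (Kbody : convex_body K) (KC2 : @C2_plus R n.+1 K).
Local Notation xm := (support_point K).
Local Notation h := (support_fun K).
Local Notation S := [set p : 'rV[R]_n.+1 | enorm p = 1].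
Local Notation curv p := (curvature_e K (xm p)).

Let Sc : compact S := unit_sphere_compact (n := n).
Let Sfin : (hausdorff n S < +oo)%E := sphere_fin Kbody KC2.

Lemma parametric_integral_continuous (f : R -> 'rV[R]_n.+1 -> R) (u v C l : R) :
  u < l < v ->
  (forall t, u < t < v -> {within S, continuous (f t)}) ->
  (forall t p, u < t < v -> S p -> {for t, continuous (fun t => f t p)}) ->
  (forall t p, u < t < v -> S p -> `|f t p| <= C) ->
  {for l, continuous (fun t => hausdorff_integral n S (f t))}.
Proof.
move=> ulv fc fc' fC.
have I t : `]u, v[%classic t -> u < t < v by rewrite /= in_itv.
have := @continuity_under_integral R _ _ (@hausdorff_measure R n.+1 n) f S
  (compact_measurable n Sc) u v.
move=> /(_ _ _ (fun=> C)) H; apply: H.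
- move=> t /I ut; apply: (compact_integrable Sc Sfin); exact: fc.
- by apply: aeW => p p1 t /set_mem/I ut; exact: fc'.
- by apply: (compact_integrable Sc Sfin); exact: within_cst.
- by move=> t /I ut; apply: aeW => p p1; exact: fC.
- by apply: mem_set; rewrite /= in_itv.
Qed.

Lemma ln_bound (s U : R) : 1 / 2 <= s <= U -> `|ln s| <= U + 1.
Proof.
move=> /andP[s1 s2]; have s0 : 0 < s by lra.
have l1 : ln s <= s - 1.
  have := @le_ln1Dx R (s - 1); rewrite (addrC 1) subrK; apply; lra.
have l2 : ln s^-1 <= s^-1 - 1.
  have si0 : 0 < s^-1 by rewrite invr_gt0.
  by have := @le_ln1Dx R (s^-1 - 1); rewrite (addrC 1) subrK; apply; lra.
rewrite lnV ?posrE// in l2.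
have s3 : s^-1 <= 2.
  by rewrite -[leRHS]invrK lef_pV2 ?posrE ?invr_gt0//; lra.
by rewrite ler_norml; apply/andP; split; lra.
Qed.

Lemma entropy_average_continuous : exists2 dl, 0 < dl & forall l, - dl < l < 2 ->
  admissible K l /\
  {for l, continuous (fun t => hausdorff_integral n S (entropy_weight K t))} /\
  {for l, continuous (fun t => hausdorff_integral n S
     (fun p => entropy_density K t p * entropy_weight K t p))}.
Proof.
have [B B0 [_ KB]] := support_fun_lipschitz Kbody.
have xB p : enorm (xm p) <= B by apply: KB; have [] := support_pointP Kbody p.
have hB p : S p -> `|h p| <= B.
  move=> p1; apply: le_trans (xB p); apply: le_trans (cauchy_schwarz _ _) _.
  by rewrite p1 mulr1.
(* For t greater than - dl and s of size at most B, the quantity 1 + t s^2 stays above 1/2. The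
   resulting bounds are uniform on the interval from - dl to 2, which contains 0 and 1 in its
   interior, so dominated convergence applies at both. *)
pose dl := 1 / (2 * B ^+ 2); have B2 : 0 < B ^+ 2 by rewrite exprn_gt0.
have dl0 : 0 < dl by rewrite divr_gt0// mulr_gt0.
have key t s : - dl < t < 2 -> `|s| <= B -> 1 / 2 <= 1 + t * s ^+ 2 <= 1 + 2 * B ^+ 2.
  move=> /andP[t1 t2] sB.
  have s2 : s ^+ 2 <= B ^+ 2 by rewrite -real_normK ?num_real// lerXn2r ?nnegrE ?(ltW B0).
  have s0 : 0 <= s ^+ 2 by exact: sqr_ge0.
  have dB : dl * B ^+ 2 = 1 / 2 by rewrite /dl; field; rewrite gt_eqF.
  apply/andP; split.
    have : - dl * s ^+ 2 <= t * s ^+ 2 by rewrite ler_wpM2r// ltW.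
    have : dl * s ^+ 2 <= dl * B ^+ 2 by rewrite ler_wpM2l// ltW.
    lra.
  have : t * s ^+ 2 <= 2 * s ^+ 2 by rewrite ler_wpM2r// ltW.
  lra.
pose U : R := 1 + 2 * B ^+ 2.
have U1 : 1 <= U by rewrite /U; lra.
have skey t s : - dl < t < 2 -> `|s| <= B -> 1 / 2 <= Num.sqrt (1 + t * s ^+ 2) <= U.
  move=> tI sB; have /andP[k1 k2] := key t s tI sB.
  have p0 : 0 < 1 + t * s ^+ 2 by lra.
  set r := Num.sqrt _; have r0 : 0 <= r by exact: sqrtr_ge0.
  have r2 : r ^+ 2 = 1 + t * s ^+ 2 by rewrite sqr_sqrtr// ltW.
  apply/andP; split.
    rewrite leNgt; apply/negP => r1.
    have : r * r < 1 / 2 * (1 / 2) by rewrite ltr_pM.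
    by rewrite -expr2 r2; lra.
  rewrite leNgt; apply/negP => r1.
  have : U * 1 < r * r by apply: ltr_pM => //; lra.
  by rewrite -expr2 r2 mulr1 /U; lra.
have xB' p : `|enorm (xm p)| <= B by rewrite ger0_norm ?enorm_ge0.
have wb t p : - dl < t < 2 -> S p -> `|entropy_weight K t p| <= U * 2 ^+ n.+1.
  move=> tI p1; rewrite /entropy_weight normrM ler_pM//.
    have /andP[? ?] := skey t _ tI (xB' p); rewrite ger0_norm ?sqrtr_ge0//.
  rewrite normrX lerXn2r ?nnegrE//.
  have /andP[k1 _] := skey t _ tI (hB p p1).
  rewrite ger0_norm ?invr_ge0 ?sqrtr_ge0//.
  by rewrite -[leRHS]invrK lef_pV2 ?posrE ?invr_gt0//; lra.
have [L L0 HL] := compact_bound Sc (within_log_curvature Kbody KC2).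
pose C := L + n.+2%:R * ((U + 1) + (U + 1)).
have db t p : - dl < t < 2 -> S p -> `|entropy_density K t p| <= C.
  move=> tI p1; apply: le_trans (ler_normB _ _) _; apply: lerD; first exact: HL.
  rewrite normrM ger0_norm// ler_wpM2l//; apply: le_trans (ler_normB _ _) _.
  by apply: lerD; apply: ln_bound; [exact: skey (hB p p1)|exact: skey (xB' p)].
have adm t : - dl < t < 2 -> admissible K t.
  move=> tI p p1; have /andP[k1 _] := key t _ tI (hB p p1).
  by have /andP[k2 _] := key t _ tI (xB' p); split; lra.
have lin (s t : R) : {for t, continuous (fun t : R => 1 + t * s ^+ 2)}.
  have c1 : {for t, continuous (fun t : R => t * s ^+ 2)}.
    exact: (@cvgM _ _ _ _ _ _ _ _ cvg_id (cvg_cst _)).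
  exact: (@cvgD _ _ _ _ _ _ _ _ _ (cvg_cst _) c1).
have sq (s t : R) : {for t, continuous (fun t : R => Num.sqrt (1 + t * s ^+ 2))}.
  exact: (continuous_comp (lin s t) (@sqrt_continuous R _)).
have wc (t : R) p : - dl < t < 2 -> S p -> {for t, continuous (fun t : R => entropy_weight K t p)}.
  move=> tI p1; apply: continuousM; first exact: sq.
  have i0 : Num.sqrt (1 + t * h p ^+ 2) != 0.
    by rewrite gt_eqF// sqrtr_gt0; have [] := adm t tI p p1.
  have c1 : {for t, continuous (fun t : R => (Num.sqrt (1 + t * h p ^+ 2))^-1)}.
    exact: (cvgV i0 (sq (h p) t)).
  exact: (@continuous_comp _ _ _ _ (fun t : R => t ^+ n.+1) _ c1 (@exprn_continuous R n.+1 _)).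
have dc (t : R) p : - dl < t < 2 -> S p -> {for t, continuous (fun t : R => entropy_density K t p)}.
  move=> tI p1; have [a1 a2] := adm t tI p p1.
  have lnc (s : R) : 0 < 1 + t * s ^+ 2 -> {for t, continuous (fun t : R => ln (Num.sqrt (1 + t * s ^+ 2)))}.
    move=> s0; apply: (continuous_comp (sq s t)); apply: continuous_ln.
    by rewrite sqrtr_gt0.
  apply: continuousB; first exact: cst_continuous.
  apply: continuousM; first exact: cst_continuous.
  exact: (continuousB (lnc _ a1) (lnc _ a2)).
exists dl => // l lI; split; first exact: adm; split.
  apply: (parametric_integral_continuous lI _ _ wb) => //.
  by move=> t /adm; exact: within_weight.
apply: (@parametric_integral_continuous (fun t p => entropy_density K t p * entropy_weight K t p)
  _ _ (C * (U * 2 ^+ n.+1)) _ lI).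
- by move=> t /adm tI; apply: withinM; [exact: within_density|exact: within_weight].
- by move=> t p tI p1; apply: continuousM; [exact: dc|exact: wc].
- by move=> t p tI p1; rewrite normrM ler_pM ?db ?wb.
Qed.

Lemma entropy_average_at (l : R) : l = 0 \/ l = 1 -> {for l, continuous (entropy_average K)}.
Proof.
have [dl dl0 H] := entropy_average_continuous => l01.
have lI : - dl < l < 2 by case: l01 => ->; rewrite ?oppr_lt0 ?dl0//=; lra.
have [_ [c1 c2]] := H l lI.
have w0 : hausdorff_integral n S (entropy_weight K l) != 0.
  rewrite gt_eqF//; case: l01 => ->; last exact: weight_integral_gt0.
  have w1 p : S p -> entropy_weight K 0 p = 1.
    by move=> _; rewrite /entropy_weight !mul0r addr0 sqrtr1 invr1 expr1n mulr1.
  rewrite (compact_integral_eq n w1) compact_integral_cst// mul1r.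
  exact: compact_mu_gt0 Sfin (sphere_gt0 Kbody KC2).
exact: (continuousM c2 (cvgV w0 c1)).
Qed.

End continuity.

Theorem corollary9p18 (R : realType) (d : nat) (K : set 'rV[R]_d) :
  (2 <= d)%N -> convex_body K -> C2_plus K ->
  [/\ (* the limits defining the entropies exist and have a logarithm *)
      forall lambda : R, 0 < lambda ->
        exists2 l : R, 0 < l &
          entropy_quotient lambda (gnomonic_preimage lambda K) q
            @[q --> 0^'+] --> l,
      curvature_entropy lambda (gnomonic_preimage lambda K)
        @[lambda --> 0^'+] --> gaussian_entropy K
    & curvature_entropy lambda (gnomonic_preimage lambda K)
        @[lambda --> (1 : R)^'] --> spherical_entropy (gnomonic_preimage 1 K)].
Proof.
(* Writing d as [m.+2] makes the dimension [d.-1] of the hypersurfaces a successor, as the results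
   on scaling factors require. *)
case: d K => [//|[//|m]] K _ Kbody KC2; split.
- move=> lambda lambda0; eexists; last exact: entropy_quotient_cvg.
  exact: expR_gt0.
- rewrite (gaussian_entropy_average Kbody KC2).
  apply: (@cvg_trans _ (entropy_average K l @[l --> 0^'+])); last first.
    by apply: cvg_at_right_filter; apply: (entropy_average_at Kbody KC2); left.
  apply: near_eq_cvg; near=> l; apply/esym/(curvature_entropyE Kbody KC2).
  by near: l; exact: nbhs_right_gt.
- rewrite (spherical_entropyE Kbody KC2).
  apply: (@cvg_trans _ (entropy_average K l @[l --> (1 : R)^'])); last first.
    apply: cvg_trans (entropy_average_at Kbody KC2 (or_intror erefl)).
    by apply: cvg_app; exact: nbhs_dnbhs.
  apply: near_eq_cvg; near=> l; apply/esym/(curvature_entropyE Kbody KC2).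
  by near: l; apply: nbhs_dnbhs; apply: open_nbhs_nbhs; split; [exact: open_gt|exact: ltr01].
Unshelve. all: by end_near.
Qed.
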